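(* Let $X=U=L^2(0,1)$ (real-valued functions), $S=L^\infty(0,1)$, $B=I$ (the identity operator), let $\sigma=\mathfrak{sat}:L^2(0,1)\to L^2(0,1)$ be given by $\mathfrak{sat}(u)(\xi)=\mathrm{sat}_{\mathbb{R}}(u(\xi))$, where $\mathrm{sat}_{\mathbb{R}}(z)=z/|z|$ for $|z|\ge 1$ and $\mathrm{sat}_{\mathbb{R}}(z)=z$ for $z\in(-1,1)$, and let $$A=\frac{d}{d\xi},\qquad D(A)=\{y\in H^1(0,1)\mid y(0)=y(1)\}.$$ Consider the unsaturated system $$(\Sigma_L)\qquad \dot x(t)=Ax(t)-BB^*x(t),\quad x(0)=x_0,$$ and the disturbed saturated system $$(\Sigma_{SLD})\qquad \dot x(t)=Ax(t)-B\sigma\big(B^*x(t)+d(t)\big),\quad x(0)=x_0.$$ Then the following assertions hold. (i) System $(\Sigma_L)$ is UGAS. Moreover, writing $\widetilde A=A-BB^*$ with $D(\widetilde A)=D(A)$, there exists a bounded self-adjoint operator $P$ on $X$ which maps $D(A)$ to $D(A)$ and satisfies $$\langle \widetilde A x,Px\rangle+\langle Px,\widetilde A x\rangle\le -\langle x,x\rangle\qquad\text{for all }x\in D(A),$$ and there exists $c>0$ such that $\|B^*x\|_S\le c\|x\|_{D(A)}$ for all $x\in D(A)$. (ii) System $(\Sigma_{SLD})$ is semi-globally exponentially stable in $D(A)$. (iii) System $(\Sigma_{SLD})$ is neither UGAS nor ISS.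
   Context: $A$ generates a strongly continuous contraction semigroup $(T(t))_{t\ge0}$ on the Hilbert space $X$, $B$ is a bounded linear operator from $U$ to $X$, and $\|x\|_{D(A)}:=\|x\|_X+\|Ax\|_X$. Mild solutions: for $x_0\in X$, $d\in L^\infty_{\mathrm{loc}}(0,\infty;U)$ and $t_1>0$, a continuous $x:[0,t_1]\to X$ with $$x(t)=T(t)x_0-\int_0^tT(t-s)B\sigma\big(B^*x(s)+d(s)\big)\,ds,\quad t\in[0,t_1],$$ is a mild solution of $(\Sigma_{SLD})$ on $[0,t_1]$. It is called global if it is defined on $[0,\infty)$ and its restriction to each $[0,t_1]$ is a mild solution. For given $x_0,d$ there is a unique mild solution on a maximal interval; ''every mild solution is global'' means this maximal interval is $[0,\infty)$. System $(\Sigma_L)$ is the special case of $(\Sigma_{SLD})$ with $\sigma(u)=u$ and $d=0$, and the notions below apply to it accordingly. Comparison functions ($\mathbb{R}_+=[0,\infty)$): $\mathcal K$ is the set of continuous strictly increasing $\alpha:\mathbb{R}_+\to\mathbb{R}_+$ with $\alpha(0)=0$; $\mathcal K_\infty$ is the set of unbounded $\alpha\in\mathcal K$; $\mathcal L$ is the set of continuous strictly decreasing $\alpha:\mathbb{R}_+\to\mathbb{R}_+$ with $\lim_{t\to\infty}\alpha(t)=0$; $\mathcal{KL}$ is the set of continuous $\beta:\mathbb{R}_+\times\mathbb{R}_+\to\mathbb{R}_+$ with $\beta(\cdot,t)\in\mathcal K$ for all $t>0$ and $\beta(r,\cdot)\in\mathcal L$ for all $r>0$. ISS (input-to-state stable):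 there exist $\beta\in\mathcal{KL}$ and $\rho\in\mathcal K_\infty$ such that for every $x_0\in X$ and every disturbance $d$ the mild solution $x$ is global and $$\|x(t)\|_X\le\beta(\|x_0\|_X,t)+\rho(\|d\|_{L^\infty(0,t;U)})\quad\text{for all }t\ge0.$$ UGAS (uniformly globally asymptotically stable): this holds for $d\equiv0$ and all $x_0\in X$, i.e. there is $\beta\in\mathcal{KL}$ such that every mild solution with $d\equiv 0$ is global and satisfies $\|x(t)\|_X\le\beta(\|x_0\|_X,t)$ for all $t\ge0$. Semi-globally exponentially stable in $D(A)$: for $d=0$ and any $r>0$ there exist $\mu(r)>0$ and $K(r)>0$ such that any mild solution $x$ with initial value $x_0\in D(A)$ is global and satisfies $\|x(t)\|_X\le K(r)e^{-\mu(r)t}\|x_0\|_X$ for all $t\ge0$ whenever $\|x_0\|_{D(A)}\le r$. *)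

(* Defs.v *)
From HB Require Import structures.
From mathcomp Require Import all_boot all_order all_algebra generic_quotient.
From mathcomp Require Import all_classical all_reals all_analysis.
From mathcomp Require Import ess_sup_inf hoelder measurable_realfun.
Set Implicit Arguments. Unset Strict Implicit. Unset Printing Implicit Defensive.
Import Order.TTheory GRing.Theory Num.Theory.
Import numFieldNormedType.Exports.
Local Open Scope classical_set_scope.
Local Open Scope ring_scope.

(* The library provides [LspaceType mu p1], the type of a.e.-classes of functions
   with finite p-norm, without any algebraic or topological structure.  We turn
   it into a normed module for the pointwise a.e. operations and the p-norm. *)
Section LpSpace.
Context d (T : measurableType d) (R : realType).
Variables (mu : {measure set T -> \bar R}) (p : \bar R) (p1 : (1 <= p)%E).
Local Notation L := (LspaceType mu p1).

Definition Lrepr (x : L) : T -> R := repr (LebesgueSpace.sort x).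

Lemma Lrepr_measurable (x : L) : measurable_fun setT (Lrepr x).
Proof. by rewrite /Lrepr; case: (repr _) => f /= [[h]]. Qed.

Lemma Lrepr_Lfun (x : L) : Lrepr x \in Lfun mu p.
Proof.
apply/andP; split; rewrite inE /=; first exact: Lrepr_measurable.
exact: (@Lebesgue_finite _ _ _ _ _ _ x).
Qed.

Lemma ae_eq_Lnorm (f g : T -> R) :
    measurable_fun setT f -> measurable_fun setT g -> f = g %[ae mu] ->
  ('N[mu]_p[EFin \o f] = 'N[mu]_p[EFin \o g])%E.
Proof.
move=> mf mg fg; rewrite unlock /Lnorm; case: p p1 => [r r1|_|//]; last first.
  case: ifPn => // _; apply: eq_ess_sup.
  by apply: filterS fg => x /= ->.
congr (_ `^ _)%E; apply: ae_eq_integral => //.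
- apply/measurable_EFinP; apply: (measurableT_comp (measurable_powR _)) => //.
  exact: measurableT_comp.
- apply/measurable_EFinP; apply: (measurableT_comp (measurable_powR _)) => //.
  exact: measurableT_comp.
- by apply: filterS fg => x /= fg _; rewrite fg.
Qed.

Section Lclass.
Variables (f : T -> R) (fL : f \in Lfun mu p).

Let mf : measurable_fun setT f.
Proof. by move: fL => /andP[/[!inE]]. Qed.

Let fm : {mfun T >-> measurableTypeR R} :=
  MeasurableFun.Pack (MeasurableFun.Class
    (@isMeasurableFun.Build d _ T (measurableTypeR R) f mf)).
Let q : {mfun_ mu, T >-> measurableTypeR R} := \pi_({mfun_ mu, T >-> measurableTypeR R})%qT fm.

Let reprq : (repr q : T -> R) = f %[ae mu].
Proof.
have /eqP : repr q = fm %[mod {mfun_ mu, T >-> measurableTypeR R}]%qT by rewrite reprK.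
rewrite eqmodE => /asboolP. exact.
Qed.

Let q_finite : finite_norm mu p (repr q : T -> R).
Proof.
rewrite /finite_norm (@ae_eq_Lnorm _ f)//.
  by move: fL => /andP[_ /[!inE]].
by case: (repr q) => g [[]].
Qed.

Definition Lclass : L :=
  LebesgueSpace.Pack (LebesgueSpace.Class (isFinLebesgue.Build d T R mu p p1 q q_finite)).

Lemma LclassK : Lrepr Lclass = f %[ae mu].
Proof. exact: reprq. Qed.

End Lclass.

Lemma Lspace_eqP (x y : L) : x = y <-> Lrepr x = Lrepr y %[ae mu].
Proof.
split=> [->|xy]; first by apply: (ae_eq_refl mu setT).
case: x y xy => [x [[xP]]] [y [[yP]]]; rewrite /Lrepr /= => xy.
have E : x = y.
  rewrite -[x]reprK -[y]reprK; apply/eqP; rewrite eqmodE; exact/asboolP.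
by case: _ / E yP {xy} => yP; rewrite (Prop_irrelevance xP yP).
Qed.

Lemma Lp_add_subproof (x y : L) : Lrepr x \+ Lrepr y \in Lfun mu p.
Proof. exact: (Lfun_addr_closed mu p1).2 (Lrepr_Lfun x) (Lrepr_Lfun y). Qed.

Lemma Lp_opp_subproof (x : L) : \- Lrepr x \in Lfun mu p.
Proof. exact: (Lfun_oppr_closed (Lrepr_Lfun x)). Qed.

Lemma Lp_zero_subproof : cst 0 \in Lfun mu p.
Proof. exact: (Lfun_addr_closed mu p1).1. Qed.

Lemma Lp_scale_subproof (a : R) (x : L) : a \*: Lrepr x \in Lfun mu p.
Proof.
have := (Lfun_submod_closed mu p1).2 a _ _ (Lrepr_Lfun x) Lp_zero_subproof.
by rewrite (_ : _ + _ = a \*: Lrepr x)//; apply/funext => t; exact: addr0.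
Qed.

Definition Lp_zero : L := Lclass Lp_zero_subproof.
Definition Lp_add (x y : L) : L := Lclass (Lp_add_subproof x y).
Definition Lp_opp (x : L) : L := Lclass (Lp_opp_subproof x).
Definition Lp_scale (a : R) (x : L) : L := Lclass (Lp_scale_subproof a x).
Definition Lp_norm (x : L) : R := fine ('N[mu]_p[EFin \o Lrepr x])%E.

HB.instance Definition _ := gen_eqMixin L.
HB.instance Definition _ := gen_choiceMixin L.


Lemma Lrepr_add x y : Lrepr (Lp_add x y) = Lrepr x \+ Lrepr y %[ae mu].
Proof. exact: LclassK. Qed.
Lemma Lrepr_opp x : Lrepr (Lp_opp x) = \- Lrepr x %[ae mu].
Proof. exact: LclassK. Qed.
Lemma Lrepr_zero : Lrepr Lp_zero = cst 0 %[ae mu].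
Proof. exact: LclassK. Qed.
Lemma Lrepr_scale a x : Lrepr (Lp_scale a x) = a \*: Lrepr x %[ae mu].
Proof. exact: LclassK. Qed.

Fact Lp_addA : associative Lp_add.
Proof.
move=> x y z; apply/Lspace_eqP; near=> t => _.
have -> //: Lrepr (Lp_add x (Lp_add y z)) t = Lrepr x t + Lrepr (Lp_add y z) t.
  by near: t; apply: filterS (Lrepr_add _ _) => t; apply.
have -> //: Lrepr (Lp_add (Lp_add x y) z) t = Lrepr (Lp_add x y) t + Lrepr z t.
  by near: t; apply: filterS (Lrepr_add _ _) => t; apply.
have -> //: Lrepr (Lp_add x y) t = Lrepr x t + Lrepr y t.
  by near: t; apply: filterS (Lrepr_add _ _) => t; apply.
have -> //: Lrepr (Lp_add y z) t = Lrepr y t + Lrepr z t.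
  by near: t; apply: filterS (Lrepr_add _ _) => t; apply.
exact: addrA.
Unshelve. all: by end_near. Qed.

Fact Lp_addC : commutative Lp_add.
Proof.
move=> x y; apply/Lspace_eqP; near=> t => _.
have -> //: Lrepr (Lp_add x y) t = Lrepr x t + Lrepr y t.
  by near: t; apply: filterS (Lrepr_add _ _) => t; apply.
have -> //: Lrepr (Lp_add y x) t = Lrepr y t + Lrepr x t.
  by near: t; apply: filterS (Lrepr_add _ _) => t; apply.
exact: addrC.
Unshelve. all: by end_near. Qed.

Fact Lp_add0 : left_id Lp_zero Lp_add.
Proof.
move=> x; apply/Lspace_eqP; near=> t => _.
have -> //: Lrepr (Lp_add Lp_zero x) t = Lrepr Lp_zero t + Lrepr x t.
  by near: t; apply: filterS (Lrepr_add _ _) => t; apply.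
have -> //: Lrepr Lp_zero t = 0.
  by near: t; apply: filterS Lrepr_zero => t; apply.
exact: add0r.
Unshelve. all: by end_near. Qed.

Fact Lp_addN : left_inverse Lp_zero Lp_opp Lp_add.
Proof.
move=> x; apply/Lspace_eqP; near=> t => _.
have -> //: Lrepr (Lp_add (Lp_opp x) x) t = Lrepr (Lp_opp x) t + Lrepr x t.
  by near: t; apply: filterS (Lrepr_add _ _) => t; apply.
have -> //: Lrepr (Lp_opp x) t = - Lrepr x t.
  by near: t; apply: filterS (Lrepr_opp _) => t; apply.
have -> //: Lrepr Lp_zero t = 0.
  by near: t; apply: filterS Lrepr_zero => t; apply.
exact: addNr.
Unshelve. all: by end_near. Qed.

HB.instance Definition _ :=
  GRing.isZmodule.Build L Lp_addA Lp_addC Lp_add0 Lp_addN.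

Fact Lp_scaleA a b (x : L) : Lp_scale a (Lp_scale b x) = Lp_scale (a * b) x.
Proof.
apply/Lspace_eqP; near=> t => _.
have -> //: Lrepr (Lp_scale a (Lp_scale b x)) t = a * Lrepr (Lp_scale b x) t.
  by near: t; apply: filterS (Lrepr_scale _ _) => t; apply.
have -> //: Lrepr (Lp_scale b x) t = b * Lrepr x t.
  by near: t; apply: filterS (Lrepr_scale _ _) => t; apply.
have -> //: Lrepr (Lp_scale (a * b) x) t = a * b * Lrepr x t.
  by near: t; apply: filterS (Lrepr_scale _ _) => t; apply.
exact: mulrA.
Unshelve. all: by end_near. Qed.

Fact Lp_scale1 : left_id 1 Lp_scale.
Proof.
move=> x; apply/Lspace_eqP; near=> t => _.
have -> //: Lrepr (Lp_scale 1 x) t = 1 * Lrepr x t.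
  by near: t; apply: filterS (Lrepr_scale _ _) => t; apply.
exact: mul1r.
Unshelve. all: by end_near. Qed.

Fact Lp_scaleDr : right_distributive Lp_scale +%R.
Proof.
move=> a x y; apply/Lspace_eqP; near=> t => _.
have -> //: Lrepr (Lp_scale a (x + y)) t = a * Lrepr (x + y) t.
  by near: t; apply: filterS (Lrepr_scale _ _) => t; apply.
have -> //: Lrepr (x + y) t = Lrepr x t + Lrepr y t.
  by near: t; apply: filterS (Lrepr_add _ _) => t; apply.
have -> //: Lrepr (Lp_scale a x + Lp_scale a y) t =
    Lrepr (Lp_scale a x) t + Lrepr (Lp_scale a y) t.
  by near: t; apply: filterS (Lrepr_add _ _) => t; apply.
have -> //: Lrepr (Lp_scale a x) t = a * Lrepr x t.
  by near: t; apply: filterS (Lrepr_scale _ _) => t; apply.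
have -> //: Lrepr (Lp_scale a y) t = a * Lrepr y t.
  by near: t; apply: filterS (Lrepr_scale _ _) => t; apply.
exact: mulrDr.
Unshelve. all: by end_near. Qed.

Fact Lp_scaleDl (x : L) : {morph Lp_scale^~ x : a b / a + b}.
Proof.
move=> a b; apply/Lspace_eqP; near=> t => _.
have -> //: Lrepr (Lp_scale (a + b) x) t = (a + b) * Lrepr x t.
  by near: t; apply: filterS (Lrepr_scale _ _) => t; apply.
have -> //: Lrepr (Lp_scale a x + Lp_scale b x) t =
    Lrepr (Lp_scale a x) t + Lrepr (Lp_scale b x) t.
  by near: t; apply: filterS (Lrepr_add _ _) => t; apply.
have -> //: Lrepr (Lp_scale a x) t = a * Lrepr x t.
  by near: t; apply: filterS (Lrepr_scale _ _) => t; apply.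
have -> //: Lrepr (Lp_scale b x) t = b * Lrepr x t.
  by near: t; apply: filterS (Lrepr_scale _ _) => t; apply.
exact: mulrDl.
Unshelve. all: by end_near. Qed.

HB.instance Definition _ :=
  GRing.Zmodule_isLmodule.Build R L Lp_scaleA Lp_scale1 Lp_scaleDr Lp_scaleDl.

Lemma Lp_norm_fin (x : L) : ((Lp_norm x)%:E = 'N[mu]_p[EFin \o Lrepr x])%E.
Proof.
by rewrite /Lp_norm fineK// ge0_fin_numE ?Lnorm_ge0//; case/andP: (Lrepr_Lfun x) => _ /[!inE].
Qed.

Fact Lp_norm_triangle (x y : L) : Lp_norm (x + y) <= Lp_norm x + Lp_norm y.
Proof.
rewrite -lee_fin EFinD !Lp_norm_fin.
rewrite (@ae_eq_Lnorm _ (Lrepr x \+ Lrepr y)).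
- by apply: eminkowski => //; exact: Lrepr_measurable.
- exact: Lrepr_measurable.
- by apply: measurable_funD; exact: Lrepr_measurable.
- exact: Lrepr_add.
Qed.

Fact Lp_normZ (a : R) (x : L) : Lp_norm (a *: x) = `|a| * Lp_norm x.
Proof.
apply/EFin_inj; rewrite EFinM !Lp_norm_fin.
rewrite (@ae_eq_Lnorm _ (a \*: Lrepr x)).
- exact: (LnormZ (Lfun_Sub p1 (Lrepr_Lfun x)) a).
- exact: Lrepr_measurable.
- by apply: measurable_funM => //; exact: Lrepr_measurable.
- exact: Lrepr_scale.
Qed.

Fact Lp_norm_eq0 (x : L) : Lp_norm x = 0 -> x = 0.
Proof.
move=> x0; apply/Lspace_eqP.
have p0 : (0 < p)%E by exact: lt_le_trans lte01 p1.
have mx : measurable_fun setT (EFin \o Lrepr x).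
  by apply/measurable_EFinP; exact: Lrepr_measurable.
have := Lp_norm_fin x; rewrite x0 => /esym /(Lnorm_eq0_eq0 mx p0) xae.
near=> t => _.
have -> //: Lrepr (0 : L) t = 0.
  by near: t; apply: filterS Lrepr_zero => t; apply.
by near: t; apply: filterS xae => t /(_ I) [].
Unshelve. all: by end_near. Qed.

HB.instance Definition _ :=
  Lmodule_isNormed.Build R L Lp_norm_triangle Lp_normZ Lp_norm_eq0.


End LpSpace.

(* Bochner integral with respect to the Lebesgue measure.  It is given as a
   relation, because X is not assumed to be complete here; the value is unique
   whenever it exists.  [simple_integral] is only used on sets of finite measure
   (otherwise [fine] would send an infinite measure to 0). *)
Section Bochner.
Context (R : realType) (X : normedModType R).
Local Notation leb := (@lebesgue_measure R).

Definition simple_function (s : R -> X) : Prop :=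
  finite_set (range s) /\ forall v, measurable (s @^-1` [set v]).

Definition simple_integral (D : set R) (s : R -> X) : X :=
  \sum_(v \in range s) fine (leb (D `&` s @^-1` [set v])) *: v.

Definition strongly_measurable (D : set R) (f : R -> X) : Prop :=
  exists s_ : (R -> X)^nat, (forall n, simple_function (s_ n)) /\
    {ae leb, forall t, D t -> s_ n t @[n --> \oo] --> f t}.

Definition is_Bochner_integral (D : set R) (f : R -> X) (v : X) : Prop :=
  exists s_ : (R -> X)^nat,
    [/\ forall n, simple_function (s_ n),
        {ae leb, forall t, D t -> s_ n t @[n --> \oo] --> f t},
        (\int[leb]_(t in D) `|f t - s_ n t|%:E @[n --> \oo] --> 0)%E &
        simple_integral D (s_ n) @[n --> \oo] --> v].

(* Norm of L^oo(0,t;X), as an extended real; it is 0 for t = 0. *)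
Definition Linf_norm (t : R) (d : R -> X) : \bar R :=
  ('N[mrestr leb (measurable_itv `]0%R, t[)]_+oo[EFin \o (fun s => `|d s|%R)])%E.

Definition Linf_loc (d : R -> X) : Prop :=
  strongly_measurable `[0, +oo[ d /\
  forall t, 0 < t -> (Linf_norm t d < +oo)%E.

End Bochner.

(* Comparison functions live on [0,+oo[: they are total functions R -> R whose
   values at negative arguments are irrelevant.  Nonnegativity of the values is
   implied by the other clauses in [class_K] and [class_L]. *)
Section ComparisonFunctions.
Context (R : realType).

Definition class_K (alpha : R -> R) : Prop :=
  [/\ {within `[0, +oo[, continuous alpha},
      forall r s, 0 <= r -> r < s -> alpha r < alpha s & alpha 0 = 0].

Definition class_Kinf (alpha : R -> R) : Prop :=
  class_K alpha /\ forall M, exists2 r, 0 <= r & M < alpha r.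

Definition class_L (alpha : R -> R) : Prop :=
  [/\ {within `[0, +oo[, continuous alpha},
      forall r s, 0 <= r -> r < s -> alpha s < alpha r &
      alpha t @[t --> +oo] --> 0].

Definition class_KL (beta : R -> R -> R) : Prop :=
  [/\ {within [set z : R * R | 0 <= z.1 /\ 0 <= z.2],
         continuous (fun z => beta z.1 z.2)},
      forall r t, 0 <= r -> 0 <= t -> 0 <= beta r t,
      forall t, 0 < t -> class_K (beta ^~ t) &
      forall r, 0 < r -> class_L (beta r)].

End ComparisonFunctions.

Section Semigroups.
Context (R : realType) (X : normedModType R).

(* Only the operators T t with 0 <= t are meaningful. *)
Definition contraction_semigroup (T : R -> {linear X -> X}) : Prop :=
  [/\ forall x, T 0 x = x,
      forall s t, 0 <= s -> 0 <= t -> forall x, T (s + t) x = T s (T t x),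
      forall x, T t x @[t --> 0^'+] --> x &
      forall t, 0 <= t -> forall x, `|T t x| <= `|x| ].

(* An unbounded operator is a pair of a domain D and a map A whose values outside
   D are irrelevant. *)
Definition generates_contraction_semigroup (D : set X) (A : X -> X)
    (T : R -> {linear X -> X}) : Prop :=
  contraction_semigroup T /\
  forall x y, (D x /\ A x = y) <->
    (h^-1 *: (T h x - x) @[h --> 0^'+] --> y).

Definition graph_norm (A : X -> X) (x : X) : R := `|x| + `|A x|.

End Semigroups.

Section MildSolutions.
Context (R : realType) (X U : normedModType R).
Variables (T : R -> {linear X -> X}) (B : U -> X) (Bs : X -> U) (sigma : U -> U).

(* x is a function on R, but only its restriction to [0,t1] matters. *)
Definition mild_solution (x0 : X) (d : R -> U) (t1 : R) (x : R -> X) : Prop :=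
  {within `[0, t1], continuous x} /\
  forall t, 0 <= t <= t1 ->
    exists2 I : X,
      is_Bochner_integral `[0, t]
        (fun s => T (t - s) (B (sigma (Bs (x s) + d s)))) I &
      x t = T t x0 - I.

Definition global_mild_solution (x0 : X) (d : R -> U) (x : R -> X) : Prop :=
  forall t1, 0 < t1 -> mild_solution x0 d t1 x.

(* The maximal mild solution is defined on [0,+oo[: there is a global mild
   solution, and every mild solution on a compact interval extends to one. *)
Definition mild_solutions_global (x0 : X) (d : R -> U) : Prop :=
  (exists x, global_mild_solution x0 d x) /\
  forall t1 x, 0 < t1 -> mild_solution x0 d t1 x ->
    exists2 y, global_mild_solution x0 d y & forall t, 0 <= t <= t1 -> y t = x t.

Definition ISS : Prop :=
  exists beta rho, [/\ class_KL beta, class_Kinf rho &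
    forall x0 d, Linf_loc d -> mild_solutions_global x0 d /\
      forall x, global_mild_solution x0 d x -> forall t, 0 <= t ->
        `|x t| <= beta `|x0| t + rho (fine (Linf_norm t d))].

Definition UGAS : Prop :=
  exists2 beta, class_KL beta &
    forall x0, mild_solutions_global x0 (cst 0) /\
      forall x, global_mild_solution x0 (cst 0) x -> forall t, 0 <= t ->
        `|x t| <= beta `|x0| t.

Definition semiglobally_exponentially_stable (D : set X) (A : X -> X) : Prop :=
  forall r, 0 < r -> exists mu K : R, [/\ 0 < mu, 0 < K &
    forall x0, D x0 -> graph_norm A x0 <= r ->
      mild_solutions_global x0 (cst 0) /\
      forall x, global_mild_solution x0 (cst 0) x -> forall t, 0 <= t ->
        `|x t| <= K * expR (- mu * t) * `|x0| ].

End MildSolutions.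

Section L2_unit_interval.
Context (R : realType).

(* L^2(0,1) is realized by (classes of) Borel functions on R for the restriction
   of the Lebesgue measure to ]0,1[: all values outside ]0,1[ are irrelevant. *)
Definition mu01 : {measure set (measurableTypeR R) -> \bar R} :=
  mrestr (@lebesgue_measure R) (measurable_itv `]0%R, 1%R[).

Definition L2 : normedModType R := LspaceType2 mu01.

Definition inner (x y : L2) : R := \int[mu01]_t (Lrepr x t * Lrepr y t).

Definition is_adjoint (B Bs : L2 -> L2) : Prop :=
  forall u x, inner (B u) x = inner u (Bs x).

Definition test_function (phi : R -> R) : Prop :=
  [/\ forall t, derivable phi t 1, continuous (derive1 phi) &
      closure [set t | phi t != 0] `<=` `]0, 1[ ].

(* g is the derivative of y in the sense of distributions, tested, as is usual in
   one space dimension, against continuously differentiable functions with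
   compact support in ]0,1[. *)
Definition weak_derivative (y g : L2) : Prop :=
  forall phi, test_function phi ->
    \int[mu01]_t (Lrepr y t * derive1 phi t) = - \int[mu01]_t (Lrepr g t * phi t).

Definition H1 : set L2 := [set y | exists g, weak_derivative y g].

(* The weak derivative is unique in L^2; the default 0 is used outside H^1. *)
Definition ddxi (y : L2) : L2 := xget 0 [set g | weak_derivative y g].

(* The boundary values of y are those of its continuous representative c. *)
Definition H1_periodic : set L2 :=
  [set y | H1 y /\ exists c : R -> R,
    [/\ {within `[0, 1], continuous c}, Lrepr y = c %[ae mu01] & c 0 = c 1] ].

Definition sat_real (z : R) : R := if 1 <= `|z| then z / `|z| else z.

Lemma sat_real_norm z : `|sat_real z| <= `|z|.
Proof.
rewrite /sat_real; case: ifPn => // z1.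
rewrite normrM normfV normr_id divff//.
by rewrite gt_eqF// (lt_le_trans _ z1).
Qed.

Lemma measurable_sat_real : measurable_fun setT sat_real.
Proof.
have -> : sat_real = (fun z => Num.min z 1) \o (fun z => Num.max z (-1)).
  apply/funext => z; rewrite /sat_real /=; case: ifPn => z1.
    have [z0|z0] := leP 0 z.
      rewrite ger0_norm// in z1 *; rewrite max_l ?min_r ?divff//; first by rewrite gt_eqF// (lt_le_trans _ z1).
      exact: le_trans z0.
    rewrite ltr0_norm// in z1 *; rewrite max_r; last by rewrite lerNr.
    by rewrite invrN mulrN divff ?lt_eqF// min_l// (le_trans _ ler01)// oppr_le0.
  by move: z1; rewrite -ltNge ltr_norml => /andP[z1 z2]; rewrite max_l ?min_l// ltW.
apply: measurableT_comp; first by apply: measurable_minr.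
by apply: measurable_maxr.
Qed.

Lemma sat_Lfun (u : L2) : sat_real \o Lrepr u \in Lfun mu01 (2%:R)%:E.
Proof.
have mu_ := Lrepr_measurable u.
have msu : measurable_fun setT (sat_real \o Lrepr u).
  exact: measurableT_comp measurable_sat_real mu_.
apply/andP; split; rewrite inE //=.
have : finite_norm mu01 (2%:R)%:E (Lrepr u) by case/andP: (Lrepr_Lfun u) => _ /[!inE].
rewrite /finite_norm unlock /Lnorm => fu.
have m2 (f : R -> R) : measurable_fun setT f ->
    measurable_fun setT (fun t => (`|(EFin \o f) t| `^ 2%:R)%E).
  move=> mf; apply/measurable_EFinP; apply: (measurableT_comp (measurable_powR _)) => //.
  exact: measurableT_comp.
apply: le_lt_trans fu; apply: gt0_ler_poweR.
- by rewrite invr_ge0.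
- by rewrite in_itv /= leey integral_ge0// => t _; exact: poweR_ge0.
- by rewrite in_itv /= leey integral_ge0// => t _; exact: poweR_ge0.
apply: ge0_le_integral => //.
- by move=> t _; exact: poweR_ge0.
- exact: (m2 _ msu).
- exact: (m2 _ mu_).
by move=> t _ /=; rewrite lee_fin ge0_ler_powR// ?nnegrE// sat_real_norm.
Qed.

Definition sat (u : L2) : L2 := Lclass (lee1n 2) (sat_Lfun u).

End L2_unit_interval.

(* Main.v *)
(* The rotation group x |-> x(. + t) of the circle, which (d/dxi, periodic boundary
   conditions) generates, commutes with every pointwise nonlinearity.  Hence the mild
   solution is the rotation by t of the pointwise flow of the scalar equation
   z' = - z, resp. z' = - sat_real z.  The first flow is multiplication by expR (- t).
   The second one decays exponentially on bounded sets of values, and functions of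
   bounded graph norm are bounded; but it decreases values larger than 1 only at unit
   speed, so high pulses of norm 1 stay close to norm 1 for an arbitrarily long time.
   The generator is only known through the domain and the weak derivative, so that
   T is identified with the rotation group by the uniqueness of the semigroup
   generated by a dissipative operator, and the weak derivative is compared with the
   difference quotients of the rotations through the primitive of its candidate. *)
From HB Require Import structures.
Require Import Defs.
From mathcomp Require Import all_boot all_order all_algebra.
From mathcomp Require Import all_classical all_reals all_analysis.
From mathcomp Require Import ess_sup_inf hoelder measurable_realfun.
From mathcomp Require Import ring lra.
Set Implicit Arguments. Unset Strict Implicit. Unset Printing Implicit Defensive.
Import Order.TTheory GRing.Theory Num.Theory.
Import numFieldNormedType.Exports.
Local Open Scope classical_set_scope.
Local Open Scope ring_scope.

(** * The Hilbert space L^2(0,1) *)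

(** Window means [avg] tie the parts together. The mean of [g] over [[s, s + h]] is exactly the
    difference quotient of the rotations at a function with derivative [g], and the window mean of
    an arbitrary [x] lies in the domain. Hence the single convergence [avg_cvg] gives the derivative
    along rotations, the density of the domain and the strong continuity of the group. Integrals of
    [L2]-valued functions are never computed directly: tested against a fixed vector they become
    scalar integrals, to which the fundamental theorem of calculus and monotonicity apply. Testing
    an error against itself then recovers its norm; existence and uniqueness of mild solutions both
    rest on this. Existence asks of a flow a quadratic Taylor bound in norm, uniform in the values
    of the initial state; this is why the saturated flow is written with the explicit convex
    function [kappa]. Dissipativity of the generator makes half the identity a suitable [P]. ISS
    fails already at zero disturbance, where it contains the estimate of UGAS. *)

Lemma integrable_EFinD d (T : measurableType d) (R : realType)
    (m : {measure set T -> \bar R}) (D : set T) (f g : T -> R) : measurable D ->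
  m.-integrable D (EFin \o f) -> m.-integrable D (EFin \o g) ->
  m.-integrable D (EFin \o (fun s => f s + g s)).
Proof.
move=> mD fi gi; apply: (@eq_integrable _ _ _ m D mD ((EFin \o f) \+ (EFin \o g))%E) => //.
exact: integrableD.
Qed.

Lemma integrable_EFinZ d (T : measurableType d) (R : realType)
    (m : {measure set T -> \bar R}) (D : set T) (c : R) (f : T -> R) : measurable D ->
  m.-integrable D (EFin \o f) -> m.-integrable D (EFin \o (fun s => c * f s)).
Proof.
move=> mD fi; apply: (@eq_integrable _ _ _ m D mD (fun s => c%:E * (EFin \o f) s)%E) => //.
exact: integrableZl.
Qed.

Lemma integrable_EFinB d (T : measurableType d) (R : realType)
    (m : {measure set T -> \bar R}) (D : set T) (f g : T -> R) : measurable D ->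
  m.-integrable D (EFin \o f) -> m.-integrable D (EFin \o g) ->
  m.-integrable D (EFin \o (fun s => f s - g s)).
Proof.
move=> mD fi gi; apply: (@eq_integrable _ _ _ m D mD ((EFin \o f) \- (EFin \o g))%E) => //.
exact: integrableB.
Qed.

Section L2_basics.
Context {R : realType}.
Local Notation mu := (mu01 R).
Local Notation X := (L2 R).
Implicit Types x y z u w : X.

Lemma mu01_setT : mu setT = 1%E.
Proof.
rewrite /= /mrestr setTI lebesgue_measure_itv/= lte_fin ltr01.
by rewrite oppr0 adde0.
Qed.

Lemma ae_imp (P Q : R -> Prop) : {ae mu, forall t, P t} ->
  (forall t, P t -> Q t) -> {ae mu, forall t, Q t}.
Proof. by move=> aP PQ; exact: (@filterS _ _ (ae_filter_ringOfSetsType mu) _ _ PQ). Qed.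

Lemma ae_imp2 (P Q S : R -> Prop) : {ae mu, forall t, P t} ->
  {ae mu, forall t, Q t} ->
  (forall t, P t -> Q t -> S t) -> {ae mu, forall t, S t}.
Proof. by move=> aP aQ PQ; exact: (@filterS2 _ _ (ae_filter_ringOfSetsType mu) _ _ _ PQ). Qed.

Lemma ae_imp3 (P Q S S' : R -> Prop) : {ae mu, forall t, P t} ->
  {ae mu, forall t, Q t} -> {ae mu, forall t, S t} ->
  (forall t, P t -> Q t -> S t -> S' t) -> {ae mu, forall t, S' t}.
Proof.
by move=> aP aQ aS PQ; exact: (@filterS3 _ _ (ae_filter_ringOfSetsType mu) _ _ _ _ PQ).
Qed.

Lemma L2_eqP x y : x = y <-> {ae mu, forall t, Lrepr x t = Lrepr y t}.
Proof.
split; first by move=> /Lspace_eqP; apply: filterS => t; apply.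
by move=> xy; apply/Lspace_eqP; apply: filterS xy => t ->.
Qed.

Lemma ae_Lclass f (fL : f \in Lfun mu (2%:R)%:E) :
  {ae mu, forall t, Lrepr (Lclass (lee1n 2) fL : X) t = f t}.
Proof. by have := LclassK (lee1n 2) fL; apply: filterS => t; apply. Qed.

Lemma aeD x y : {ae mu, forall t, Lrepr (x + y) t = Lrepr x t + Lrepr y t}.
Proof. by have := Lrepr_add x y; apply: filterS => t; apply. Qed.

Lemma aeN x : {ae mu, forall t, Lrepr (- x) t = - Lrepr x t}.
Proof. by have := Lrepr_opp x; apply: filterS => t; apply. Qed.

Lemma ae0 : {ae mu, forall t, Lrepr (0 : X) t = 0}.
Proof. by have := Lrepr_zero mu (lee1n 2); apply: filterS => t; apply. Qed.

Lemma aeZ a x : {ae mu, forall t, Lrepr (a *: x) t = a * Lrepr x t}.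
Proof. by have := Lrepr_scale a x; apply: filterS => t; apply. Qed.

Lemma aeB x y : {ae mu, forall t, Lrepr (x - y) t = Lrepr x t - Lrepr y t}.
Proof. by apply: filterS2 (aeD x (- y)) (aeN y) => t -> ->. Qed.

Lemma Lrepr_m x : measurable_fun setT (Lrepr x).
Proof. exact: Lrepr_measurable. Qed.

Lemma Lfun2P (f : R -> R) : measurable_fun setT f ->
  (f \in Lfun mu (2%:R)%:E) <-> (\int[mu]_t (f t ^+ 2)%:E < +oo)%E.
Proof.
move=> mf; split=> [/Lfun2_integrable_sqr/integrableP[_]|fi].
  apply: le_lt_trans; rewrite le_eqVlt; apply/orP; left; apply/eqP.
  by apply: eq_integral => t _ /=; rewrite ger0_norm// sqr_ge0.
apply/andP; split; rewrite inE//= /finite_norm unlock /Lnorm poweR_lty//.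
apply: le_lt_trans fi; rewrite le_eqVlt; apply/orP; left; apply/eqP.
by apply: eq_integral => t _ /=; rewrite powR_mulrn// real_normK// num_real.
Qed.

Lemma integrable_mul x y : mu.-integrable setT (EFin \o (fun t => Lrepr x t * Lrepr y t)).
Proof. by apply/Lfun1_integrable; apply: Lfun2_mul_Lfun1; exact: Lrepr_Lfun. Qed.

Lemma integrable_Lrepr x : mu.-integrable setT (EFin \o Lrepr x).
Proof.
apply/Lfun1_integrable; apply: Lfun_subset12; last exact: Lrepr_Lfun.
by rewrite mu01_setT.
Qed.

Lemma Rintegral_ae (f g : R -> R) : measurable_fun setT f -> measurable_fun setT g ->
  {ae mu, forall t, f t = g t} -> \int[mu]_t f t = \int[mu]_t g t.
Proof.
move=> mf mg fg; rewrite /Rintegral; congr fine; apply: ae_eq_integral => //.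
- exact/measurable_EFinP.
- exact/measurable_EFinP.
- by apply: (@filterS _ _ (ae_filter_ringOfSetsType mu) _ _ _ fg) => t ->.
Qed.

Lemma innerC x y : inner x y = inner y x.
Proof. by rewrite /inner; under eq_Rintegral do rewrite mulrC. Qed.

Lemma innerDl x y z : inner (x + y) z = inner x z + inner y z.
Proof.
rewrite /inner -RintegralD//; [|exact: integrable_mul..].
apply: Rintegral_ae.
- by apply: measurable_funM; exact: Lrepr_m.
- by apply: measurable_funD; apply: measurable_funM; exact: Lrepr_m.
- by apply: filterS (aeD x y) => t ->; rewrite mulrDl.
Qed.

Lemma innerZl a x z : inner (a *: x) z = a * inner x z.
Proof.
rewrite /inner -RintegralZl//; [|exact: integrable_mul..].
apply: Rintegral_ae.
- by apply: measurable_funM; exact: Lrepr_m.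
- by apply: measurable_funM => //; apply: measurable_funM; exact: Lrepr_m.
- by apply: filterS (aeZ a x) => t ->; rewrite mulrA.
Qed.

Lemma innerNl x z : inner (- x) z = - inner x z.
Proof. by rewrite -scaleN1r innerZl mulN1r. Qed.

Lemma innerBl x y z : inner (x - y) z = inner x z - inner y z.
Proof. by rewrite innerDl innerNl. Qed.

Lemma innerDr x y z : inner z (x + y) = inner z x + inner z y.
Proof. by rewrite innerC innerDl !(innerC z). Qed.

Lemma innerZr a x z : inner z (a *: x) = a * inner z x.
Proof. by rewrite innerC innerZl !(innerC z). Qed.

Lemma innerNr x z : inner z (- x) = - inner z x.
Proof. by rewrite innerC innerNl !(innerC z). Qed.

Lemma innerBr x y z : inner z (x - y) = inner z x - inner z y.
Proof. by rewrite innerC innerBl !(innerC z). Qed.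

Lemma inner0l z : inner 0 z = 0.
Proof. by rewrite -(scale0r (0 : X)) innerZl mul0r. Qed.

Lemma normL2_sqr x : `|x| ^+ 2 = inner x x.
Proof.
have e : (`|x|%:E = 'N[mu]_2[EFin \o Lrepr x])%E by exact: Lp_norm_fin.
apply: EFin_inj; rewrite /inner /Rintegral fineK; last first.
  by apply: integrable_fin_num => //; exact: integrable_mul.
have := @poweR_Lnorm _ _ _ mu (EFin \o Lrepr x) 2 ltac:(by []).
rewrite -e poweR_EFin powR_mulrn// => ->; apply: eq_integral => t _ /=.
by rewrite powR_mulrn// real_normK ?num_real// expr2.
Qed.

Lemma inner_ge0 x : 0 <= inner x x.
Proof. by rewrite -normL2_sqr sqr_ge0. Qed.

Lemma normL2D x y : `|x + y| ^+ 2 = `|x| ^+ 2 + 2 * inner x y + `|y| ^+ 2.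
Proof. rewrite !normL2_sqr innerDl !innerDr (innerC y x); ring. Qed.

Lemma normL2B x y : `|x - y| ^+ 2 = `|x| ^+ 2 - 2 * inner x y + `|y| ^+ 2.
Proof. rewrite normL2D innerNr normrN; ring. Qed.

Lemma normL2_sqrE x : `|x| ^+ 2 = \int[mu]_t (Lrepr x t ^+ 2).
Proof. by rewrite normL2_sqr /inner; under eq_Rintegral do rewrite -expr2. Qed.

(** Cauchy-Schwarz: for unit vectors it is the nonnegativity of [inner (a - b) (a - b)], and the
    general case follows by scaling. *)
Lemma inner_le_norm x y : `|inner x y| <= `|x| * `|y|.
Proof.
have key a b : `|a| = 1 -> `|b| = 1 -> inner a b <= 1 :> R.
  move=> a1 b1; have := inner_ge0 (a - b).
  rewrite innerBl !innerBr -!normL2_sqr a1 b1 (innerC b a); lra.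
have main a b : inner a b <= `|a| * `|b| :> R.
  have [->|a0] := eqVneq a 0; first by rewrite inner0l normr0 mul0r.
  have [->|b0] := eqVneq b 0; first by rewrite innerC inner0l normr0 mulr0.
  have na : 0 < `|a| by rewrite normr_gt0.
  have nb : 0 < `|b| by rewrite normr_gt0.
  have n1 (c : X) : c != 0 -> `|(`|c|^-1 : R) *: c| = 1.
    by move=> c0; rewrite normrZ normfV normr_id mulVf// normr_eq0.
  have := key _ _ (n1 _ a0) (n1 _ b0); rewrite innerZl innerZr.
  by rewrite mulrA -invfM mulrC ler_pdivrMr ?mul1r ?mulr_gt0// mulrC.
rewrite ler_norml main andbT lerNl -innerNl.
by have := main (- x) y; rewrite normrN.
Qed.

(** Transfers pointwise bounds to norms; the Lipschitz, Taylor and decay estimates of the saturated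
    flow all descend from scalar ones in this way. *)
Lemma norm_le_ae x y c : 0 <= c ->
  {ae mu, forall t, `|Lrepr x t| <= c * `|Lrepr y t|} -> `|x| <= c * `|y|.
Proof.
move=> c0 xy; rewrite -(@ler_pXn2r _ 2)// ?nnegrE ?mulr_ge0// exprMn !normL2_sqrE.
rewrite -RintegralZl//; last exact: Lfun2_integrable_sqr (Lrepr_Lfun _).
have ix : mu.-integrable setT (EFin \o (fun t => Lrepr x t ^+ 2)).
  exact: Lfun2_integrable_sqr (Lrepr_Lfun _).
have iy : mu.-integrable setT (EFin \o (fun t => c ^+ 2 * Lrepr y t ^+ 2)).
  apply: (@eq_integrable _ _ _ mu setT _
    (fun t => ((c ^+ 2)%:E * (EFin \o (fun t => Lrepr y t ^+ 2)%R) t)%E)) => //.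
  apply: integrableZl => //; exact: Lfun2_integrable_sqr (Lrepr_Lfun _).
rewrite /Rintegral fine_le//; [exact: integrable_fin_num..|].
apply: ae_ge0_le_integral => //.
- by move=> t _; rewrite lee_fin sqr_ge0.
- by case/integrableP : ix.
- by move=> t _; rewrite lee_fin mulr_ge0// sqr_ge0.
- by case/integrableP : iy.
apply: filterS xy => t xyt _; rewrite lee_fin -exprMn -[leLHS]real_normK ?num_real//.
by rewrite -[leRHS]real_normK ?num_real// ler_pXn2r ?nnegrE// normrM (ger0_norm c0).
Qed.

Lemma bounded_Lfun (f : R -> R) (M : R) : measurable_fun setT f ->
  (forall t, `|f t| <= M) -> f \in Lfun mu (2%:R)%:E.
Proof.
move=> mf fM; apply/Lfun2P => //.
apply: (@le_lt_trans _ _ (\int[mu]_t (cst (M ^+ 2)%:E t))%E).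
  apply: ge0_le_integral => //.
  - by move=> t _; rewrite lee_fin sqr_ge0.
  - by apply/measurable_EFinP; exact: measurable_funX.
  - move=> t _ /=; rewrite lee_fin -[leLHS]real_normK ?num_real//.
    by rewrite ler_pXn2r ?nnegrE// (le_trans _ (fM t)).
rewrite integral_cst//= -/mu.
by rewrite -[mrestr _ _ _]/(mu setT) mu01_setT mule1 ltry.
Qed.

Lemma cst_Lfun (c : R) : cst c \in Lfun mu (2%:R)%:E.
Proof.
apply/Lfun2P => //=; rewrite integral_cst//= -/mu.
by rewrite -[mrestr _ _ _]/(mu setT) mu01_setT mule1 ltry.
Qed.

Definition L2cst (c : R) : X := Lclass (lee1n 2) (cst_Lfun c).

Lemma norm_L2cst c : `|L2cst c| = `|c|.
Proof.
apply: (@pexpIrn _ 2) => //; rewrite ?nnegrE// normL2_sqrE.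
rewrite (@Rintegral_ae _ (cst (c ^+ 2))).
- rewrite Rintegral_cst//= -[mrestr _ _ _]/(mu setT) mu01_setT mulr1.
  by rewrite real_normK// num_real.
- by apply: measurable_funX; exact: Lrepr_m.
- exact: measurable_cst.
- by apply: filterS (ae_Lclass (cst_Lfun c)) => t ->.
Qed.

Lemma norm_le_cst x c : {ae mu, forall t, `|Lrepr x t| <= c} -> `|x| <= `|c|.
Proof.
move=> xc; rewrite -norm_L2cst -[leRHS]mul1r; apply: norm_le_ae => //.
by apply: filterS2 xc (ae_Lclass (cst_Lfun c)) => t xc ->; rewrite mul1r (le_trans xc)// ler_norm.
Qed.

Lemma inner_Lclass f (fL : f \in Lfun mu (2%:R)%:E) y :
  inner (Lclass (lee1n 2) fL) y = \int[mu]_t (f t * Lrepr y t).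
Proof.
have mf : measurable_fun setT f by move: fL; rewrite inE => /andP[/[!inE]].
apply: Rintegral_ae.
- by apply: measurable_funM; exact: Lrepr_m.
- by apply: measurable_funM => //; exact: Lrepr_m.
- by apply: filterS (ae_Lclass fL) => t ->.
Qed.

End L2_basics.

(** * The scalar saturated flow *)

Section scalar_flow.
Context {R : realType}.
Implicit Types y z t h a b : R.

(** One formula for [y + 1] on the nonnegative and [expR y] on the nonpositive half line; the pieces
    meet at 0 with common value 1 and common slope 1. *)
Definition kappa y : R := Num.max y 0 + expR (Num.min y 0).

Lemma kappa_ge0E y : 0 <= y -> kappa y = y + 1.
Proof. by move=> y0; rewrite /kappa max_l// min_r// expR0. Qed.

Lemma kappa_le0E y : y <= 0 -> kappa y = expR y.
Proof. by move=> y0; rewrite /kappa max_r// min_l// add0r. Qed.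

Lemma kappa_gt0 y : 0 < kappa y.
Proof. by rewrite /kappa ltr_wpDl ?expR_gt0// le_max lexx orbT. Qed.

(** The derivative of [kappa], used only through inequalities. *)
Definition dkappa y : R := expR (Num.min y 0).

Lemma dkappa_gt0 y : 0 < dkappa y. Proof. exact: expR_gt0. Qed.

Lemma dkappa_le1 y : dkappa y <= 1.
Proof. by rewrite /dkappa -expR0 ler_expR ge_min lexx orbT. Qed.

Lemma kappa_dkappa y : dkappa y = Num.min 1 (kappa y).
Proof.
have [y0|/ltW y0] := leP 0 y.
  by rewrite kappa_ge0E// /dkappa min_r// expR0 min_l// lerDr.
by rewrite kappa_le0E// /dkappa min_l// min_r// -expR0 ler_expR.
Qed.

Lemma expR_tangent y z : expR y * (1 + (z - y)) <= expR z.
Proof.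
rewrite -[in leRHS](subrKC y z) expRD ler_pM2l ?expR_gt0//; exact: expR_ge1Dx.
Qed.

(** Convexity of [kappa]: the graph lies above each of its tangents. Monotonicity, the Lipschitz
    bound and the Taylor bound are all drawn from this inequality. *)
Lemma kappa_tangent y z : kappa y + (z - y) * dkappa y <= kappa z.
Proof.
have [y0|/ltW y0] := leP 0 y.
  rewrite kappa_ge0E// /dkappa min_r// expR0 mulr1.
  have [z0|/ltW z0] := leP 0 z; first by rewrite kappa_ge0E//; lra.
  by rewrite kappa_le0E//; have := expR_ge1Dx z; lra.
rewrite kappa_le0E// /dkappa min_l//.
have [z0|/ltW z0] := leP 0 z; last first.
  by rewrite kappa_le0E//; have := expR_tangent y z; lra.
rewrite kappa_ge0E//; have := expR_tangent y 0; rewrite expR0.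
have : expR y * z <= 1 * z by rewrite ler_wpM2r// -expR0 ler_expR.
lra.
Qed.

Lemma dkappa_lip y z : y <= z -> dkappa z - dkappa y <= z - y.
Proof.
move=> yz; have := expR_tangent (Num.min z 0) (Num.min y 0).
rewrite -/(dkappa y) -/(dkappa z) => H.
have m0 : 0 <= Num.min z 0 - Num.min y 0.
  by rewrite subr_ge0 le_min !ge_min yz lexx orbT.
have m1 : Num.min z 0 - Num.min y 0 <= z - y.
  case: (leP z 0) => z0; case: (leP y 0) => y0 => //; lra.
have : dkappa z * (Num.min z 0 - Num.min y 0) <= 1 * (Num.min z 0 - Num.min y 0).
  by rewrite ler_wpM2r// dkappa_le1.
lra.
Qed.

Lemma kappa_lip y z : `|kappa y - kappa z| <= `|y - z|.
Proof.
wlog yz : y z / z <= y => [H|].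
  by have [/H//|/ltW/H] := leP z y; rewrite distrC (distrC y).
have h1 : kappa y - kappa z <= y - z.
  have := kappa_tangent y z.
  have : (y - z) * dkappa y <= (y - z) * 1 by rewrite ler_wpM2l ?subr_ge0 ?dkappa_le1.
  lra.
have h2 : 0 <= kappa y - kappa z.
  have := kappa_tangent z y.
  have : 0 <= (y - z) * dkappa z by rewrite mulr_ge0 ?subr_ge0// ltW ?dkappa_gt0.
  lra.
by rewrite !ger0_norm// subr_ge0.
Qed.

(** The tangent at [y] shows that the remainder is nonnegative; the tangent at [y - h] bounds it by
    [h * (dkappa y - dkappa (y - h))], which is at most [h ^+ 2] because [dkappa] is 1-Lipschitz. *)
Lemma kappa_taylor y h : `|kappa (y - h) - kappa y + h * dkappa y| <= h ^+ 2.
Proof.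
have H1 := kappa_tangent y (y - h).
have H2 := kappa_tangent (y - h) y.
have H3 : h * (dkappa y - dkappa (y - h)) <= h ^+ 2.
  have [h0|/ltW h0] := leP 0 h.
    by rewrite expr2 ler_wpM2l//; have := @dkappa_lip (y - h) y; lra.
  have : dkappa (y - h) - dkappa y <= - h by have := @dkappa_lip y (y - h); lra.
  by move=> H; rewrite -subr_ge0 (_ : _ - _ = - h * (- h - (dkappa (y - h) - dkappa y))); [|ring];
    apply: mulr_ge0; lra.
rewrite ger0_norm; lra.
Qed.

(* The flow of z' = - sat_real z, frozen at negative times: kappa linearizes it, as
   kappa' = min 1 kappa. *)
Definition phi t z : R :=
  sat_real z * kappa (Num.max (`|z| - 1) 0 - Num.max t 0).

Lemma sat_real_le1 z : `|sat_real z| <= 1.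
Proof.
rewrite /sat_real; case: ifPn => [z1|]; last by rewrite -ltNge => /ltW.
rewrite normrM normfV normr_id divff// gt_eqF//.
exact: lt_le_trans ltr01 z1.
Qed.

Lemma sat_real_kappa z : sat_real z * kappa (Num.max (`|z| - 1) 0) = z.
Proof.
rewrite kappa_ge0E; last by rewrite le_max lexx orbT.
rewrite /sat_real; case: ifPn => [z1|].
  rewrite max_l ?subr_ge0// subrK mulfVK// gt_eqF//.
  exact: lt_le_trans ltr01 z1.
by rewrite -ltNge => z1; rewrite max_r ?add0r ?mulr1// subr_le0 ltW.
Qed.

Lemma phi0 z : phi 0 z = z.
Proof. by rewrite /phi maxxx subr0 sat_real_kappa. Qed.

Lemma phi_lip a b z : `|phi b z - phi a z| <= `|b - a|.
Proof.
rewrite /phi -mulrBr normrM -[leRHS]mul1r ler_pM// ?sat_real_le1//.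
apply: (le_trans (kappa_lip _ _)).
rewrite (_ : _ - _ = Num.max a 0 - Num.max b 0); last by ring.
case: (leP a 0) => a0; case: (leP b 0) => b0.
- by rewrite subrr normr0.
- by rewrite sub0r normrN !ger0_norm//; lra.
- by rewrite subr0 distrC !ger0_norm//; lra.
- by rewrite distrC.
Qed.

(** This is the differential equation of the flow: as [dkappa] is [min 1 kappa], saturating replaces
    the factor [kappa] by its derivative. If [|z| >= 1] then [|sat_real z| = 1] and the minimum does
    the saturation; if [|z| < 1] then the factor is at most 1 and nothing is cut. *)
Lemma sat_phi t z : 0 <= t ->
  sat_real (phi t z) = sat_real z * dkappa (Num.max (`|z| - 1) 0 - Num.max t 0).
Proof.
move=> t0; rewrite /phi (max_l t0) kappa_dkappa.
set k := kappa _; have k0 : 0 < k by exact: kappa_gt0.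
have [z1|z1] := leP 1 `|z|; last first.
  have kle1 : k <= 1.
    rewrite /k max_r; last by rewrite subr_le0 ltW.
    by rewrite sub0r kappa_le0E ?oppr_le0// -expR0 ler_expR oppr_le0.
  rewrite min_r//; have sz : sat_real z = z by rewrite /sat_real leNgt z1.
  rewrite sz /sat_real; case: ifPn => //.
  rewrite normrM (gtr0_norm k0) leNgt (le_lt_trans _ z1)//.
  by rewrite -[leRHS]mulr1 ler_wpM2l.
have zn0 : `|z| != 0 by rewrite gt_eqF// (lt_le_trans ltr01).
have sz : `|sat_real z| = 1.
  by rewrite /sat_real z1 normrM normfV normr_id divff.
rewrite {1}/sat_real normrM sz mul1r (gtr0_norm k0).
case: (leP 1 k) => k1; last by [].
by rewrite mulr1 mulfK// gt_eqF.
Qed.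

(** The bound does not depend on [z], so it passes to the norm of [L2]. *)
Lemma phi_taylor a b z : 0 <= a -> 0 <= b ->
  `|phi b z - phi a z + (b - a) * sat_real (phi a z)| <= (b - a) ^+ 2.
Proof.
move=> a0 b0; rewrite sat_phi// /phi (max_l a0) (max_l b0).
set p := Num.max (`|z| - 1) 0.
rewrite (_ : _ + _ = sat_real z *
  (kappa (p - a - (b - a)) - kappa (p - a) + (b - a) * dkappa (p - a))); last first.
  by rewrite (_ : p - a - (b - a) = p - b); ring.
rewrite normrM -[leRHS]mul1r ler_pM// ?sat_real_le1//; exact: kappa_taylor.
Qed.

Lemma phi_norm t z : `|phi t z| <= `|z|.
Proof.
rewrite -[in leRHS](sat_real_kappa z) /phi; set p : R := Num.max (`|z| - 1) 0.
rewrite !normrM ler_wpM2l// !gtr0_norm ?kappa_gt0//.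
have := kappa_tangent (p - Num.max t 0) p.
have : 0 <= (p - (p - Num.max t 0)) * dkappa (p - Num.max t 0).
  by rewrite mulr_ge0 ?(ltW (dkappa_gt0 _))// subKr le_max lexx orbT.
lra.
Qed.

(** The rate is dictated by the phase of unit speed: starting from height [1 + p <= M], the line
    [1 + p - s] stays below [expR (- M^-1 * s) * (1 + p)] because [(1 + p) / M <= 1]. In the later
    phase the true rate 1 is at least [M^-1]. *)
Lemma phi_decay M t z : 1 <= M -> `|z| <= M -> 0 <= t ->
  `|phi t z| <= expR (- M^-1 * t) * `|z|.
Proof.
move=> M1 zM t0; rewrite mulrC -[in leRHS](sat_real_kappa z) /phi (max_l t0).
set p : R := Num.max (`|z| - 1) 0; rewrite !normrM -mulrA ler_wpM2l//.
rewrite !gtr0_norm ?kappa_gt0//.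
have p0 : 0 <= p by rewrite le_max lexx orbT.
have pM : 1 + p <= M.
  by rewrite /p; case: (leP (`|z| - 1) 0) => _; lra.
have M0 : 0 < M by lra.
have p1 : 0 < 1 + p by lra.
have Mp : M^-1 <= (1 + p)^-1 by rewrite lef_pV2 ?posrE.
have Mi1 : M^-1 <= 1 by rewrite invf_le1.
rewrite (kappa_ge0E p0) mulrC.
have key (s : R) : 0 <= s <= p -> 1 + p - s <= expR (- M^-1 * s) * (p + 1).
  move=> /andP[s0 sp].
  have : (1 + p) * (1 + - M^-1 * s) <= (1 + p) * expR (- M^-1 * s).
    by rewrite ler_pM2l// expR_ge1Dx.
  have : M^-1 * s * (1 + p) <= s.
    have h : M^-1 * (1 + p) <= 1 by rewrite ler_pdivrMl// mulr1.
    by rewrite mulrAC -[leRHS]mul1r ler_wpM2r.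
  lra.
have [tp|/ltW pt] := leP t p.
  by rewrite kappa_ge0E ?subr_ge0//; have := key t; rewrite t0 tp => /(_ isT); lra.
rewrite kappa_le0E ?subr_le0//.
have := key p; rewrite p0 lexx addrK => /(_ isT) K1.
(* The exponent is split at the time [p] that ends the phase of unit speed: the first factor is
   handled by [K1], the second by [M^-1 <= 1] and [p <= t]. *)
rewrite (_ : - M^-1 * t = - M^-1 * p + M^-1 * (p - t)); last by ring.
rewrite [in leRHS]expRD mulrAC.
apply: (@le_trans _ _ (1 * expR (M^-1 * (p - t)))); last first.
  by rewrite ler_wpM2r// expR_ge0.
rewrite mul1r ler_expR -subr_ge0.
rewrite (_ : _ - _ = (1 - M^-1) * (t - p)); last by ring.
by rewrite mulr_ge0 ?subr_ge0.
Qed.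

Lemma phi_large t z : 0 <= t -> 1 + t <= z -> phi t z = z - t.
Proof.
move=> t0 tz; have z1 : 1 <= z by lra.
rewrite /phi (max_l t0) (ger0_norm (le_trans ler01 z1)) max_l ?subr_ge0//.
rewrite kappa_ge0E; last by lra.
rewrite /sat_real (ger0_norm (le_trans ler01 z1)) z1 divff ?mul1r; first by lra.
by rewrite gt_eqF// (lt_le_trans ltr01).
Qed.

Lemma phi_0 t : phi t 0 = 0.
Proof. by rewrite /phi /sat_real normr0 leNgt ltr01 mul0r. Qed.

Lemma measurable_kappa : measurable_fun setT kappa.
Proof.
apply: measurable_funD; first exact: measurable_maxr.
by apply: measurableT_comp; [exact: measurable_expR|exact: measurable_minr].
Qed.

Lemma measurable_phi t : measurable_fun setT (phi t).
Proof.
apply: measurable_funM; first exact: measurable_sat_real.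
apply: measurableT_comp; first exact: measurable_kappa.
apply: measurable_funB => //; apply: measurable_maxr => //.
by apply: measurable_funB => //; exact: measurable_normr.
Qed.

Lemma sat_real_lip y z : `|sat_real y - sat_real z| <= `|y - z|.
Proof.
have satE (x : R) : sat_real x = Num.max (-1) (Num.min x 1).
  rewrite /sat_real; case: ifPn => [|]; last first.
    by rewrite -ltNge ltr_norml => /andP[x1 x2]; rewrite min_l ?ltW// max_r// ltW.
  have [x0|x0] := leP 0 x.
    rewrite ger0_norm// => x1; rewrite divff; last by rewrite gt_eqF// (lt_le_trans ltr01).
    by rewrite min_r// max_r//; lra.
  rewrite ltr0_norm// => x1; rewrite min_l ?max_l; [|lra..].
  by rewrite invrN mulrN divff// lt_eqF.
wlog yz : y z / z <= y => [H|].
  by have [/H//|/ltW/H] := leP z y; rewrite distrC (distrC y).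
rewrite !satE (@ger0_norm _ (y - z)) ?subr_ge0//.
have m11 : Num.max (-1) 1 = 1 :> R by rewrite max_r//; lra.
case: (leP y 1) => y1; case: (leP z 1) => z1; rewrite ?m11 ?subrr ?normr0 ?subr_ge0//.
- by case: (leP (-1) y) => ?; case: (leP (-1) z) => ?; rewrite ler_norml; lra.
- by case: (leP (-1) y) => ?; rewrite ler_norml; lra.
- by case: (leP (-1) z) => ?; rewrite ler_norml; lra.
Qed.

End scalar_flow.

(** * Rotations of the circle *)

Section frpart.
Context {R : realType}.
Local Notation leb := (@lebesgue_measure R).
Implicit Types s t : R.

Definition frpart t : R := t - (Num.floor t)%:~R.

Lemma frac_ge0 t : 0 <= frpart t.
Proof. by rewrite subr_ge0 floor_le. Qed.

Lemma frac_lt1 t : frpart t < 1.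
Proof. by rewrite ltrBlDr addrC -[X in _ + X]/(1%:~R) -intrD floorD1_gt. Qed.

Lemma frac_id t : 0 <= t < 1 -> frpart t = t.
Proof.
by move=> t01; rewrite /frpart (@floor_def _ _ 0) ?mulr0z ?subr0// add0r.
Qed.

Lemma fracDz t (n : int) : frpart (t + n%:~R) = frpart t.
Proof.
rewrite /frpart floorDrz ?intr_int// intrKfloor intrD; ring.
Qed.

Lemma fracD1 t : frpart (t + 1) = frpart t.
Proof. exact: (fracDz t 1). Qed.

Lemma fracB1 t : frpart (t - 1) = frpart t.
Proof. exact: (fracDz t (-1)). Qed.

Lemma frac_fracD s t : frpart (frpart s + t) = frpart (s + t).
Proof.
rewrite [in RHS](_ : s = frpart s + (Num.floor s)%:~R); last by rewrite /frpart subrK.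
by rewrite [X in _ = frpart X]addrAC fracDz.
Qed.

Lemma frac_fracDr s t : frpart (s + frpart t) = frpart (s + t).
Proof. by rewrite addrC frac_fracD addrC. Qed.

Lemma measurable_floor : measurable_fun setT (fun t : R => (Num.floor t)%:~R : R).
Proof.
apply: (measurability _ (RGenOInfty.measurableE R)) => //.
move=> _ [_ [r ->] <-]; apply: measurableI => //.
rewrite (_ : _ @^-1` _ = `[(Num.floor r + 1)%:~R, +oo[%classic); first exact: measurable_itv.
apply/seteqP; split => t /=; rewrite !in_itv/= !andbT.
  by rewrite -floor_lt_int -floor_ge_int -lezD1.
by rewrite -floor_ge_int lezD1 floor_lt_int.
Qed.

Lemma measurable_frac t : measurable_fun setT (fun s => frpart (s + t)).
Proof.
rewrite /frpart; apply: measurable_funB; first exact: measurable_funD.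
by apply: (measurableT_comp measurable_floor); exact: measurable_funD.
Qed.

(** The image of Lebesgue measure under a translation agrees with it on half-open intervals, hence
    everywhere by uniqueness. *)
Lemma lebesgue_translation (c : R) (A : set R) : measurable A ->
  leb ((fun s => s + c) @^-1` A) = leb A.
Proof.
have mc : measurable_fun setT (fun s : measurableTypeR R => s + c : measurableTypeR R).
  exact: measurable_funD.
move=> mA; apply/esym.
apply: (@lebesgue_measure_unique R
  (pushforward leb (fun s : measurableTypeR R => s + c : measurableTypeR R))) => //.
move=> _ [[a b]] _ <-; rewrite /pushforward.
transitivity (leb `]a - c, b - c]); last first.
  by congr (leb _); apply/seteqP; split => s /=; rewrite !in_itv/= ltrBlDr lerBrDr.
rewrite !lebesgue_measure_itv/= !lte_fin ltrD2r; case: ifPn => // _.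
by rewrite -!EFinD; congr (_%:E); ring.
Qed.

Lemma lebesgue_setD_null (A N : set R) : measurable A -> measurable N ->
  leb N = 0%E -> leb (A `\` N) = leb A.
Proof.
move=> mA mN N0; rewrite [RHS](measureDI leb mA mN).
rewrite -[LHS]adde0; congr (_ + _)%E; apply/esym.
apply/eqP; rewrite eq_le measure_ge0 andbT -N0.
by apply: le_measure; rewrite ?inE//; exact: measurableI.
Qed.

Lemma mu01_frac t (A : set R) : measurable A ->
  mu01 R ((fun s => frpart (s + t)) @^-1` A) = mu01 R A.
Proof.
move=> mA; rewrite /= /mrestr/=.
rewrite (_ : (fun s => frpart (s + t)) = (fun s => frpart (s + frpart t))); last first.
  by apply/funext => s; rewrite frac_fracDr.
set u := frpart t.
have u0 : 0 <= u := frac_ge0 t; have u1 : u < 1 := frac_lt1 t.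
(* The rotation translates []0, 1 - u[] by [u] onto []u, 1[] and [[1 - u, 1[] by [u - 1] onto [[0,
   u[]. *)
have -> : (fun s => frpart (s + u)) @^-1` A `&` `]0, 1[ =
  ((fun s => s + u) @^-1` (A `&` `]u, 1[)) `|`
  ((fun s => s + (u - 1)) @^-1` (A `&` `[0, u[)).
  apply/seteqP; split => s /=; rewrite !in_itv/=.
    move=> [As /andP[s0 s1]]; have [su1|su1] := ltP (s + u) 1.
      left; split; last by lra.
      by move: As; rewrite frac_id//; lra.
    right; split; last by lra.
    by move: As; rewrite -fracB1 -addrA frac_id//; lra.
  move=> [|] [As su]; split; try lra.
    by rewrite frac_id//; lra.
  by rewrite -fracB1 -addrA frac_id//; lra.
rewrite measureU/=; last 3 first.
- rewrite -[X in measurable X]setTI; apply: measurable_funD => //.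
  exact: measurableI.
- rewrite -[X in measurable X]setTI; apply: measurable_funD => //.
  exact: measurableI.
- apply/seteqP; split => s //=; rewrite !in_itv/= => -[[_ h1] [_ h2]]; lra.
have mA1 : measurable (A `&` `]u, 1[) by exact: measurableI.
have mA2 : measurable (A `&` `[0, u[) by exact: measurableI.
rewrite !lebesgue_translation// -measureU//; last first.
  apply/seteqP; split => s //=; rewrite !in_itv/= => -[[_ h1] [_ h2]]; lra.
(* The two image pieces recombine to the unit interval up to the endpoints [0] and [u]. *)
have N0 : leb [set 0; u] = 0%E.
  by apply: countable_lebesgue_measure0; apply: finite_set_countable.
have mN : measurable [set 0; u] by exact: measurableU.
rewrite -[LHS](lebesgue_setD_null _ mN N0); last exact: measurableU.
rewrite -[RHS](lebesgue_setD_null _ mN N0); last exact: measurableI.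
congr (leb _); apply/seteqP; split => s /=; rewrite !in_itv/=.
  move=> [H N]; split=> //; have /not_orP[/eqP s0 /eqP su] := N.
  by case: H => -[As h]; split=> //; lra.
move=> [[As h] N]; split=> //; have /not_orP[/eqP s0 /eqP su] := N.
by case: (ltgtP u s) su => // us _; [left|right]; split => //; lra.
Qed.

Lemma ae_mu01_itv : {ae mu01 R, forall s, 0 < s < 1}.
Proof.
exists (~` `]0, 1[); split.
- by apply: measurableC; exact: measurable_itv.
- by rewrite /= /mrestr setICl measure0.
- by move=> s /= h; rewrite in_itv.
Qed.

Lemma ae_frac t (P : R -> Prop) : {ae mu01 R, forall s, P s} ->
  {ae mu01 R, forall s, P (frpart (s + t))}.
Proof.
move=> [N [mN N0 PN]]; exists ((fun s => frpart (s + t)) @^-1` N); split.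
- by rewrite -[X in measurable X]setTI; exact: measurable_frac.
- by rewrite mu01_frac.
- by move=> s /= h; exact: PN.
Qed.

Lemma ge0_integral_frac t (f : R -> \bar R) : measurable_fun setT f ->
  (forall s, 0 <= f s)%E ->
  (\int[mu01 R]_s f (frpart (s + t)) = \int[mu01 R]_s f s)%E.
Proof.
move=> mf f0; have mt := measurable_frac t.
have := @ge0_integral_pushforward _ _ (measurableTypeR R) (measurableTypeR R) R _
  mt (mu01 R) setT f measurableT mf.
rewrite preimage_setT => <-//; apply: eq_measure_integral => A mA _.
exact: mu01_frac.
Qed.

Lemma Rintegral_frac t (f : R -> R) : (mu01 R).-integrable setT (EFin \o f) ->
  \int[mu01 R]_s f (frpart (s + t)) = \int[mu01 R]_s f s.
Proof.
move=> fi; have mt := measurable_frac t; have mf := measurable_int _ fi.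
have fi' : (mu01 R).-integrable setT ((EFin \o f) \o (fun s => frpart (s + t))).
  apply/integrableP; split; first exact: measurableT_comp.
  case/integrableP : fi => _; apply: le_lt_trans.
  rewrite (@ge0_integral_frac t (fun s => `|(EFin \o f) s|)%E)//.
  exact: measurableT_comp.
have := @integral_pushforward _ _ (measurableTypeR R) (measurableTypeR R) R _
  mt (mu01 R) setT _ mf.
rewrite preimage_setT => /(_ fi' measurableT) E.
rewrite /Rintegral -E; congr fine; apply: eq_measure_integral => A mA _.
exact: mu01_frac.
Qed.

End frpart.

(** * The rotation group acting on [L2] *)

Section shift_operator.
Context {R : realType}.
Local Notation mu := (mu01 R).
Local Notation X := (L2 R).
Implicit Types (x y z : X) (s t : R).

Lemma shift_Lfun t x : (fun s => Lrepr x (frpart (s + t))) \in Lfun mu (2%:R)%:E.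
Proof.
apply/Lfun2P; first by apply: measurableT_comp; [exact: Lrepr_m|exact: measurable_frac].
rewrite (@ge0_integral_frac _ t (fun s => (Lrepr x s ^+ 2)%:E)).
- by apply/Lfun2P; [exact: Lrepr_m|exact: Lrepr_Lfun].
- by apply/measurable_EFinP; apply: measurable_funX; exact: Lrepr_m.
- by move=> s; rewrite lee_fin sqr_ge0.
Qed.

Definition shift_op t x : X := Lclass (lee1n 2) (shift_Lfun t x).

Lemma ae_shift t x :
  {ae mu, forall s, Lrepr (shift_op t x) s = Lrepr x (frpart (s + t))}.
Proof. exact: ae_Lclass. Qed.

Fact shift_op_linear t : linear (shift_op t).
Proof.
move=> a x y; apply/L2_eqP.
have h1 := ae_frac t (aeD (a *: x) y); have h2 := ae_frac t (aeZ a x).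
have h3 := ae_shift t (a *: x + y); have h4 := aeD (a *: shift_op t x) (shift_op t y).
have h5 := aeZ a (shift_op t x); have h6 := ae_shift t x; have h7 := ae_shift t y.
have h123 := ae_imp3 h1 h2 h3 (fun t P Q S => conj P (conj Q S)).
have h45 := ae_imp2 h4 h5 (fun t P Q => conj P Q).
have h67 := ae_imp2 h6 h7 (fun t P Q => conj P Q).
by apply: (ae_imp3 h123 h45 h67) => s [e1 [e2 ->]] [-> ->] [-> ->]; rewrite e1 e2.
Qed.

HB.instance Definition _ (t : R) := @GRing.isLinear.Build R X X _ (shift_op t)
  (shift_op_linear t).

Lemma shift_op0 x : shift_op 0 x = x.
Proof.
apply/L2_eqP; apply: (ae_imp2 (ae_shift 0 x) ae_mu01_itv) => s -> /andP[s0 s1].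
by rewrite addr0 frac_id// (ltW s0).
Qed.

Lemma shift_opD s t x : shift_op (s + t) x = shift_op s (shift_op t x).
Proof.
apply/L2_eqP; have h := ae_frac s (ae_shift t x).
apply: (ae_imp3 (ae_shift (s + t) x) (ae_shift s (shift_op t x)) h) => r -> -> ->.
by rewrite frac_fracD addrA.
Qed.

Lemma inner_shift t x y : inner (shift_op t x) (shift_op t y) = inner x y.
Proof.
rewrite /inner -(Rintegral_frac t (integrable_mul x y)).
apply: Rintegral_ae.
- by apply: measurable_funM; exact: Lrepr_m.
- by apply: measurable_funM; apply: measurableT_comp; [exact: Lrepr_m|
    exact: measurable_frac|exact: Lrepr_m|exact: measurable_frac].
- by apply: (ae_imp2 (ae_shift t x) (ae_shift t y)) => s -> ->.
Qed.

Lemma norm_shift t x : `|shift_op t x| = `|x|.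
Proof. by apply: (@pexpIrn _ 2) => //; rewrite ?nnegrE// !normL2_sqr inner_shift. Qed.

End shift_operator.

(** * Primitives *)

Section mu01_lebesgue.
Context {R : realType}.
Local Notation leb := (@lebesgue_measure R).
Local Notation mu := (mu01 R).

Lemma ge0_integral_mu01 (f : R -> \bar R) : measurable_fun setT f ->
  (forall s, 0 <= f s)%E ->
  (\int[mu]_s f s = \int[leb]_(s in `]0%R, 1%R[) f s)%E.
Proof.
move=> mf f0.
rewrite (@ge0_negligible_integral _ _ _ mu setT (~` `]0, 1[))//; last 2 first.
- by apply: measurableC; exact: measurable_itv.
- by rewrite /= /mrestr setICl measure0.
rewrite setTD setCK; apply: eq_measure_integral => A mA A01.
by rewrite /= /mrestr setIidl.
Qed.

Lemma integrable_mu01 (f : R -> R) : measurable_fun setT f ->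
  mu.-integrable setT (EFin \o f) <-> leb.-integrable `]0, 1[ (EFin \o f).
Proof.
move=> mf.
have E := @ge0_integral_mu01 (fun s => `|(EFin \o f) s|%E) _ (fun s => abse_ge0 _).
split=> /integrableP[mf' fi]; apply/integrableP; split.
- by apply: measurable_funTS; exact/measurable_EFinP.
- by rewrite -E//; apply: measurableT_comp => //; exact/measurable_EFinP.
- exact/measurable_EFinP.
- by rewrite E//; apply: measurableT_comp => //; exact/measurable_EFinP.
Qed.

Lemma Rintegral_mu01 (f : R -> R) : mu.-integrable setT (EFin \o f) ->
  \int[mu]_s f s = \int[leb]_(s in `]0, 1[) f s.
Proof.
move=> fi; rewrite /Rintegral; congr fine.
rewrite (@negligible_integral _ _ _ mu setT (~` `]0, 1[))//; last 2 first.
- by apply: measurableC; exact: measurable_itv.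
- by rewrite /= /mrestr setICl measure0.
rewrite setTD setCK; apply: eq_measure_integral => A mA A01.
by rewrite /= /mrestr setIidl.
Qed.

Lemma ge0_integral_translation c (a b : itv_bound R) (f : R -> \bar R) :
  measurable_fun setT f -> (forall s, 0 <= f s)%E ->
  (\int[leb]_(s in (fun s => s + c)%R @^-1` [set` Interval a b]) f (s + c)%R =
   \int[leb]_(s in [set` Interval a b]) f s)%E.
Proof.
move=> mf f0.
have mc : measurable_fun setT (fun s : measurableTypeR R => s + c : measurableTypeR R).
  exact: measurable_funD.
have := @ge0_integral_pushforward _ _ _ _ R _ mc leb [set` Interval a b] f
  (measurable_itv _) (measurable_funTS mf) (fun s _ => f0 s).
move=> <-; apply: eq_measure_integral => A mA _.
exact: lebesgue_translation.
Qed.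

Lemma Rintegral_translation c (a b : itv_bound R) (f : R -> R) :
  measurable_fun setT f ->
  leb.-integrable [set` Interval a b] (EFin \o f) ->
  \int[leb]_(s in (fun s => s + c)%R @^-1` [set` Interval a b]) f (s + c)%R =
   \int[leb]_(s in [set` Interval a b]) f s.
Proof.
move=> mf fi.
have mc : measurable_fun setT (fun s : measurableTypeR R => s + c : measurableTypeR R).
  exact: measurable_funD.
have mD : measurable ((fun s : measurableTypeR R => s + c : measurableTypeR R) @^-1` [set` Interval a b]).
  by rewrite -[X in measurable X]setTI; apply: mc => //; exact: measurable_itv.
have mE : measurable_fun setT (EFin \o f) by exact/measurable_EFinP.
have fi' : leb.-integrable ((fun s : measurableTypeR R => s + c : measurableTypeR R) @^-1` [set` Interval a b])
    ((EFin \o f) \o (fun s => s + c)).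
  apply/integrableP; split.
    by apply: measurable_funTS; exact: measurableT_comp.
  case/integrableP : fi => _; apply: le_lt_trans.
  have := @ge0_integral_translation c a b (fun s => `|(EFin \o f) s|%E).
  by move=> <-//; exact: measurableT_comp.
have := @integral_pushforward _ _ _ _ R _ mc leb [set` Interval a b] _
  mE fi' (measurable_itv _).
move=> E; rewrite /Rintegral -[X in fine X]E; congr fine.
apply: eq_measure_integral => A mA _; exact: lebesgue_translation.
Qed.

Lemma ae_leb_mu01 (P : R -> Prop) : {ae leb, forall s, P s} -> {ae mu, forall s, P s}.
Proof.
move=> [N [mN N0 PN]]; exists N; split => //.
apply/eqP; rewrite eq_le measure_ge0 andbT /= /mrestr -N0.
by apply: le_measure; rewrite ?inE//; exact: measurableI.
Qed.

End mu01_lebesgue.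

Section primitive.
Context {R : realType}.
Local Notation leb := (@lebesgue_measure R).
Local Notation mu := (mu01 R).
Local Notation X := (L2 R).
Implicit Types g x : X.

(** The 1-periodic extension, so that a window [[s, s + h]] may leave []0, 1[]. Since [s] and [h]
    are at most 1, integrals over parts of [[0, 2]] suffice. *)
Definition per g (s : R) : R := Lrepr g (frpart s).

Lemma measurable_per g : measurable_fun setT (per g).
Proof.
apply: measurableT_comp; first exact: Lrepr_m.
by have := @measurable_frac R 0; under eq_fun do rewrite addr0.
Qed.

Lemma per_D1 g s : per g (s + 1) = per g s.
Proof. by rewrite /per fracD1. Qed.

Lemma per_id g s : 0 <= s < 1 -> per g s = Lrepr g s.
Proof. by move=> s01; rewrite /per frac_id. Qed.

Lemma integrable_per01 g : leb.-integrable `]0, 1[ (EFin \o per g).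
Proof.
have := integrable_Lrepr g => /integrable_mu01 => /(_ (Lrepr_m g)).
apply: eq_integrable; first exact: measurable_itv.
by move=> s; rewrite inE/= in_itv/= => /andP[s0 s1]; rewrite per_id// (ltW s0).
Qed.

Lemma integrable_per g : leb.-integrable `[0, 2] (EFin \o per g).
Proof.
have m : measurable_fun setT (EFin \o per g) by apply/measurable_EFinP; exact: measurable_per.
have ma : measurable_fun setT (fun s => `|(EFin \o per g) s|%E) by exact: measurableT_comp.
apply/integrableP; split; first exact: measurable_funTS.
have -> : `[0%R : R, 2]%classic = `[0, 1]%classic `|` `]1, 2]%classic.
  apply/seteqP; split => s /=; rewrite !in_itv/=.
    by move=> /andP[s0 s2]; case: (leP s 1) => s1; [left|right]; lra.
  by move=> [|] /andP[? ?]; lra.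
rewrite ge0_integral_setU//=; last 2 first.
- exact: measurable_funTS.
- rewrite disj_set2E; apply/eqP/seteqP; split => s //=; rewrite !in_itv/=; lra.
have E (a b : bool) : (\int[leb]_(s in [set` Interval (BSide a (0%R:R)) (BSide b 1%R)])
    `|(EFin \o per g) s| < +oo)%E.
  rewrite integral_itv_bndoo//; last exact: measurable_funTS.
  by have /integrableP[] := integrable_per01 g.
rewrite lte_add_pinfty//.
rewrite -(@ge0_integral_translation R 1)//.
rewrite (_ : _ @^-1` _ = `]0, 1]%classic); last first.
  by apply/seteqP; split => s /=; rewrite !in_itv/=; lra.
by under eq_integral => s _ do rewrite per_D1.
Qed.

Lemma integrable_perS g (a b : bool) (u v : R) : 0 <= u -> v <= 2 ->
  leb.-integrable [set` Interval (BSide a u) (BSide b v)] (EFin \o per g).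
Proof.
move=> u0 v2; apply: integrableS (integrable_per g) => //.
by apply: subset_itv; [case: a|case: b]; rewrite bnd_simp.
Qed.

Definition prim g (s : R) : R := \int[leb]_(u in `[0, s]) per g u.

Lemma prim0 g : prim g 0 = 0.
Proof. by rewrite /prim set_itv1 Rintegral_set1. Qed.

Lemma primB g (a b : R) : 0 <= a -> a <= b -> b <= 2 ->
  prim g b - prim g a = \int[leb]_(u in `]a, b]) per g u.
Proof.
move=> a0 ab b2; rewrite /prim Rintegral_itvB//.
exact: integrable_perS.
Qed.

(** The primitive gains the mean [prim g 1] over each period, so it is periodic when that mean
    vanishes; this is how the boundary condition will enter. *)
Lemma primD1 g (s : R) : 0 <= s <= 1 -> prim g (s + 1) = prim g s + prim g 1.
Proof.
move=> /andP[s0 s1]; apply/eqP; rewrite -subr_eq; apply/eqP.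
rewrite primB; [|lra..].
rewrite -(@Rintegral_translation R 1); last 2 first.
- exact: measurable_per.
- by apply: integrable_perS; lra.
rewrite (_ : _ @^-1` _ = `]0, s]%classic); last first.
  by apply/seteqP; split => u /=; rewrite !in_itv/=; lra.
have -> : prim g s = prim g s - prim g 0 by rewrite prim0 subr0.
rewrite primB; [|lra..].
by apply: eq_Rintegral => u _; rewrite per_D1.
Qed.

Lemma prim1E g : prim g 1 = \int[mu]_s Lrepr g s.
Proof.
rewrite Rintegral_mu01; last exact: integrable_Lrepr.
rewrite /prim /Rintegral integral_itv_bndoo//; last first.
  by apply: measurable_funTS; apply/measurable_EFinP; exact: measurable_per.
congr fine; apply: eq_integral => s; rewrite inE/= in_itv/= => /andP[s0 s1].
by rewrite per_id// (ltW s0).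
Qed.

Lemma continuous_prim g : {within `[0, 2], continuous (prim g)}.
Proof. by apply: parameterized_integral_continuous; [lra|exact: integrable_per]. Qed.

Lemma measurable_prim g : measurable_fun `[0%R : R, 2] (prim g).
Proof.
apply: subspace_continuous_measurable_fun; first exact: measurable_itv.
exact: continuous_prim.
Qed.

Lemma indic_oo_Lfun (a b : R) : (\1_(`]a, b[) : R -> R) \in Lfun mu (2%:R)%:E.
Proof.
apply: (@bounded_Lfun _ _ 1).
  by apply: measurable_indic; exact: measurable_itv.
by move=> s; rewrite indicE; case: (_ \in _); rewrite ?normr1 ?normr0.
Qed.

Definition indic_oo (a b : R) : X := Lclass (lee1n 2) (indic_oo_Lfun a b).

Lemma norm_indic_oo_le1 (a b : R) : `|indic_oo a b| <= 1.
Proof.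
rewrite -[leRHS]normr1; apply: norm_le_cst.
apply: (ae_imp (ae_Lclass (indic_oo_Lfun a b))) => s ->.
by rewrite indicE; case: (_ \in _); rewrite ?normr1 ?normr0.
Qed.

Lemma inner_indic_oo g (a b : R) : 0 <= a -> b <= 1 ->
  inner (indic_oo a b) g = \int[leb]_(u in `]a, b[) per g u.
Proof.
move=> a0 b1.
have im : mu.-integrable setT (EFin \o (fun s => \1_(`]a, b[) s * Lrepr g s)).
  apply/Lfun1_integrable; apply: Lfun2_mul_Lfun1; last exact: Lrepr_Lfun.
  exact: indic_oo_Lfun.
rewrite inner_Lclass Rintegral_mu01//.
rewrite (_ : `]a, b[%classic = `]0, 1[ `&` `]a, b[); last first.
  by apply/seteqP; split => s /=; rewrite !in_itv/=; lra.
rewrite Rintegral_mkcondr; apply: eq_Rintegral => s.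
rewrite inE/= in_itv/= => /andP[s0 s1]; rewrite patchE indicE.
rewrite setIidr; last by move=> u /=; rewrite !in_itv/=; lra.
by case: ifPn => _; rewrite ?mul1r ?mul0r// per_id// (ltW s0).
Qed.

(** As inner products, increments of a primitive become linear in [g] and are controlled by
    Cauchy-Schwarz. *)
Lemma prim_inner g (a b : R) : 0 <= a -> a <= b -> b <= 1 ->
  prim g b - prim g a = inner (indic_oo a b) g.
Proof.
move=> a0 ab b1; rewrite primB; [|lra..].
rewrite inner_indic_oo// Rintegral_itv_bndo_bndc//.
by apply: integrable_perS; lra.
Qed.

Lemma norm_prim_le g (a b : R) : 0 <= a -> a <= b -> b <= 1 ->
  `|prim g b - prim g a| <= `|g|.
Proof.
move=> a0 ab b1; rewrite prim_inner//; apply: le_trans (inner_le_norm _ _) _.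
by rewrite -[leRHS]mul1r ler_wpM2r// norm_indic_oo_le1.
Qed.

Lemma prim_inner0 g (s : R) : 0 <= s <= 1 -> prim g s = inner (indic_oo 0 s) g.
Proof. by move=> /andP[s0 s1]; rewrite -prim_inner// prim0 subr0. Qed.

End primitive.

(** * Averages *)

Section averages.
Context {R : realType}.
Local Notation leb := (@lebesgue_measure R).
Local Notation mu := (mu01 R).
Local Notation X := (L2 R).
Implicit Types (g x : X) (h : R).

(** Expand the nonnegative integral of [(f - m) ^+ 2], where [m] is the mean of [f]; this requires
    [f ^+ 2] to be integrable, and otherwise the right-hand side is infinite. *)
Lemma jensen_sqr (D : set R) (f : R -> R) h : measurable D -> leb D = h%:E -> 0 < h ->
  leb.-integrable D (EFin \o f) ->
  (((h^-1 * \int[leb]_(s in D) f s) ^+ 2)%:E <=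
   h^-1%:E * \int[leb]_(s in D) (f s ^+ 2)%:E)%E.
Proof.
move=> mD Dh h0 fi; set J := (\int[leb]_(s in D) (f s ^+ 2)%:E)%E.
have mf : measurable_fun D f by have /integrableP[/measurable_EFinP] := fi.
have J0 : (0 <= J)%E by apply: integral_ge0 => s _; rewrite lee_fin sqr_ge0.
have [Jy|Jy] := eqVneq J +oo%E.
  by rewrite Jy gt0_muley ?leey// lte_fin invr_gt0.
have f2 : leb.-integrable D (EFin \o (fun s => f s ^+ 2)).
  apply/integrableP; split; first by apply/measurable_EFinP; exact: measurable_funX.
  rewrite (_ : (\int[leb]_(x in D) _)%E = J); first by rewrite ltey.
  by apply: eq_integral => s _ /=; rewrite ger0_norm// sqr_ge0.
have JE : J = (\int[leb]_(s in D) (f s ^+ 2))%:E.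
  by rewrite /Rintegral fineK//; exact: integrable_fin_num f2.
rewrite JE -EFinM lee_fin; set m := h^-1 * _.
have mh : \int[leb]_(s in D) f s = m * h by rewrite /m mulrAC mulVf ?mul1r// gt_eqF.
have c2 (c : R) : leb.-integrable D (EFin \o (fun=> c)).
  apply/integrableP; split; first exact: measurable_cst.
  rewrite (_ : (\int[leb]_(x in D) _)%E = (`|c|%:E * leb D)%E); last exact: integral_cst.
  by rewrite Dh -EFinM ltry.
have f1 : leb.-integrable D (EFin \o (fun s => (- (2 * m)) * f s)).
  apply: (@eq_integrable _ _ _ leb D _ (fun s => ((- (2 * m))%:E * (EFin \o f) s)%E)) => //.
  exact: integrableZl.
have f12 : leb.-integrable D (EFin \o (fun s => f s ^+ 2 + (- (2 * m)) * f s)).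
  exact: integrable_EFinD.
have cE : \int[leb]_(s in D) (m ^+ 2) = m ^+ 2 * fine (leb D) by exact: Rintegral_cst.
have : 0 <= \int[leb]_(s in D) (f s ^+ 2 + (- (2 * m)) * f s + m ^+ 2).
  apply: Rintegral_ge0 => s _.
  by rewrite (_ : _ + _ = (f s - m) ^+ 2) ?sqr_ge0//; ring.
rewrite RintegralD// RintegralD// RintegralZl// cE Dh /= mh => H.
have aux (I m' : R) : 0 <= I + - (2 * m') * (m' * h) + m' ^+ 2 * h -> m' ^+ 2 <= h^-1 * I.
  by rewrite [h^-1 * _]mulrC ler_pdivlMr// expr2; clear; lra.
exact: aux H.
Qed.

(** At once the mean of [per g] over [[s, s + h]] and the difference quotient of its primitive; it
    is cut off because [prim] is only controlled on [[0, 2]]. *)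
Definition avg_fun h g : R -> R :=
  (fun s => h^-1 * (prim g (s + h) - prim g s)) \_ `]0, 1[.

Lemma measurable_avg_fun h g : 0 < h <= 1 -> measurable_fun setT (avg_fun h g).
Proof.
move=> /andP[h0 h1]; apply/(measurable_restrictT _ _).1; first exact: measurable_itv.
apply: measurable_funM => //; apply: measurable_funB; last first.
  apply: measurable_funS (measurable_prim g); first exact: measurable_itv.
  by move=> s /=; rewrite !in_itv/=; lra.
apply: (measurable_comp _ _ (measurable_prim g)).
- exact: measurable_itv.
- by move=> _ /= [s + <-]; rewrite !in_itv/=; lra.
- exact: measurable_funD.
Qed.

Let K h g : R * R -> \bar R :=
  (fun z : R * R => (per g (z.2 + z.1) ^+ 2)%:E) \_ (`]0, 1[ `*` `]0, h]).

Let K_ge0 h g z : (0 <= K h g z)%E.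
Proof. by rewrite /K patchE; case: ifPn => // _; rewrite lee_fin sqr_ge0. Qed.

Let measurable_K h g : measurable_fun setT (K h g).
Proof.
apply/(measurable_restrictT _ _).1.
  by apply: measurableX; exact: measurable_itv.
apply: measurable_funTS; apply/measurable_EFinP; apply: measurable_funX.
apply: (measurableT_comp (measurable_per g)).
by apply: measurable_funD; [exact: measurable_snd|exact: measurable_fst].
Qed.

(** Jensen bounds the square of each mean by the mean of the squares. After Tonelli, the integral
    over [s] at a fixed offset [y] is that of a rotation of the square of [g], whose value does not
    depend on [y]; integrating over [y] gives the factor [h] that cancels [h^-1]. *)
Lemma integral_avg_fun h g : 0 < h <= 1 ->
  (\int[mu]_s (avg_fun h g s ^+ 2)%:E <= (`|g| ^+ 2)%:E)%E.
Proof.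
move=> /andP[h0 h1].
have mper2 : measurable_fun setT (fun s => (per g s ^+ 2)%:E).
  by apply/measurable_EFinP; apply: measurable_funX; exact: measurable_per.
have mavg : measurable_fun setT (fun s => (avg_fun h g s ^+ 2)%:E).
  by apply/measurable_EFinP; apply: measurable_funX; apply: measurable_avg_fun; rewrite h0.
have K1 s : (`]0%R, 1%R[%classic s) -> (\int[leb]_y K h g (s, y) =
    \int[leb]_(y in `]s, (s + h)%R]) (per g y ^+ 2)%:E)%E.
  move=> s01; rewrite -(@ge0_integral_translation _ s); last 2 first.
  - exact: mper2.
  - by move=> u; rewrite lee_fin sqr_ge0.
  rewrite (_ : _ @^-1` _ = `]0, h]%classic); last first.
    by apply/seteqP; split => u /=; rewrite !in_itv/=; lra.
  rewrite [RHS]integral_mkcond; apply: eq_integral => y _.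
  rewrite /K !patchE; congr (if _ then _ else _).
  by apply/idP/idP; rewrite !inE /= => -[].
have -> : (`|g| ^+ 2)%:E = (\int[mu]_s (Lrepr g s ^+ 2)%:E)%E.
  rewrite normL2_sqrE /Rintegral fineK//; apply: integrable_fin_num => //.
  exact: Lfun2_integrable_sqr (Lrepr_Lfun _).
apply: (@le_trans _ _ (h^-1%:E * \int[leb]_s \int[leb]_y K h g (s, y))%E).
  have mF := @measurable_fun_fubini_tonelli_F _ _ _ _ R leb (K h g) (measurable_K h g) (K_ge0 h g).
  rewrite -ge0_integralZl//; last 2 first.
  - by move=> s _; apply: integral_ge0 => y _; exact: K_ge0.
  - by rewrite lee_fin invr_ge0 ltW.
  rewrite ge0_integral_mu01//; last by move=> s; rewrite lee_fin sqr_ge0.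
  rewrite [leLHS]integral_mkcond; apply: ge0_le_integral => //.
  - by move=> s _; rewrite patchE; case: ifPn => // _; rewrite lee_fin sqr_ge0.
  - apply/(measurable_restrictT _ _).1; first exact: measurable_itv.
    exact: measurable_funTS.
  - exact: measurable_funeM.
  move=> s _; rewrite patchE; case: ifPn => [|_]; last first.
    by rewrite mule_ge0 ?lee_fin ?invr_ge0 ?(ltW h0)// integral_ge0// => y _; exact: K_ge0.
  rewrite inE => s01; rewrite K1// /avg_fun patchE mem_set//.
  move: (s01); rewrite /= in_itv/= => /andP[s0 s1].
  rewrite primB; [|lra..].
  apply: jensen_sqr => //.
  - rewrite lebesgue_measure_itv/= lte_fin ltrDl h0 -EFinD; congr (_%:E); ring.
  - by apply: integrable_perS; lra.
rewrite (@fubini_tonelli _ _ _ _ R leb leb (K h g))//; last exact: measurable_K.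
have -> : (\int[leb]_y \int[leb]_s K h g (s, y) =
    \int[leb]_(y in `]0%R, h]) \int[mu]_s (Lrepr g s ^+ 2)%:E)%E.
  rewrite [RHS]integral_mkcond; apply: eq_integral => y _.
  rewrite patchE; case: ifPn => yh; last first.
    rewrite -[RHS](integral0 leb setT); apply: eq_integral => s _.
    rewrite /K patchE ifF//; apply/negbTE; move: yh; apply: contra.
    by rewrite !inE => -[].
  rewrite -(@ge0_integral_frac _ y (fun s => (Lrepr g s ^+ 2)%:E)); last 2 first.
  - by apply/measurable_EFinP; apply: measurable_funX; exact: Lrepr_m.
  - by move=> s; rewrite lee_fin sqr_ge0.
  rewrite ge0_integral_mu01; last 2 first.
  - apply/measurable_EFinP; apply: measurable_funX.
    by apply: measurableT_comp; [exact: Lrepr_m|exact: measurable_frac].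
  - by move=> s; rewrite lee_fin sqr_ge0.
  rewrite [RHS]integral_mkcond; apply: eq_integral => s _.
  rewrite /K !patchE /= /per addrC; congr (if _ then _ else _).
  apply/idP/idP; rewrite !inE /=; first by case.
  by move=> s01; split => //; rewrite inE in yh.
move: (\int[mu]_s (Lrepr g s ^+ 2)%:E)%E => c.
have -> : (\int[leb]_(y in `]0%R, h]) c = c * h%:E)%E.
  rewrite integral_cst//; congr (_ * _)%E; transitivity (leb `]0, h]%classic) => //.
  by rewrite lebesgue_measure_itv/= lte_fin h0 oppr0 adde0.
by rewrite muleCA -EFinM mulVf ?mule1// gt_eqF.
Qed.

Lemma avg_Lfun h g : 0 < h <= 1 -> avg_fun h g \in Lfun mu (2%:R)%:E.
Proof.
move=> h01; apply/Lfun2P; first exact: measurable_avg_fun.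
by apply: le_lt_trans (integral_avg_fun g h01) _; rewrite ltry.
Qed.

Definition avg h (h01 : 0 < h <= 1) g : X := Lclass (lee1n 2) (avg_Lfun g h01).

Lemma ae_avg h (h01 : 0 < h <= 1) g : {ae mu, forall s,
  Lrepr (avg h01 g) s = h^-1 * (prim g (s + h) - prim g s)}.
Proof.
apply: (ae_imp2 (ae_Lclass (avg_Lfun g h01)) (@ae_mu01_itv R)) => s -> s01.
by rewrite /avg_fun patchE mem_set//= in_itv.
Qed.

Lemma norm_avg h (h01 : 0 < h <= 1) g : `|avg h01 g| <= `|g|.
Proof.
rewrite -(@ler_pXn2r _ 2)// ?nnegrE// -lee_fin; apply: le_trans (integral_avg_fun g h01).
rewrite normL2_sqrE /Rintegral fineK; last first.
  apply: integrable_fin_num => //; exact: Lfun2_integrable_sqr (Lrepr_Lfun _).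
rewrite le_eqVlt; apply/orP; left; apply/eqP; apply: ae_eq_integral => //.
- by apply/measurable_EFinP; apply: measurable_funX; exact: Lrepr_m.
- by apply/measurable_EFinP; apply: measurable_funX; exact: measurable_avg_fun.
- by apply: (ae_imp (ae_Lclass (avg_Lfun g h01))) => s ->.
Qed.

End averages.

Section averages_cvg.
Context {R : realType}.
Local Notation leb := (@lebesgue_measure R).
Local Notation mu := (mu01 R).
Local Notation X := (L2 R).
Implicit Types (g x : X) (h : R).

Lemma ae_prim_derive g : {ae mu, forall s,
  h^-1 * (prim g (s + h) - prim g s) @[h --> 0^'+] --> Lrepr g s}.
Proof.
(* Lebesgue differentiation is applied to a function integrable on the whole line that coincides
   with [per g] near every point of []0, 1[]. *)
pose f : R -> R := (per g) \_ `[0, 2].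
have locf : locally_integrable setT f.
  by apply: integrable_locally; [exact: measurable_itv|exact: integrable_per].
have intf : leb.-integrable setT (EFin \o f).
  rewrite -restrict_EFin.
  have := @integrable_mkcond _ (measurableTypeR R) R leb `[0, 2]%classic (EFin \o per g).
  by move=> /(_ (measurable_itv _))[+ _]; apply; exact: integrable_per.
have intfS y : leb.-integrable [set` Interval (BLeft 0) (BRight y)] (EFin \o f).
  by apply: integrableS intf.
pose F y := \int[leb]_(t in [set` Interval (BLeft 0) (BRight y)]) f t.
have FE y : y <= 2 -> F y = prim g y.
  move=> y2; apply: eq_Rintegral => s; rewrite inE/= in_itv/= => /andP[s0 sy].
  by rewrite /f patchE mem_set//= in_itv/= s0 (le_trans sy).
apply: (ae_imp2 (ae_leb_mu01 (FTC1 intfS locf)) (@ae_mu01_itv R)) => s H /andP[s0 s1].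
have [dF F's] := H ltac:(by rewrite /= lte_fin).
have fs : f s = Lrepr g s.
  rewrite /f patchE mem_set; last by rewrite /= in_itv/=; lra.
  by rewrite per_id// s1 ltW.
rewrite -fs -F's derive1E.
have : h^-1 *: ((F \o shift s) (h *: 1) - F s) @[h --> 0^'+] --> 'D_1 F s.
  exact: cvg_dnbhs_at_right.
apply: cvg_trans; apply: near_eq_cvg; near=> h.
rewrite /= -FE; last first.
  by rewrite -lerBrDl; near: h; apply: nbhs_right_le; lra.
rewrite -FE; last by lra.
by rewrite (_ : h *: 1 = h) ?(addrC h s)//; exact: mulr1.
Unshelve. all: by end_near. Qed.

Lemma ae_avg_cvg g (u : R^nat) (u01 : forall n, 0 < u n <= 1) :
  u n @[n --> \oo] --> 0 ->
  {ae mu, forall s, Lrepr (avg (u01 n) g) s @[n --> \oo] --> Lrepr g s}.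
Proof.
move=> u0.
have h : {ae mu, forall s, forall n, Lrepr (avg (u01 n) g) s =
    (u n)^-1 * (prim g (s + u n) - prim g s)}.
  by apply/ae_foralln => n; exact: ae_avg.
apply: (ae_imp2 (ae_prim_derive g) h) => s H E.
have -> : (fun n => Lrepr (avg (u01 n) g) s) =
  (fun h => h^-1 * (prim g (s + h) - prim g s)) \o u.
  by apply/funext => n; rewrite E.
have /cvg_at_rightP := H; apply; split => // n.
by case/andP: (u01 n).
Qed.

(** Almost everywhere convergence and the norm bound [norm_avg] suffice for convergence in norm:
    Fatou for the squares of [avg g + g], whose limit is [4 * g ^ 2], shows that their integrals
    cannot stay below [4 * |g| ^ 2], and the parallelogram law turns this into smallness of
    [avg g - g]. *)
Lemma cvg_avg_seq g (u : R^nat) (u01 : forall n, 0 < u n <= 1) e :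
  u n @[n --> \oo] --> 0 -> 0 < e ->
  exists n, `|avg (u01 n) g - g| ^+ 2 < e.
Proof.
move=> u0 e0; apply: contrapT => /forallNP H.
have {}H n : e <= `|avg (u01 n) g - g| ^+ 2 by rewrite leNgt; apply/negP.
pose f n s := ((Lrepr (avg (u01 n) g) s + Lrepr g s) ^+ 2)%:E.
have mf n : measurable_fun setT (f n).
  apply/measurable_EFinP; apply: measurable_funX.
  by apply: measurable_funD; exact: Lrepr_m.
have f0 n s : (0 <= f n s)%E by rewrite lee_fin sqr_ge0.
have int4 : (\int[mu]_s (4 * Lrepr g s ^+ 2)%:E = (4 * `|g| ^+ 2)%:E)%E.
  have ig : mu.-integrable setT (EFin \o (fun s => Lrepr g s ^+ 2)).
    exact: Lfun2_integrable_sqr (Lrepr_Lfun _).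
  rewrite normL2_sqrE -RintegralZl// /Rintegral fineK//.
  by apply: integrable_fin_num => //; exact: integrable_EFinZ.
have F := @fatou _ _ R mu setT measurableT f mf (fun n s _ => f0 n s).
have E1 : (\int[mu]_s limn_einf (f^~ s) = (4 * `|g| ^+ 2)%:E)%E.
  rewrite -int4; apply: ae_eq_integral => //.
  - rewrite (_ : (fun s => _) = (fun s => - limn_esup ((fun n s => - f n s)^~ s))%E).
      apply: measurableT_comp => //; apply: measurable_fun_limn_esup => n.
      exact: measurableT_comp.
    have K (v : (\bar R)^nat) : limn_einf v = (- limn_esup (fun n => - v n))%E.
      by rewrite -[limn_esup _]/(limn_esup (-%E \o v)) limn_esupN oppeK.
    by apply/funext => s; exact: K.
  - apply/measurable_EFinP; apply: measurable_funM => //.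
    by apply: measurable_funX; exact: Lrepr_m.
  - apply: (ae_imp (ae_avg_cvg g u01 u0)) => s Hs _.
    have : f n s @[n --> \oo] --> (4 * Lrepr g s ^+ 2)%:E.
      apply: cvg_EFin; first by near=> n.
      rewrite (_ : 4 * _ = (Lrepr g s + Lrepr g s) * (Lrepr g s + Lrepr g s)); last by ring.
      rewrite (_ : fine \o _ = fun n => (Lrepr (avg (u01 n) g) s + Lrepr g s) *
        (Lrepr (avg (u01 n) g) s + Lrepr g s)); last first.
        by apply/funext => n; rewrite /= expr2.
      by apply: cvgM; apply: cvgD => //; exact: cvg_cst.
    by move=> /cvg_limn_einf_sup[].
(* By the parallelogram law and [|avg g| <= |g|], a squared distance of at least [e] leaves at most
   [4 * |g| ^ 2 - e] for the squared norm of the sum. *)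
have E2 n : (\int[mu]_s f n s <= (4 * `|g| ^+ 2 - e)%:E)%E.
  have -> : (\int[mu]_s f n s = (`|avg (u01 n) g + g| ^+ 2)%:E)%E.
    rewrite normL2_sqrE /Rintegral fineK; last first.
      apply: integrable_fin_num => //; exact: Lfun2_integrable_sqr (Lrepr_Lfun _).
    apply: ae_eq_integral => //.
    - by apply/measurable_EFinP; apply: measurable_funX; exact: Lrepr_m.
    - by apply: (ae_imp (aeD (avg (u01 n) g) g)) => s ->.
  rewrite lee_fin; have := H n; have : `|avg (u01 n) g| ^+ 2 <= `|g| ^+ 2.
    by rewrite ler_pXn2r ?nnegrE// norm_avg.
  have := normL2D (avg (u01 n) g) g; have := normL2B (avg (u01 n) g) g; lra.
move: F; rewrite E1 limn_einf_lim => F.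
have : (limn (einfs (fun n => \int[mu]_s f n s)) <= (4 * `|g| ^+ 2 - e)%:E)%E.
  apply: lime_le; first exact: is_cvg_einfs.
  near=> n; apply: le_trans (E2 n); apply: ereal_inf_lbound => /=.
  by exists n => //=.
move=> /(le_trans F); rewrite lee_fin; lra.
Unshelve. all: by end_near. Qed.

(** A failure would produce windows of lengths below [1 / (n + 1)] at distance at least [e], which
    reduces the claim to sequences, where Fatou applies. *)
Lemma avg_cvg g e : 0 < e ->
  exists2 d, 0 < d & forall h (h01 : 0 < h <= 1), h < d -> `|avg h01 g - g| < e.
Proof.
move=> e0; apply: contrapT => H.
have K n : exists h, exists h01 : 0 < h <= 1, h < n.+1%:R^-1 /\ e <= `|avg h01 g - g|.
  apply: contrapT => Hn; apply: H; exists n.+1%:R^-1; first by rewrite invr_gt0.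
  move=> h h01 hn; rewrite ltNge; apply/negP => eh; apply: Hn.
  by exists h, h01.
pose u n := sval (cid (K n)).
have u01 n : 0 < u n <= 1 by rewrite /u; case: cid => h /= [].
have uP n : u n < n.+1%:R^-1 /\ e <= `|avg (u01 n) g - g|.
  move: (u01 n); rewrite /u; case: cid => h /= [h01 hP] h01'.
  by rewrite (Prop_irrelevance h01' h01).
have u0 : u n @[n --> \oo] --> 0.
  apply: (@squeeze_cvgr _ _ _ _ (cst 0) (fun n => n.+1%:R^-1)).
  - near=> n; have [/ltW -> _] := uP n; rewrite andbT.
    by case/andP: (u01 n) => /ltW.
  - exact: cvg_cst.
  - exact: cvg_harmonic.
have e20 : 0 < e ^+ 2 by rewrite exprn_gt0.
have [n] := cvg_avg_seq g u01 u0 e20.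
have [_ en] := uP n.
by rewrite ltNge ler_pXn2r ?nnegrE ?(ltW e0)// en.
Unshelve. all: by end_near. Qed.

End averages_cvg.

(** * Difference quotients of rotations *)

Section real_lemmas.
Context {R : realType}.

Lemma cvg_at_right0P (V : normedModType R) (F : R -> V) (l : V) :
  (F h @[h --> 0^'+] --> l) <->
  (forall e, 0 < e -> exists2 d, 0 < d & forall h, 0 < h < d -> `|F h - l| < e).
Proof.
split=> [H e e0|H].
  have /cvgrPdist_lt /(_ e e0) := H.
  rewrite /prop_near1 /nbhs /= /at_right /within /= => /nbhs_ballP[d d0 dP].
  exists d => // h /andP[h0 hd]; rewrite distrC; apply: dP => //=.
  by rewrite /ball/= sub0r normrN gtr0_norm.
apply/cvgrPdist_lt => e e0; have [d d0 dP] := H e e0.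
near=> h; rewrite distrC; apply: dP; apply/andP; split.
  by near: h; exact: nbhs_right_gt.
by near: h; exact: nbhs_right_lt.
Unshelve. all: by end_near. Qed.

(** Derivatives of the smoothed step [ramp] and of tested flows are obtained from such quadratic
    remainders. *)
Lemma is_derive_quad (f : R -> R) (s l C d : R) : 0 < d ->
  (forall h, `|h| < d -> `|f (s + h) - f s - h * l| <= C * h ^+ 2) -> is_derive s 1 f l.
Proof.
move=> d0 H.
have K : h^-1 *: ((f \o shift s) (h *: (1 : R)) - f s) @[h --> 0^'] --> l.
  apply/cvgrPdist_lt => e e0; near=> h.
  have h0 : h != 0 by near: h; exact: nbhs_dnbhs_neq.
  rewrite /= (_ : h *: 1 = h); last exact: mulr1.
  rewrite (addrC h s) (_ : _ *: _ = h^-1 * (f (s + h) - f s))//.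
  rewrite (_ : l - _ = - (h^-1 * (f (s + h) - f s - h * l))); last first.
    by rewrite [in RHS]mulrBr mulrA mulVf// mul1r opprB.
  rewrite normrN normrM normfV mulrC ltr_pdivrMr ?normr_gt0//.
  have hd : `|h| < d by near: h; exact: dnbhs0_lt.
  apply: le_lt_trans (H _ hd) _.
  rewrite -(@real_normK _ h) ?num_real// expr2 mulrA ltr_pM2r ?normr_gt0//.
  have C1 : 0 < `|C| + 1 by rewrite ltr_wpDl.
  apply: (@le_lt_trans _ _ ((`|C| + 1) * `|h|)).
    by rewrite ler_wpM2r// (le_trans (ler_norm C))// lerDl.
  rewrite mulrC -ltr_pdivlMr//; near: h; apply: dnbhs0_lt.
  by rewrite divr_gt0.
split; first by apply/cvg_ex; exists l.
by apply/cvg_lim.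
Unshelve. all: by end_near. Qed.

End real_lemmas.

Section generator.
Context {R : realType}.
Local Notation leb := (@lebesgue_measure R).
Local Notation mu := (mu01 R).
Local Notation X := (L2 R).
Implicit Types (g x y : X) (h : R).

Lemma shift_opB t x y : shift_op t (x - y) = shift_op t x - shift_op t y.
Proof. exact: (raddfB (shift_op t)). Qed.

Lemma shift_opZ t a x : shift_op t (a *: x) = a *: shift_op t x.
Proof. exact: (linearZ_LR (shift_op t)). Qed.

Lemma ae_mu01_leb (P : R -> Prop) : {ae mu, forall s, P s} ->
  {ae leb, forall s, `]0, 1[%classic s -> P s}.
Proof.
move=> [N [mN N0 PN]]; exists (N `&` `]0, 1[); split => //.
  by apply: measurableI => //; exact: measurable_itv.
move=> s /= /not_implyP[s01 Ps]; split => //; exact: PN.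
Qed.

(* x has an absolutely continuous 1-periodic representative with derivative g *)
Definition ac x g : Prop := prim g 1 = 0 /\
  exists k : R, {ae mu, forall s, Lrepr x s = k + prim g s}.

Lemma prim_frpart g (s : R) : prim g 1 = 0 -> 0 <= s < 2 -> prim g (frpart s) = prim g s.
Proof.
move=> g1 /andP[s0 s2]; have [s1|s1] := ltP s 1; first by rewrite frac_id ?s0.
rewrite -fracB1 frac_id; last by lra.
have := @primD1 _ g (s - 1); rewrite subrK g1 addr0 => -> //; lra.
Qed.

(** The constant of integration cancels in the difference, and the vanishing mean of [g] lets the
    primitive continue past 1; so the difference quotient is an average exactly, not only in the
    limit. *)
Lemma ac_avg x g h (h01 : 0 < h <= 1) : ac x g ->
  h^-1 *: (shift_op h x - x) = avg h01 g.
Proof.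
move=> [g1 [k xk]]; apply/L2_eqP.
have A := ae_imp3 (aeZ h^-1 (shift_op h x - x)) (aeB (shift_op h x) x) (ae_shift h x)
  (fun _ P Q S => conj P (conj Q S)).
have B := ae_imp3 xk (ae_frac h xk) (ae_avg h01 g) (fun _ P Q S => conj P (conj Q S)).
apply: (ae_imp3 A B (@ae_mu01_itv R)) => s [-> [-> ->]] [-> [-> ->]] s01.
rewrite prim_frpart//; last by lra.
by congr (_ * _); ring.
Qed.

Lemma ac_cvg x g : ac x g ->
  h^-1 *: (shift_op h x - x) @[h --> 0^'+] --> g.
Proof.
move=> xg; apply/cvg_at_right0P => e e0.
have [d d0 dP] := avg_cvg g e0.
exists (Num.min d 1); first by rewrite lt_min d0 ltr01.
move=> h /andP[h0]; rewrite lt_min => /andP[hd h1].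
have h01 : 0 < h <= 1 by rewrite h0 ltW.
by rewrite (ac_avg h01 xg); exact: dP.
Qed.

Lemma ac_norm_shift x g h : 0 < h <= 1 -> ac x g -> `|shift_op h x - x| <= h * `|g|.
Proof.
move=> h01 xg; have h0 : 0 < h by case/andP : h01.
have -> : shift_op h x - x = h *: avg h01 g.
  by rewrite -(ac_avg h01 xg) scalerA mulfV ?scale1r// gt_eqF.
by rewrite normrZ gtr0_norm// ler_pM2l// norm_avg.
Qed.

Lemma prim_shift x h (s : R) : 0 <= h <= 1 -> 0 <= s <= 1 ->
  prim (shift_op h x) s = prim x (s + h) - prim x h.
Proof.
move=> h01 s01; rewrite prim_inner0// inner_indic_oo//; last by case/andP : s01.
transitivity (\int[leb]_(u in `]0, s[) per x (u + h)).
  rewrite /Rintegral; congr fine; apply: ae_eq_integral => //.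
  - by apply: measurable_funTS; apply/measurable_EFinP; exact: measurable_per.
  - apply: measurable_funTS; apply/measurable_EFinP.
    by apply: measurableT_comp; [exact: measurable_per|exact: measurable_funD].
  - apply: (@filterS _ _ (ae_filter_ringOfSetsType leb) _ _ _ (ae_mu01_leb (ae_shift h x))).
    move=> u H us; move: (us); rewrite /= in_itv/= => us'.
    by rewrite per_id ?H//= ?in_itv/=; lra.
rewrite primB; [|lra..].
rewrite -Rintegral_itv_bndo_bndc; last by apply: integrable_perS; lra.
rewrite -(@Rintegral_translation R h); last 2 first.
- exact: measurable_per.
- by apply: integrable_perS; lra.
congr (\int[leb]_(u in _) _).
by apply/seteqP; split => u /=; rewrite !in_itv/=; lra.
Qed.

(** Differentiating a mean over a moving window gives the difference quotient of the integrand,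
    whose total integral is 0 by rotation invariance. Averages thus regularize every [x] into the
    domain. *)
Lemma avg_ac h (h01 : 0 < h <= 1) x : ac (avg h01 x) (h^-1 *: (shift_op h x - x)).
Proof.
have h0 : 0 < h by case/andP : h01.
have primE (s : R) : 0 <= s <= 1 -> prim (h^-1 *: (shift_op h x - x)) s =
    h^-1 * (prim x (s + h) - prim x h - prim x s).
  move=> s01; rewrite prim_inner0// innerZr innerBr -!prim_inner0// prim_shift//; lra.
split.
  rewrite primE; last by lra.
  by rewrite (addrC 1 h) primD1; [ring|lra].
(* The constant is the mean of [x] over [[0, h]], that is, the value of the average at 0. *)
exists (h^-1 * prim x h); apply: (ae_imp2 (ae_avg h01 x) (@ae_mu01_itv R)) => s -> s01.
rewrite primE; last by lra.
ring.
Qed.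

(** An argument with three errors [e / 3]: an average [w] close to [x] moves at most [h * |g|] under
    rotation, where [g] is its derivative, and rotations preserve the distance from [x] to [w]. The
    [+ 1] guards against [g = 0]; negative [h] reduces to positive [h] by isometry. *)
Lemma shift_op_cvg0 x e : 0 < e ->
  exists2 d, 0 < d & forall h, `|h| < d -> `|shift_op h x - x| < e.
Proof.
move=> e0; have e3 : 0 < e / 3 by lra.
have [d d0 dP] := avg_cvg x e3.
pose r := Num.min (d / 2) 1.
have r01 : 0 < r <= 1 by rewrite /r lt_min ge_min lexx orbT andbT ltr01 andbT; lra.
have rd : r < d by rewrite /r gt_min; apply/orP; left; lra.
have xw := dP _ r01 rd; have wg := avg_ac r01 x.
set w := avg _ _ in xw wg; set g := _ *: _ in wg.
exists (Num.min 1 (e / 3 / (`|g| + 1))).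
  by rewrite lt_min ltr01 divr_gt0// ltr_wpDl.
have pos h : 0 < h -> h < Num.min 1 (e / 3 / (`|g| + 1)) -> `|shift_op h x - x| < e.
  move=> h0; rewrite lt_min => /andP[h1 hg].
  have h01 : 0 < h <= 1 by rewrite h0 ltW.
  have H1 := ac_norm_shift h01 wg.
  have H2 : h * `|g| < e / 3.
    rewrite (le_lt_trans (_ : _ <= h * (`|g| + 1)))//.
      by rewrite ler_pM2l// lerDl.
    by rewrite -ltr_pdivlMr// ltr_wpDl.
  have -> : shift_op h x - x = (shift_op h x - shift_op h w) + (shift_op h w - w) + (w - x).
    by rewrite !subrKA.
  have H3 : `|shift_op h x - shift_op h w| = `|w - x|.
    by rewrite -shift_opB norm_shift distrC.
  apply: (le_lt_trans (ler_normD _ _)).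
  have := ler_normD (shift_op h x - shift_op h w) (shift_op h w - w).
  lra.
move=> h; have [h0|h0|->] := ltgtP h 0; last first.
- by rewrite normr0 => _; rewrite shift_op0 subrr normr0.
- by rewrite gtr0_norm//; exact: pos.
rewrite ltr0_norm// => hd; have := pos (- h); rewrite oppr_gt0 => /(_ h0 hd).
by rewrite -(norm_shift h) shift_opB -shift_opD subrr shift_op0 distrC.
Qed.

Lemma dist_shift s t x : `|shift_op s x - shift_op t x| = `|shift_op (s - t) x - x|.
Proof.
by rewrite -(norm_shift t (_ - x)) shift_opB -shift_opD (addrC t) subrK.
Qed.

End generator.

Section weak_derivatives.
Context {R : realType}.
Local Notation leb := (@lebesgue_measure R).
Local Notation mu := (mu01 R).
Local Notation X := (L2 R).
Implicit Types (g x y : X) (h : R).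

Lemma inner_cvg {T : Type} {F : set_system T} {FF : Filter F} (f k : T -> X) (a b : X) :
  f t @[t --> F] --> a -> k t @[t --> F] --> b ->
  inner (f t) (k t) @[t --> F] --> inner a b.
Proof.
move=> fa kb.
have fa0 : `|f t - a| @[t --> F] --> 0 by apply/norm_cvg0P/subr_cvg0.
have kb0 : `|k t - b| @[t --> F] --> 0 by apply/norm_cvg0P/subr_cvg0.
apply/subr_cvg0/norm_cvg0P.
apply: (@squeeze_cvgr _ _ _ _ (cst 0) (fun t => `|f t - a| * `|k t| + `|a| * `|k t - b|)).
- near=> t; rewrite normr_ge0/=.
  have -> : inner (f t) (k t) - inner a b = inner (f t - a) (k t) + inner a (k t - b).
    rewrite innerBl innerBr; ring.
  by apply: le_trans (ler_normD _ _) _; rewrite lerD ?inner_le_norm.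
- exact: cvg_cst.
- rewrite -[X in _ --> X]addr0; apply: cvgD.
    rewrite -[X in _ --> X](mul0r `|b|); apply: cvgM => //; exact: cvg_norm.
  rewrite -[X in _ --> X](mulr0 `|a|); apply: cvgM => //; exact: cvg_cst.
Unshelve. all: by end_near. Qed.

Lemma FTC2 (f F : R -> R) (a b : R) : a <= b -> continuous f ->
  (forall s : R, is_derive s 1 F (f s)) ->
  \int[leb]_(s in `[a, b]) f s = F b - F a.
Proof.
rewrite le_eqVlt => /predU1P[->|ab] cf dF; first by rewrite set_itv1 Rintegral_set1 subrr.
have cF s : {for s, continuous F}.
  apply: differentiable_continuous; apply/derivable1_diffP; exact: ex_derive.
rewrite /Rintegral (continuous_FTC2 ab (continuous_subspaceT cf) (F := F))//.
- split.
  + by move=> s _; exact: ex_derive.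
  + by apply: cvg_at_right_filter; exact: cF.
  + by apply: cvg_at_left_filter; exact: cF.
- by move=> s _; rewrite derive1E derive_val.
Qed.

Lemma continuous_Lfun (f : R -> R) : continuous f -> f \_ `[0, 1] \in Lfun mu (2%:R)%:E.
Proof.
move=> cf.
have cn : {within `[0, 1], continuous (fun s => `|f s|)}.
  by apply: continuous_subspaceT => s; apply: cvg_norm; exact: cf.
have [c _ cM] := EVT_max ler01 cn.
apply: (@bounded_Lfun _ _ `|f c|).
  apply/(measurable_restrictT _ _).1; first exact: measurable_itv.
  by apply: measurable_funTS; exact: continuous_measurable_fun.
move=> s; rewrite patchE; case: ifPn; last by rewrite normr0.
by rewrite inE => s01; apply: cM; rewrite inE in s01 *.
Qed.

Definition L2cont (f : R -> R) (cf : continuous f) : X := Lclass (lee1n 2) (continuous_Lfun cf).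

Lemma ae_L2cont (f : R -> R) (cf : continuous f) :
  {ae mu, forall s, Lrepr (L2cont cf) s = f s}.
Proof.
apply: (ae_imp2 (ae_Lclass (continuous_Lfun cf)) (@ae_mu01_itv R)) => s -> s01.
by rewrite patchE mem_set//= in_itv/=; lra.
Qed.

Lemma prim_ae (f : R -> R) g (s : R) : measurable_fun setT f ->
  {ae mu, forall s, Lrepr g s = f s} -> 0 <= s <= 1 ->
  prim g s = \int[leb]_(u in `[0, s]) f u.
Proof.
move=> mf gf s01; rewrite /prim /Rintegral; congr fine.
rewrite integral_itv_bndoo; last first.
  by apply: measurable_funTS; apply/measurable_EFinP; exact: measurable_per.
rewrite [RHS]integral_itv_bndoo; last first.
  by apply: measurable_funTS; apply/measurable_EFinP.
apply: ae_eq_integral => //.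
- by apply: measurable_funTS; apply/measurable_EFinP; exact: measurable_per.
- by apply: measurable_funTS; apply/measurable_EFinP.
- apply: (@filterS _ _ (ae_filter_ringOfSetsType leb) _ _ _ (ae_mu01_leb gf)).
  move=> u H us; move: (us); rewrite /= in_itv/= => us'.
  by rewrite per_id ?H//= ?in_itv/=; lra.
Qed.

Lemma inner_L2cont (f : R -> R) (cf : continuous f) y :
  inner y (L2cont cf) = \int[mu]_s (Lrepr y s * f s).
Proof.
apply: Rintegral_ae.
- by apply: measurable_funM; exact: Lrepr_m.
- by apply: measurable_funM; [exact: Lrepr_m|exact: continuous_measurable_fun].
- by apply: (ae_imp (ae_L2cont cf)) => s ->.
Qed.

Lemma test_function0 (p : R -> R) : test_function p -> p 0 = 0 /\ p 1 = 0.
Proof.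
move=> [_ _ H]; split; apply/eqP; apply: contraT => p0.
  have : closure [set t | p t != 0] 0 by apply: subset_closure.
  by move/H; rewrite /= in_itv/= ltxx.
have : closure [set t | p t != 0] 1 by apply: subset_closure.
by move/H; rewrite /= in_itv/= ltxx andbF.
Qed.

Lemma test_function_continuous (p : R -> R) : test_function p -> continuous p.
Proof.
move=> [dp _ _] s; apply: differentiable_continuous; apply/derivable1_diffP; exact: dp.
Qed.

(** A test function vanishes at 0 and at 1, so it is periodic and is the primitive of its derivative
    with constant 0. *)
Lemma test_function_ac (p : R -> R) (cp : continuous p) (cp' : continuous (derive1 p)) :
  test_function p -> ac (L2cont cp) (L2cont cp').
Proof.
move=> tp; have [p0 p1] := test_function0 tp; have [dp _ _] := tp.
have E (s : R) : 0 <= s <= 1 -> prim (L2cont cp') s = p s.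
  move=> s01; rewrite (prim_ae (continuous_measurable_fun cp') (ae_L2cont cp'))//.
  have D (u : R) : is_derive u 1 p (derive1 p u).
    by rewrite derive1E; apply/derivableP; exact: dp.
  by rewrite (FTC2 _ cp' D) ?p0 ?subr0//; case/andP : s01.
split; first by rewrite E// ler01 lexx.
exists 0; apply: (ae_imp2 (ae_L2cont cp) (@ae_mu01_itv R)) => s -> s01.
by rewrite add0r E//; lra.
Qed.

Lemma shift_cvg0 y : shift_op h y @[h --> 0^'+] --> y.
Proof.
apply/cvg_at_right0P => e e0; have [d d0 dP] := shift_op_cvg0 y e0.
by exists d => // h /andP[h0 hd]; apply: dP; rewrite gtr0_norm.
Qed.

(** Discrete integration by parts: as rotations preserve [inner], the difference quotient moves from
    [y] to the test function with a change of sign, where its limit is known by [ac_cvg]. *)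
Lemma cvg_weak_derivative y g :
  h^-1 *: (shift_op h y - y) @[h --> 0^'+] --> g -> weak_derivative y g.
Proof.
move=> yg p tp; have cp := test_function_continuous tp; have [_ cp' _] := tp.
rewrite -(inner_L2cont cp) -(inner_L2cont cp').
have pp' := test_function_ac cp cp' tp.
have H1 : inner (h^-1 *: (shift_op h y - y)) (L2cont cp) @[h --> 0^'+] -->
    inner g (L2cont cp).
  by apply: inner_cvg => //; exact: cvg_cst.
have H2 : - inner (shift_op h y) (h^-1 *: (shift_op h (L2cont cp) - L2cont cp))
     @[h --> 0^'+] --> - inner y (L2cont cp').
  by apply: cvgN; apply: inner_cvg; [exact: shift_cvg0|exact: ac_cvg].
have E : (fun h => inner (h^-1 *: (shift_op h y - y)) (L2cont cp)) =
    (fun h => - inner (shift_op h y) (h^-1 *: (shift_op h (L2cont cp) - L2cont cp))).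
  apply/funext => h; rewrite innerZl innerZr innerBl innerBr inner_shift; ring.
rewrite E in H1; have := cvg_unique _ H1 H2.
by move=> /(_ (@Rhausdorff R)) ->; rewrite opprK.
Qed.

End weak_derivatives.

(** * Weak derivatives *)

Section ramp.
Context {R : realType}.
Implicit Types s k h : R.

Definition ppart s : R := Num.max s 0.
Definition ppart2 s : R := ppart s ^+ 2 / 2.

Lemma ppart_ge0 s : 0 <= s -> ppart s = s. Proof. by move=> s0; rewrite /ppart max_l. Qed.
Lemma ppart_le0 s : s <= 0 -> ppart s = 0. Proof. by move=> s0; rewrite /ppart max_r. Qed.

Lemma ppart2_quad s k : `|ppart2 (s + k) - ppart2 s - k * ppart s| <= k ^+ 2 / 2.
Proof.
rewrite /ppart2 ler_norml.
have [s0|/ltW s0] := leP 0 s; have [sk|/ltW sk] := leP 0 (s + k).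
- by rewrite !ppart_ge0//; nra.
- by rewrite (ppart_ge0 s0) (ppart_le0 sk); nra.
- by rewrite (ppart_le0 s0) (ppart_ge0 sk); nra.
- by rewrite !ppart_le0//; nra.
Qed.

(* The second difference quotients of max s 0 and of its primitive: a tent of mass
   one on [-h, h], and a C^1 step from 0 to 1. *)
Definition tent h s : R := (ppart (s + h) - 2 * ppart s + ppart (s - h)) / h ^+ 2.
Definition ramp h s : R := (ppart2 (s + h) - 2 * ppart2 s + ppart2 (s - h)) / h ^+ 2.

Lemma is_derive_ramp h s : 0 < h -> is_derive s 1 (ramp h) (tent h s).
Proof.
move=> h0; apply: (@is_derive_quad _ _ _ _ (2 / h ^+ 2) 1) => // k _.
rewrite /ramp /tent (addrAC s k h) (addrAC s k (- h)).
rewrite (_ : _ - _ - _ = ((ppart2 (s + h + k) - ppart2 (s + h) - k * ppart (s + h))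
  - 2 * (ppart2 (s + k) - ppart2 s - k * ppart s)
  + (ppart2 (s - h + k) - ppart2 (s - h) - k * ppart (s - h))) / h ^+ 2); last first.
  by ring.
have := ppart2_quad (s + h) k; have := ppart2_quad s k; have := ppart2_quad (s - h) k.
rewrite normrM (@gtr0_norm _ (h ^- 2)) ?invr_gt0 ?exprn_gt0//.
rewrite [2 / _ * _]mulrAC ler_pM2r ?invr_gt0 ?exprn_gt0//.
rewrite !ler_norml; lra.
Qed.

Lemma continuous_tent h : continuous (tent h).
Proof.
have cp : continuous ppart.
  have -> : ppart = fun s => (s + `|s|) / 2.
    apply/funext => s; rewrite /ppart; case: (leP s 0) => s0.
      by rewrite ler0_norm// subrr mul0r.
    by rewrite gtr0_norm//; field.
  move=> s; apply: cvgM; last exact: cvg_cst.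
  by apply: cvgD; [exact: cvg_id|apply: cvg_norm; exact: cvg_id].
move=> s; apply: cvgM; last exact: cvg_cst.
apply: cvgD; last first.
  by apply: (@continuous_comp _ _ _ (fun s => s - h)); [apply: cvgB; [exact: cvg_id|exact: cvg_cst]|exact: cp].
apply: cvgB; last by apply: cvgM; [exact: cvg_cst|exact: cp].
by apply: (@continuous_comp _ _ _ (fun s => s + h)); [apply: cvgD; [exact: cvg_id|exact: cvg_cst]|exact: cp].
Qed.

Lemma tent_out h s : 0 < h -> h <= `|s| -> tent h s = 0.
Proof.
move=> h0; rewrite ler_normr => /orP[hs|hs]; rewrite /tent.
  by rewrite !ppart_ge0; [rewrite (_ : _ + _ = 0) ?mul0r//; ring|lra..].
by rewrite !ppart_le0; [rewrite mulr0 subr0 addr0 mul0r|lra..].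
Qed.

Lemma tent_ge0 h s : 0 < h -> 0 <= tent h s.
Proof.
move=> h0; rewrite /tent divr_ge0 ?exprn_ge0 ?(ltW h0)// /ppart.
by case: (leP (s + h) 0) => ?; case: (leP s 0) => ?; case: (leP (s - h) 0) => ?; lra.
Qed.

Lemma tent_le h s : 0 < h -> tent h s <= h^-1.
Proof.
move=> h0; rewrite /tent ler_pdivrMr ?exprn_gt0// expr2 mulKf ?gt_eqF// /ppart.
by case: (leP (s + h) 0) => ?; case: (leP s 0) => ?; case: (leP (s - h) 0) => ?; lra.
Qed.

Lemma ramp_left h s : 0 < h -> s <= - h -> ramp h s = 0.
Proof.
move=> h0 hs; rewrite /ramp /ppart2 !ppart_le0; [|lra..].
by rewrite expr0n mul0r mulr0 subr0 addr0 mul0r.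
Qed.

Lemma ramp_right h s : 0 < h -> h <= s -> ramp h s = 1.
Proof.
move=> h0 hs; rewrite /ramp /ppart2 !ppart_ge0; [|lra..].
rewrite (_ : _ + _ = h ^+ 2); first by rewrite divff// expf_neq0// gt_eqF.
by field.
Qed.

Lemma ramp_itv h s : 0 < h -> 0 <= ramp h s <= 1.
Proof.
move=> h0; rewrite /ramp ler_pdivlMr ?ler_pdivrMr ?exprn_gt0// mul0r mul1r /ppart2.
have [s1|/ltW s1] := leP s (- h).
  by rewrite !ppart_le0; nra.
have [s2|/ltW s2] := leP h s.
  by rewrite !ppart_ge0; nra.
rewrite (@ppart_ge0 (s + h)) ?(@ppart_le0 (s - h)); [|lra..].
have [s0|/ltW s0] := leP 0 s; first by rewrite ppart_ge0//; nra.
by rewrite ppart_le0//; nra.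
Qed.

(** A continuously differentiable version of the indicator of []a, b[], with transition zones of
    half-width [h]. Its derivative is a difference of two tents of mass one, so testing with it
    compares local means of a function near [a] and near [b]. *)
Definition plateau h a b s : R := ramp h (s - a) - ramp h (s - b).

Lemma is_derive_plateau h a b s : 0 < h ->
  is_derive s 1 (plateau h a b) (tent h (s - a) - tent h (s - b)).
Proof.
move=> h0.
have K c : is_derive s 1 (fun s => ramp h (s - c)) (tent h (s - c)).
  have := @is_derive1_comp _ (ramp h) (fun s => s - c) s _ _ (is_derive_ramp (s - c) h0).
  by move=> /(_ _ (is_derive_shift _ _ _)); rewrite mulr1.
exact: is_deriveB.
Qed.

Lemma test_function_plateau h a b : 0 < h -> h < a -> a <= b -> b + h < 1 ->
  test_function (plateau h a b).
Proof.
move=> h0 ha ab b1; split.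
- by move=> s; have H := is_derive_plateau a b s h0; exact: ex_derive.
- rewrite (_ : derive1 _ = (fun s => tent h (s - a) - tent h (s - b))); last first.
    apply/funext => s; rewrite derive1E; have H := is_derive_plateau a b s h0.
    exact: derive_val.
  move=> s; apply: cvgB;
    (apply: (@continuous_comp _ _ _ (fun s => s - _) (tent h)); last exact: continuous_tent);
    by apply: cvgB; [exact: cvg_id|exact: cvg_cst].
- apply: (@subset_trans _ `[a - h, b + h]%classic); last first.
    by move=> s /=; rewrite !in_itv/=; lra.
  have -> : `[a - h, b + h]%classic = closure `[a - h, b + h]%classic.
    by apply/closure_id; exact: interval_closed.
  apply: closureS => s /=; apply: contraR; rewrite in_itv/= negb_and -!ltNge /plateau.
  move=> /orP[sa|sb].
    by rewrite !ramp_left ?subr0//; lra.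
  by rewrite !ramp_right ?subrr//; lra.
Qed.

End ramp.

(** * A function with a weak derivative is a primitive of it *)

Section weak_ac.
Context {R : realType}.
Local Notation leb := (@lebesgue_measure R).
Local Notation mu := (mu01 R).
Local Notation X := (L2 R).
Implicit Types (g x y : X) (h a b : R).

Lemma norm_indic_oo_sqr a b : 0 <= a -> a <= b -> b <= 1 -> `|indic_oo a b| ^+ 2 = b - a.
Proof.
move=> a0 ab b1; rewrite normL2_sqrE.
rewrite (@Rintegral_ae _ _ (\1_(`]a, b[))); last 3 first.
- by apply: measurable_funX; exact: Lrepr_m.
- by apply: measurable_indic; exact: measurable_itv.
- apply: (ae_imp (ae_Lclass (indic_oo_Lfun a b))) => s ->.
  by rewrite indicE; case: (_ \in _); rewrite ?expr1n ?expr0n.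
rewrite /Rintegral integral_indic//.
rewrite setIT /= /mrestr setIidl; last by move=> s /=; rewrite !in_itv/=; lra.
rewrite lebesgue_measure_itv/= lte_fin; case: ifPn => [_|]; first by rewrite -EFinD.
by rewrite -leNgt => ba; rewrite (_ : b = a) ?subrr//; apply/le_anti; rewrite ba.
Qed.

Lemma plateau_indic h a b (s : R) : 0 < h -> a + h < b - h ->
  `|plateau h a b s - (a < s < b)%R%:R| <=
  `|(a - h < s < a + h)%R%:R + (b - h < s < b + h)%R%:R|.
Proof.
move=> h0 ab.
rewrite /plateau.
have /andP[ra0 ra1] := @ramp_itv _ h (s - a) h0.
have /andP[rb0 rb1] := @ramp_itv _ h (s - b) h0.
have [sa1|sa1] := leP s (a - h).
  rewrite !ramp_left; [|lra..].
  have -> : a < s < b = false by apply/negbTE; lra.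
  by rewrite !subr0 normr0.
have [sa2|sa2] := ltP s (a + h).
  rewrite (@ramp_left _ h (s - b)); [|lra..].
  have -> : b - h < s < b + h = false by apply/negbTE; lra.
  rewrite subr0 addr0 normr1 ler_norml.
  by case: (a < s < b) => /=; lra.
rewrite (@ramp_right _ h (s - a)); [|lra..].
have [sb1|sb1] := leP s (b - h).
  rewrite (@ramp_left _ h (s - b)); [|lra..].
  have -> : a < s < b = true by lra.
  by rewrite subr0 subrr normr0.
have [sb2|sb2] := ltP s (b + h).
  rewrite add0r normr1 ler_norml.
  by case: (a < s < b) => /=; lra.
rewrite (@ramp_right _ h (s - b)); [|lra..].
have -> : a < s < b = false by apply/negbTE; lra.
by rewrite subrr subr0 normr0.
Qed.

(** The values of [Lrepr y] outside []0, 1[] are arbitrary and need not be locally integrable; the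
    cut-off makes Lebesgue points available. *)
Definition restr01 y : R -> R := (Lrepr y) \_ `]0, 1[.

Lemma restr01_id y (s : R) : 0 < s < 1 -> restr01 y s = Lrepr y s.
Proof. by move=> s01; rewrite /restr01 patchE mem_set//= in_itv. Qed.

Lemma ae_lebesgue_pt y : {ae mu, forall s, lebesgue_pt (restr01 y) s}.
Proof.
apply: ae_leb_mu01; apply: lebesgue_differentiation; apply: integrable_locally.
  exact: measurable_itv.
by apply/integrable_mu01; [exact: Lrepr_m|exact: integrable_Lrepr].
Qed.

Lemma Rintegral_tent h a : 0 < h -> h < a -> a + h < 1 ->
  \int[mu]_s tent h (s - a) = 1.
Proof.
move=> h0 ha a1.
have ct : continuous (fun s => tent h (s - a)).
  move=> s; apply: (@continuous_comp _ _ _ (fun s => s - a) (tent h)).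
    by apply: cvgB; [exact: cvg_id|exact: cvg_cst].
  exact: continuous_tent.
have D (s : R) : is_derive s 1 (fun s => ramp h (s - a)) (tent h (s - a)).
  have := @is_derive1_comp _ (ramp h) (fun s => s - a) s _ _ (is_derive_ramp (s - a) h0).
  by move=> /(_ _ (is_derive_shift _ _ _)); rewrite mulr1.
rewrite (@Rintegral_ae _ _ (Lrepr (L2cont ct))); last 3 first.
- exact: continuous_measurable_fun.
- exact: Lrepr_m.
- by apply: (ae_imp (ae_L2cont ct)) => s ->.
rewrite -prim1E (prim_ae (continuous_measurable_fun ct) (ae_L2cont ct)) ?ler01 ?lexx//.
by rewrite (FTC2 ler01 ct D) ramp_right ?ramp_left ?subr0//; lra.
Qed.

(** The tent has mass one, height at most [h^-1], and vanishes off a ball of length [2 * h];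
    comparing [h^-1] with the normalization of [davg] gives the factor 2. *)
Lemma tent_mean_le y h a : 0 < h -> h < a -> a + h < 1 ->
  (`|\int[mu]_s (Lrepr y s * tent h (s - a)) - Lrepr y a|%:E <=
   2%:E * davg (restr01 y) a h)%E.
Proof.
move=> h0 ha a1.
have mt : measurable_fun setT (fun s : R => tent h (s - a)).
  apply: continuous_measurable_fun => s.
  apply: (@continuous_comp _ _ _ (fun s => s - a) (tent h)); last exact: continuous_tent.
  by apply: cvgB; [exact: cvg_id|exact: cvg_cst].
have tb (s : R) : `|tent h (s - a)| <= h^-1 by rewrite ger0_norm ?tent_ge0// tent_le.
have tL := bounded_Lfun mt tb.
have i1 : mu.-integrable setT (EFin \o (fun s => Lrepr y s * tent h (s - a))).
  by apply/Lfun1_integrable; apply: Lfun2_mul_Lfun1 => //; exact: Lrepr_Lfun.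
have i2 : mu.-integrable setT (EFin \o (fun s => tent h (s - a))).
  by apply/Lfun1_integrable; apply: Lfun_subset12 => //; rewrite mu01_setT.
have i3 : mu.-integrable setT (EFin \o (fun s => Lrepr y a * tent h (s - a))).
  exact: integrable_EFinZ.
have i4 := integrable_EFinB measurableT i1 i3.
have -> : \int[mu]_s (Lrepr y s * tent h (s - a)) - Lrepr y a =
    \int[mu]_s (Lrepr y s * tent h (s - a) - Lrepr y a * tent h (s - a)).
  by rewrite RintegralB// RintegralZl// Rintegral_tent// mulr1.
apply: (@le_trans _ _ (\int[mu]_s `|(Lrepr y s * tent h (s - a) - Lrepr y a * tent h (s - a))|%:E)%E).
  rewrite EFin_normr_Rintegral//; apply: le_trans (le_abse_integral _ _ _) _ => //.
  by case/integrableP : i4.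
have mr : measurable_fun setT (fun s => `|restr01 y s - restr01 y a|).
  apply: measurableT_comp => //; apply: measurable_funB => //.
  apply/(measurable_restrictT _ _).1; first exact: measurable_itv.
  by apply: measurable_funTS; exact: Lrepr_m.
apply: (@le_trans _ _ (h^-1%:E * \int[leb]_(s in ball a h) `|restr01 y s - restr01 y a|%:E)%E); last first.
  rewrite /davg /iavg lebesgue_measure_ball ?(ltW h0)// inver ifF; last first.
    by apply/negbTE; rewrite mulrn_eq0/= gt_eqF.
  rewrite muleA -EFinM lee_wpmul2r//.
    by apply: integral_ge0 => s _; rewrite lee_fin.
  by rewrite lee_fin (_ : 2 / (h *+ 2) = h^-1)//; field; rewrite gt_eqF.
rewrite -ge0_integralZl//; last 3 first.
- exact: measurable_ball.
- by apply: measurable_funTS; apply/measurable_EFinP.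
- by rewrite lee_fin invr_ge0 ltW.
have mi : measurable_fun setT (fun s => `|Lrepr y s * tent h (s - a) - Lrepr y a * tent h (s - a)|%:E).
  by apply/measurable_EFinP; apply: measurableT_comp => //; case/integrableP : i4 => /measurable_EFinP.
rewrite ge0_integral_mu01//.
rewrite [leLHS]integral_mkcond [leRHS]integral_mkcond.
apply: ge0_le_integral => //.
- by move=> s _; rewrite patchE; case: ifPn => // _; rewrite lee_fin.
- apply/(measurable_restrictT _ _).1; first exact: measurable_itv.
  exact: measurable_funTS.
- apply/(measurable_restrictT _ _).1; first exact: measurable_ball.
  apply: measurable_funTS; apply: measurable_funeM; exact/measurable_EFinP.
move=> s _; rewrite !patchE; case: ifPn => [s01|_]; last first.
  by case: ifPn => // _; rewrite -EFinM lee_fin mulr_ge0// invr_ge0 ltW.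
rewrite -mulrBl normrM; case: ifPn => [sb|sb].
  rewrite inE/= in_itv/= in s01; rewrite !restr01_id//; last by lra.
  by rewrite -EFinM lee_fin mulrC ler_wpM2r.
rewrite tent_out ?normr0 ?mulr0//.
by move: sb; rewrite notin_setE /ball/= => /negP; rewrite -leNgt distrC.
Qed.

(** Error budget: each of the two tent means is within [2 * (e / 8)] of the value of [y] at its
    centre, and replacing the plateau by the indicator in the inner product with [g] costs at most
    [e / 2]. The last hypothesis ensures the latter, as [(|g| + 1) ^ 2 * (8 * h)] is then below
    [(e / 2) ^ 2]. *)
Lemma plateau_increment y g a b h (e : R) : weak_derivative y g ->
  0 < e -> a < b -> 0 < h -> h < a -> b + h < 1 -> h < (b - a) / 2 ->
  (davg (restr01 y) a h < (e / 8)%:E)%E -> (davg (restr01 y) b h < (e / 8)%:E)%E ->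
  h * (`|g| + 1) ^+ 2 * 32 < e ^+ 2 ->
  `|Lrepr y b - Lrepr y a - (prim g b - prim g a)| <= e.
Proof.
move=> yg e0 ab h0 ha bh hab da db he.
have tp := test_function_plateau h0 ha (ltW ab) bh.
have cp := test_function_continuous tp.
have small c : h < c -> c + h < 1 -> (davg (restr01 y) c h < (e / 8)%:E)%E ->
   `|\int[mu]_s (Lrepr y s * tent h (s - c)) - Lrepr y c| < e / 4.
  move=> hc c1 dc; rewrite -lte_fin; apply: le_lt_trans (tent_mean_le y h0 hc c1) _.
  rewrite (_ : (e / 4)%:E = 2%:E * (e / 8)%:E)%E; last by rewrite -EFinM; congr (_%:E); field.
  by rewrite lte_pmul2l.
have [ah1 hb] : a + h < 1 /\ h < b by clear -h0 ha bh ab; split; lra.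
have sa := small a ha ah1 da; have sb := small b hb bh db.
have itent c : mu.-integrable setT (EFin \o (fun s => Lrepr y s * tent h (s - c))).
  apply/Lfun1_integrable; apply: Lfun2_mul_Lfun1; first exact: Lrepr_Lfun.
  apply: (@bounded_Lfun _ _ h^-1).
    apply: continuous_measurable_fun => s.
    apply: (@continuous_comp _ _ _ (fun s => s - c) (tent h)); last exact: continuous_tent.
    by apply: cvgB; [exact: cvg_id|exact: cvg_cst].
  by move=> s; rewrite ger0_norm ?tent_ge0// tent_le.
have W := yg _ tp.
have W1 : \int[mu]_s (Lrepr y s * (derive1 (plateau h a b)) s) =
    \int[mu]_s (Lrepr y s * tent h (s - a)) - \int[mu]_s (Lrepr y s * tent h (s - b)).
  rewrite -RintegralB//; apply: eq_Rintegral => s _.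
  have H := is_derive_plateau a b s h0.
  by rewrite derive1E derive_val mulrBr.
rewrite W1 in W.
have G : `|inner g (L2cont cp) - (prim g b - prim g a)| <= e / 2.
  have [a0 b1 ahbh] : [/\ 0 <= a, b <= 1 & a + h < b - h].
    by clear -h0 ha bh hab; split; lra.
  rewrite (prim_inner _ a0 (ltW ab) b1).
  rewrite (innerC (indic_oo _ _)) -innerBr; apply: le_trans (inner_le_norm _ _) _.
  (* The plateau and the indicator differ only in the transition zones, and by at most 1. The
     parallelogram law bounds the squared norm of [z] by twice the sum of the lengths [2 * h]. *)
  pose z := indic_oo (a - h) (a + h) + indic_oo (b - h) (b + h).
  have zle : `|L2cont cp - indic_oo a b| <= 1 * `|z|.
    apply: norm_le_ae => //.
    have A := ae_imp3 (aeB (L2cont cp) (indic_oo a b)) (ae_L2cont cp) (ae_Lclass (indic_oo_Lfun a b))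
      (fun _ P Q S => conj P (conj Q S)).
    have B := ae_imp3 (aeD (indic_oo (a - h) (a + h)) (indic_oo (b - h) (b + h)))
       (ae_Lclass (indic_oo_Lfun (a - h) (a + h))) (ae_Lclass (indic_oo_Lfun (b - h) (b + h)))
       (fun _ P Q S => conj P (conj Q S)).
    apply: (ae_imp2 A B) => s [-> [-> ->]] [-> [-> ->]]; rewrite mul1r !indicE.
    by rewrite !mem_setE !in_itv/=; apply: plateau_indic.
  have z2 : `|z| ^+ 2 <= 8 * h.
    have n1 : `|indic_oo (a - h) (a + h)| ^+ 2 = a + h - (a - h).
      by clear -h0 ha bh hab; apply: norm_indic_oo_sqr; lra.
    have n2 : `|indic_oo (b - h) (b + h)| ^+ 2 = b + h - (b - h).
      by clear -h0 ha bh hab; apply: norm_indic_oo_sqr; lra.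
    have := normL2D (indic_oo (a - h) (a + h)) (indic_oo (b - h) (b + h)).
    have := normL2B (indic_oo (a - h) (a + h)) (indic_oo (b - h) (b + h)).
    have := sqr_ge0 `|indic_oo (a - h) (a + h) - indic_oo (b - h) (b + h)|.
    by rewrite -/z n1 n2; clear; lra.
  rewrite mul1r in zle; apply: (@le_trans _ _ (`|g| * `|z|)); first by rewrite ler_wpM2l.
  rewrite -(@ler_pXn2r _ 2)// ?nnegrE ?mulr_ge0//; last by lra.
  have gg : `|g| ^+ 2 <= (`|g| + 1) ^+ 2 by rewrite ler_pXn2r ?nnegrE// lerDl.
  rewrite exprMn; have : `|g| ^+ 2 * `|z| ^+ 2 <= (`|g| + 1) ^+ 2 * (8 * h).
    by rewrite ler_pM// sqr_ge0.
  by move: he; clear; lra.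
move: sa sb G; rewrite (_ : inner g (L2cont cp) = \int[mu]_t (Lrepr g t * plateau h a b t)).
  move: W; move: (\int[mu]_s (Lrepr y s * tent h (s - a))) (\int[mu]_s (Lrepr y s * tent h (s - b))).
  move: (\int[mu]_s (Lrepr g s * plateau h a b s)) => I1 I2 I3.
  by rewrite !ltr_norml !ler_norml; clear; lra.
exact: inner_L2cont.
Qed.

Lemma lebesgue_pt_increment y g a b : weak_derivative y g ->
  0 < a -> a < b -> b < 1 ->
  lebesgue_pt (restr01 y) a -> lebesgue_pt (restr01 y) b ->
  Lrepr y b - Lrepr y a = prim g b - prim g a.
Proof.
move=> yg a0 ab b1 La Lb; apply/eqP; rewrite -subr_eq0 -normr_eq0.
rewrite eq_le normr_ge0 andbT; apply/ler_addgt0Pl => e e0; rewrite addr0.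
have davg_small c : lebesgue_pt (restr01 y) c ->
    \forall h \near 0^'+, (davg (restr01 y) c h < (e / 8)%:E)%E.
  move=> Lc; have e8 : ((0:R)%:E < (e / 8)%:E)%E by rewrite lte_fin; lra.
  apply: (Lc [set z | (z < (e / 8)%:E)%E]); apply: open_nbhs_nbhs; split => //.
  exact: open_ereal_lt_ereal.
have b10 : 0 < 1 - b by lra.
have ba0 : 0 < (b - a) / 2 by lra.
have d0 : 0 < e ^+ 2 / 32 / (`|g| + 1) ^+ 2.
  apply: divr_gt0; first by apply: divr_gt0 => //; exact: exprn_gt0.
  by apply: exprn_gt0; rewrite ltr_wpDl.
near ((0:R)^'+) => h; apply: (@plateau_increment y g a b h) => //.
- by rewrite -ltrBrDl; near: h; exact: nbhs_right_lt.
- by near: h; exact: davg_small.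
- by near: h; exact: davg_small.
- have g0 : 0 < (`|g| + 1) ^+ 2 by apply: exprn_gt0; rewrite ltr_wpDl.
  rewrite -ltr_pdivlMr// -(ltr_pdivlMr _ _ g0).
  by near: h; exact: nbhs_right_lt.
Unshelve. all: by end_near. Qed.

End weak_ac.

(** * The generator of the rotation group *)

Section shift_generator.
Context {R : realType}.
Local Notation leb := (@lebesgue_measure R).
Local Notation mu := (mu01 R).
Local Notation X := (L2 R).
Implicit Types (g x y : X) (h : R).

Lemma ae_ex_itv (P : R -> Prop) (a b : R) : {ae mu, forall s, P s} ->
  0 <= a -> a < b -> b <= 1 -> exists2 s, a < s < b & P s.
Proof.
move=> [N [mN N0 PN]] a0 ab b1; apply: contrapT => H.
have sub : `]a, b[%classic `<=` N.
  by move=> s /=; rewrite in_itv/= => sab; apply: PN => /= Ps; apply: H; exists s.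
have : (leb `]a, b[%classic <= mu N)%E.
  rewrite -[`]a, b[%classic](@setIidl _ _ `]0, 1[); last first.
    by move=> s /=; rewrite !in_itv/=; lra.
  by apply: le_measure; rewrite ?inE//; [exact: measurableI|exact: measurableI|exact: setSI].
rewrite [mu N]N0 lebesgue_measure_itv/= lte_fin ab -EFinD lee_fin; lra.
Qed.

(** A nonzero value at an endpoint would persist on a subinterval of positive measure. *)
Lemma continuous_ae0_endpoints (f : R -> R) : {within `[0, 1], continuous f} ->
  {ae mu, forall s, f s = 0} -> f 0 = 0 /\ f 1 = 0.
Proof.
move=> /(continuous_within_itvP _ ltr01)[_ f0 f1] ae0; split; apply/eqP; apply: contraT => fn0.
- have n0 : 0 < `|f 0| by rewrite normr_gt0.
  have /cvgrPdist_lt /(_ _ n0) := f0.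
  rewrite /prop_near1 /nbhs /= /at_right /within /= => /nbhs_ballP[d d0 dP].
  have m0 : 0 < Num.min d 1 by rewrite lt_min d0 ltr01.
  have m1 : Num.min d 1 <= 1 by rewrite ge_min lexx orbT.
  have [s /andP[s0]] := ae_ex_itv ae0 (lexx 0) m0 m1.
  rewrite lt_min => /andP[sd _] fs.
  have := dP s; rewrite /ball/= sub0r normrN gtr0_norm// fs subr0 ltxx.
  by move=> /(_ sd s0).
- have n0 : 0 < `|f 1| by rewrite normr_gt0.
  have /cvgrPdist_lt /(_ _ n0) := f1.
  rewrite /prop_near1 /nbhs /= /at_left /within /= => /nbhs_ballP[d d0 dP].
  have m0 : 0 <= Num.max (1 - d) 0 by rewrite le_max lexx orbT.
  have m1 : Num.max (1 - d) 0 < 1 by rewrite gt_max ltr01 andbT; move: d0 => /=; lra.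
  have [s /andP[]] := ae_ex_itv ae0 m0 m1 (lexx 1).
  rewrite gt_max => /andP[sd s0] s1 fs.
  have := dP s; rewrite /ball/= gtr0_norm ?subr_gt0// fs subr0 ltxx.
  by rewrite ltrBlDr addrC -ltrBlDr => /(_ sd s1).
Qed.

Lemma continuous_prim01 g : {within `[0, 1], continuous (prim g)}.
Proof.
apply: continuous_subspaceW; last exact: (@continuous_prim _ g).
by move=> u /=; rewrite !in_itv/=; lra.
Qed.


(** The difference of [y] and [prim g] takes the same value at all Lebesgue points, which are almost
    all points; [k] is this value at one of them. *)
Lemma weak_prim y g : weak_derivative y g ->
  exists k, {ae mu, forall s, Lrepr y s = k + prim g s}.
Proof.
move=> yg; have [a /andP[a0 a1] La] := ae_ex_itv (ae_lebesgue_pt y) (lexx 0) ltr01 (lexx 1).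
pose k := Lrepr y a - prim g a; exists k.
apply: (ae_imp2 (ae_lebesgue_pt y) (@ae_mu01_itv R)) => s Ls /andP[s0 s1].
have [sa|sa|->] := ltgtP s a.
- have := lebesgue_pt_increment yg s0 sa a1 Ls La; rewrite /k; lra.
- have := lebesgue_pt_increment yg a0 sa s1 La Ls; rewrite /k; lra.
- by rewrite /k subrK.
Qed.

(** The continuous representatives [c] and [k + prim g] agree almost everywhere, hence also at 0 and
    1, so that [c 0 = c 1] becomes [prim g 1 = 0]. *)
Lemma weak_ac y g : weak_derivative y g ->
  (exists c : R -> R, [/\ {within `[0, 1], continuous c}, Lrepr y = c %[ae mu] & c 0 = c 1]) ->
  ac y g.
Proof.
move=> yg [c [cc yc c01]]; have [k yk] := weak_prim yg.
split; last by exists k.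
have cf : {within `[0, 1], continuous (fun s => c s - (k + prim g s))}.
  move=> s; apply: cvgB; first exact: cc.
  apply: cvgD; first exact: cvg_cst.
  exact: continuous_prim01.
have [] := @continuous_ae0_endpoints _ cf.
  apply: (ae_imp2 yk yc) => s -> H; rewrite -H//; exact: subrr.
rewrite prim0; lra.
Qed.

Lemma ac_periodic y g : ac y g ->
  (exists c : R -> R, [/\ {within `[0, 1], continuous c}, Lrepr y = c %[ae mu] & c 0 = c 1]).
Proof.
move=> [g1 [k yk]]; exists (fun s => k + prim g s); split.
- move=> s; apply: cvgD; first exact: cvg_cst.
  exact: continuous_prim01.
- by apply: (ae_imp yk) => s ->.
- by rewrite g1 prim0.
Qed.

Lemma ac_weak_derivative y g : ac y g -> weak_derivative y g.
Proof. by move=> yg; apply: cvg_weak_derivative; exact: ac_cvg. Qed.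

Lemma ac_unique y g g' : ac y g -> ac y g' -> g = g'.
Proof.
move=> /ac_cvg H /ac_cvg H'; exact: (cvg_unique _ H H').
Qed.

(** The choice made by [ddxi] is harmless: whichever weak derivative [xget] picks, the boundary
    condition makes it a derivative in the sense of [ac], and that one is unique. *)
Lemma ac_H1_periodic y g : ac y g -> H1_periodic y /\ ddxi y = g.
Proof.
move=> yg; have wg := ac_weak_derivative yg; have per := ac_periodic yg.
split; first by split => //; exists g.
apply: (@ac_unique y) => //; apply: weak_ac => //.
by rewrite /ddxi; case: xgetP => [g' _ //|H]; case: (H g).
Qed.

Lemma H1_periodic_ac y : H1_periodic y -> ac y (ddxi y).
Proof.
move=> [[g yg] per]; apply: weak_ac => //.
by rewrite /ddxi; case: xgetP => [g' _ //|H]; case: (H g).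
Qed.

(** Periodicity comes for free: rotations fix constants, so every difference quotient has mean zero,
    and so has its limit [g]. *)
Lemma cvg_ac y g : h^-1 *: (shift_op h y - y) @[h --> 0^'+] --> g -> ac y g.
Proof.
move=> H; have wg := cvg_weak_derivative H.
have [k yk] := weak_prim wg; split; last by exists k.
have cE : prim g 1 = inner g (L2cst 1).
  rewrite prim1E; apply: Rintegral_ae.
  - exact: Lrepr_m.
  - by apply: measurable_funM; exact: Lrepr_m.
  - by apply: (ae_imp (ae_Lclass (cst_Lfun 1))) => s ->; rewrite mulr1.
have cS h : shift_op h (L2cst 1) = L2cst 1 :> X.
  apply/L2_eqP; have A := ae_frac h (ae_Lclass (cst_Lfun (1 : R))).
  by apply: (ae_imp3 (ae_shift h (L2cst 1)) A (ae_Lclass (cst_Lfun (1 : R)))) => s -> -> ->.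
have : inner (h^-1 *: (shift_op h y - y)) (L2cst 1) @[h --> 0^'+] --> inner g (L2cst 1).
  by apply: inner_cvg => //; exact: cvg_cst.
rewrite (_ : (fun h => _) = cst 0); last first.
  by apply/funext => h; rewrite innerZl innerBl -{1}(cS h) inner_shift subrr mulr0.
by move=> K; rewrite cE -(cvg_lim (@Rhausdorff R) K) lim_cst//; exact: Rhausdorff.
Qed.


Definition shiftL (t : R) : {linear X -> X} := shift_op t.

Lemma shiftL_contraction_semigroup : contraction_semigroup shiftL.
Proof.
split.
- exact: shift_op0.
- by move=> s t _ _ x; exact: shift_opD.
- exact: shift_cvg0.
- by move=> t _ x; rewrite norm_shift.
Qed.

Lemma shiftL_generates : generates_contraction_semigroup (@H1_periodic R) (@ddxi R) shiftL.
Proof.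
split; first exact: shiftL_contraction_semigroup.
move=> x y; split=> [[/H1_periodic_ac + xy]|/cvg_ac/ac_H1_periodic//].
by rewrite xy => /ac_cvg.
Qed.

End shift_generator.

(** * Uniqueness of the contraction semigroup with a given generator *)

Lemma subACA (V : zmodType) (a b c d : V) : (a - b) - (c - d) = (a - c) - (b - d).
Proof. by rewrite !opprB addrACA [RHS]addrACA (addrC (- b)). Qed.

Lemma telescope_sub (V : zmodType) (a b c a' b' c' : V) :
  a - a' = (b - b') + (c - c') + ((a - b - c) - (a' - b' - c')).
Proof.
have E (p q r : V) : p - q - r = p - (q + r) by rewrite opprD addrA.
by rewrite (E a) (E a') subACA (addrACA b) -opprD [RHS]addrC subrK.
Qed.

Section semigroup_uniqueness.
Context {R : realType}.
Local Notation X := (L2 R).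
Implicit Types (x y : X) (D : set X) (A : X -> X) (T S : R -> {linear X -> X}).

(** A contraction satisfies [inner (T h x) x <= |x| ^ 2], so all difference quotients have a
    nonpositive inner product with [x]. *)
Lemma generator_dissipative D A T x : generates_contraction_semigroup D A T ->
  D x -> inner (A x) x <= 0.
Proof.
move=> [[T0 TD Tc Tn] gen] Dx.
have H : h^-1 *: (T h x - x) @[h --> 0^'+] --> A x by apply/gen.
have H' : inner (h^-1 *: (T h x - x)) x @[h --> 0^'+] --> inner (A x) x.
  by apply: inner_cvg => //; exact: cvg_cst.
rewrite -(cvg_lim (@Rhausdorff R) H'); apply: limr_le; first by apply/cvg_ex; exists (inner (A x) x).
near=> h; have h0 : 0 < h by near: h; exact: nbhs_right_gt.
rewrite innerZl pmulr_rle0 ?invr_gt0// innerBl subr_le0 -normL2_sqr.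
apply: le_trans (ler_norm _) _; apply: le_trans (inner_le_norm _ _) _.
by rewrite expr2 ler_wpM2r// Tn// ltW.
Unshelve. all: by end_near. Qed.

Lemma semigroup_domain D A T x (s : R) : generates_contraction_semigroup D A T ->
  0 <= s -> D x -> D (T s x) /\ A (T s x) = T s (A x).
Proof.
move=> [[T0 TD Tc Tn] gen] s0 Dx; apply/gen.
have /cvg_at_right0P H : h^-1 *: (T h x - x) @[h --> 0^'+] --> A x by apply/gen.
apply/cvg_at_right0P => e e0; have [d d0 dP] := H e e0; exists d => // h hd.
have h0 : 0 <= h by case/andP : hd => /ltW.
rewrite -TD// (addrC h) TD// -linearB -linearZ_LR -linearB.
by apply: le_lt_trans (dP h hd); exact: Tn.
Qed.

Lemma generatorB D A T x y : generates_contraction_semigroup D A T ->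
  D x -> D y -> D (x - y) /\ A (x - y) = A x - A y.
Proof.
move=> [_ gen] Dx Dy; apply/gen.
have Hx : h^-1 *: (T h x - x) @[h --> 0^'+] --> A x by apply/gen.
have Hy : h^-1 *: (T h y - y) @[h --> 0^'+] --> A y by apply/gen.
rewrite (_ : (fun h => _) = (fun h => h^-1 *: (T h x - x) - h^-1 *: (T h y - y))).
  exact: cvgB.
by apply/funext => h; rewrite -scalerBr (linearB (T h)) subACA.
Qed.

(** The remainder at time [s] is [T s] applied to the remainder at time 0, whence the uniformity in
    [s]. *)
Lemma generator_small D A T x (e : R) : generates_contraction_semigroup D A T ->
  D x -> 0 < e -> exists2 d, 0 < d & forall s h, 0 <= s -> 0 < h < d ->
    `|T (s + h) x - T s x - h *: T s (A x)| <= e * h.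
Proof.
move=> [[T0 TD Tc Tn] gen] Dx e0.
have /cvg_at_right0P H : h^-1 *: (T h x - x) @[h --> 0^'+] --> A x by apply/gen.
have [d d0 dP] := H e e0; exists d => // s h s0 hd.
have h0 : 0 < h by case/andP : hd.
rewrite TD ?(ltW h0)// -linearB -linearZ_LR -linearB; apply: le_trans (Tn _ s0 _) _.
have -> : T h x - x - h *: A x = h *: (h^-1 *: (T h x - x) - A x).
  by rewrite scalerBr scalerA mulfV ?scale1r// gt_eqF.
rewrite normrZ gtr0_norm// mulrC ler_pM2r// ltW//; exact: dP.
Qed.

(** One Euler step for the squared norm: the first-order term [2 * h * inner u v] is nonpositive. In
    [(C + 2) ^ 2], the part [C ^ 2] comes from the square of [h *: v], [4 * C] from the product with
    [r], and 4 from the square of [r]. *)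
Lemma semigroup_step (u v r : X) (C e h : R) : 0 <= C -> 0 < h -> h <= e -> e <= 1 ->
  inner v u <= 0 -> `|u| + `|v| <= C -> `|r| <= 2 * e * h ->
  `|u + h *: v + r| ^+ 2 <= `|u| ^+ 2 + h * (e * (C + 2) ^+ 2).
Proof.
move=> C0 h0 he e1 vu uvC rh.
have h1 : h <= 1 by exact: le_trans e1.
have e0 : 0 <= e by lra.
have u0 := normr_ge0 u; have v0 := normr_ge0 v; have r0 := normr_ge0 r.
have vC : `|v| <= C by lra.
have W : `|u + h *: v| ^+ 2 <= `|u| ^+ 2 + h ^+ 2 * C ^+ 2.
  rewrite normL2D innerZr normrZ gtr0_norm// exprMn.
  have : h * inner u v <= 0 by rewrite pmulr_rle0// innerC.
  have : h ^+ 2 * `|v| ^+ 2 <= h ^+ 2 * C ^+ 2.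
    by rewrite ler_wpM2l ?sqr_ge0// ler_pXn2r ?nnegrE.
  lra.
have WC : `|u + h *: v| <= C.
  apply: le_trans (ler_normD _ _) _; rewrite normrZ gtr0_norm//.
  have : h * `|v| <= 1 * `|v| by rewrite ler_wpM2r.
  lra.
have I : inner (u + h *: v) r <= C * (2 * e * h).
  apply: le_trans (ler_norm _) _; apply: le_trans (inner_le_norm _ _) _.
  by rewrite ler_pM.
have r2 : `|r| ^+ 2 <= (2 * e * h) ^+ 2.
  by rewrite ler_pXn2r ?nnegrE// !mulr_ge0// ltW.
rewrite normL2D.
have : h ^+ 2 * C ^+ 2 <= h * e * C ^+ 2.
  by rewrite expr2 ler_wpM2r ?sqr_ge0// ler_pM2l.
have : (2 * e * h) ^+ 2 <= h * e * 4.
  rewrite (_ : (2 * e * h) ^+ 2 = h * e * (4 * (e * h))); last by ring.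
  rewrite ler_wpM2l ?mulr_ge0 ?(ltW h0)//.
  have : e * h <= 1 * 1 by rewrite ler_pM// ltW.
  lra.
rewrite (_ : h * (e * (C + 2) ^+ 2) = h * e * C ^+ 2 + 2 * (C * (2 * e * h)) + h * e * 4).
  by move: W I r2; clear; lra.
ring.
Qed.

(** The difference [u] of the two orbits satisfies the equation of the dissipative generator up to
    errors of size [e * h] for each orbit. Over the steps from 0 to [t] the squared norm grows by at
    most [t * (e * (C + 2) ^ 2)], and [e] is arbitrary. *)
Lemma semigroup_unique_dom D A T S x (t : R) :
  generates_contraction_semigroup D A T -> generates_contraction_semigroup D A S ->
  D x -> 0 <= t -> T t x = S t x.
Proof.
move=> gT gS Dx t0; have [[T0 TD Tc Tn] _] := gT; have [[S0 SD Sc Sn] _] := gS.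
have [->|tn0] := eqVneq t 0; first by rewrite T0 S0.
have {tn0}t0 : 0 < t by rewrite lt_neqAle eq_sym tn0.
(* Bounds the sum of the norms of [u s] and [v s] for all [s >= 0], both semigroups being
   contractive. *)
pose C := 2 * `|x| + 2 * `|A x|.
have C0 : 0 <= C by rewrite addr_ge0 ?mulr_ge0.
pose u s := T s x - S s x; pose v s := T s (A x) - S s (A x).
have key e : 0 < e -> e <= 1 -> `|u t| ^+ 2 <= t * (e * (C + 2) ^+ 2).
  move=> e0 e1.
  have [d1 d10 d1P] := generator_small gT Dx e0.
  have [d2 d20 d2P] := generator_small gS Dx e0.
  pose m := Num.min e (Num.min d1 d2).
  have m0 : 0 < m by rewrite !lt_min e0 d10 d20.
  pose n := (Num.trunc (t / m)).+1.
  pose h := t / n%:R.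
  have n0 : 0 < n%:R :> R by rewrite ltr0n.
  have h0 : 0 < h by rewrite divr_gt0.
  have hm : h < m.
    rewrite /h ltr_pdivrMr// mulrC -ltr_pdivrMr//.
    exact: truncnS_gt.
  have [he hd1 hd2] : [/\ h <= e, h < d1 & h < d2].
    by move: hm; rewrite !lt_min => /and3P[/ltW].
  have step s : 0 <= s -> `|u (s + h)| ^+ 2 <= `|u s| ^+ 2 + h * (e * (C + 2) ^+ 2).
    move=> s0.
    have -> : u (s + h) = u s + h *: v s +
       ((T (s + h) x - T s x - h *: T s (A x)) - (S (s + h) x - S s x - h *: S s (A x))).
      by rewrite /u /v scalerBr; exact: telescope_sub.
    have [DT AT] := semigroup_domain gT s0 Dx.
    have [DS AS] := semigroup_domain gS s0 Dx.
    have [Du Au] := generatorB gT DT DS.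
    apply: semigroup_step => //.
    - by rewrite /v /u -AT -AS -Au; exact: generator_dissipative gT Du.
    - have := ler_normB (T s x) (S s x); have := ler_normB (T s (A x)) (S s (A x)).
      have := Tn s s0 x; have := Sn s s0 x; have := Tn s s0 (A x); have := Sn s s0 (A x).
      by rewrite /u /v /C; lra.
    - apply: le_trans (ler_normB _ _) _.
      have := d1P s h s0; rewrite h0 hd1 => /(_ isT).
      have := d2P s h s0; rewrite h0 hd2 => /(_ isT).
      lra.
  have ind k : `|u (k%:R * h)| ^+ 2 <= k%:R * h * (e * (C + 2) ^+ 2).
    elim: k => [|k IH].
      by rewrite !mul0r /u T0 S0 subrr normr0 expr0n.
    rewrite -natr1 !mulrDl !mul1r; apply: le_trans (step _ _) _.
      by rewrite mulr_ge0// ltW.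
    by rewrite lerD2r.
  have -> : t = n%:R * h by rewrite /h mulrCA divff ?mulr1// gt_eqF.
  exact: ind.
have K0 : 0 < t * (C + 2) ^+ 2 by rewrite mulr_gt0// exprn_gt0// ltr_wpDl.
apply/eqP; rewrite -subr_eq0 -normr_eq0 -sqrf_eq0 eq_le sqr_ge0 andbT -/(u t).
apply/ler_addgt0Pl => e e0; rewrite addr0.
pose e' := Num.min 1 (e / (t * (C + 2) ^+ 2)).
have e'0 : 0 < e' by rewrite lt_min ltr01 divr_gt0.
apply: le_trans (key e' e'0 _) _; first by rewrite ge_min lexx.
by rewrite mulrCA -ler_pdivlMr// ge_min lexx orbT.
Qed.

(** Equality on the domain extends to every [x], since averages of [x] lie in the domain, come
    arbitrarily close to [x], and both operators are contractions. *)
Lemma generator_is_shift T x (t : R) :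
  generates_contraction_semigroup (@H1_periodic R) (@ddxi R) T ->
  0 <= t -> T t x = shift_op t x.
Proof.
move=> gT t0; have [[_ _ _ Tn] _] := gT.
apply/eqP; rewrite -subr_eq0 -normr_eq0 eq_le normr_ge0 andbT.
apply/ler_addgt0Pl => e e0; rewrite addr0.
have e2 : 0 < e / 2 by lra.
have [d d0 dP] := avg_cvg x e2.
pose h := Num.min (d / 2) 1.
have h01 : 0 < h <= 1 by rewrite /h lt_min ge_min lexx orbT andbT ltr01 andbT; lra.
have hd : h < d by rewrite /h gt_min; apply/orP; left; lra.
have xw := dP _ h01 hd; have [Dw _] := ac_H1_periodic (avg_ac h01 x).
set w := avg h01 x in xw Dw.
have E := semigroup_unique_dom gT shiftL_generates Dw t0.
rewrite (_ : T t x - shift_op t x = T t (x - w) - shift_op t (x - w)); last first.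
  rewrite linearB shift_opB E /= [shiftL t w]/(shift_op t w).
  by rewrite opprB addrA subrK.
apply: le_trans (ler_normB _ _) _; rewrite norm_shift.
have := Tn t t0 (x - w); rewrite (distrC x); lra.
Qed.

End semigroup_uniqueness.

(** * Bochner integrals *)

Lemma Rintegral_sum d (T : measurableType d) (R : realType)
    (m : {measure set T -> \bar R}) (D : set T) (I : Type) (r : seq I) (F : I -> T -> R) :
  measurable D -> (forall i, m.-integrable D (EFin \o F i)) ->
  m.-integrable D (EFin \o (fun x => \sum_(i <- r) F i x)) /\
  \int[m]_(x in D) (\sum_(i <- r) F i x) = \sum_(i <- r) \int[m]_(x in D) F i x.
Proof.
move=> mD Fi; elim: r => [|i r [IH1 IH2]].
  rewrite big_nil; split.
    apply: (@eq_integrable _ _ _ m D mD (cst 0%E)); last exact: integrable0.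
    by move=> x _; rewrite /= big_nil.
  rewrite (_ : (fun x => _) = (fun x => 0)); last by apply/funext => x; rewrite big_nil.
  by rewrite /Rintegral integral0.
rewrite (_ : (fun x => \sum_(j <- i :: r) F j x) = (fun x => F i x + \sum_(j <- r) F j x)).
  split; first exact: integrable_EFinD.
  by rewrite RintegralD// big_cons IH2.
by apply/funext => x; rewrite big_cons.
Qed.

Section Bochner_weak.
Context {R : realType}.
Local Notation leb := (@lebesgue_measure R).
Local Notation X := (L2 R).
Implicit Types (f s : R -> X) (v w : X) (t : R).

Lemma inner_suml (I : Type) (r : seq I) (F : I -> X) w :
  inner (\sum_(i <- r) F i) w = \sum_(i <- r) inner (F i) w.
Proof. by elim/big_rec2: _ => [|i y x _ <-]; rewrite ?inner0l ?innerDl. Qed.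

Lemma leb_itv0t t : 0 <= t -> leb `[0, t]%classic = t%:E.
Proof.
rewrite le_eqVlt => /predU1P[<-|t0]; first by rewrite set_itv1 lebesgue_measure_set1.
by rewrite lebesgue_measure_itv/= lte_fin t0 oppr0 adde0.
Qed.

(** [F] may also depend on time, so that one decomposition serves both inner products and distances
    to another function. *)
Lemma simple_function_sum s (F : X -> R -> R) : simple_function s ->
  forall u, F (s u) u = \sum_(v <- finmap.enum_fset (fset_set (range s))) \1_(s @^-1` [set v]) u * F v u.
Proof.
move=> [fs ms] u; rewrite (bigD1_seq (s u))/=.
- rewrite indicE mem_set//= mul1r big1 ?addr0// => v vsu.
  by rewrite indicE memNset ?mul0r// => /= /esym/eqP; rewrite (negbTE vsu).
- by rewrite in_fset_set// inE; exists u.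
- exact: finmap.fset_uniq.
Qed.

Lemma integrable_indic_finite (D A : set R) (c : R) : measurable D -> measurable A ->
  (leb D < +oo)%E -> leb.-integrable D (EFin \o (fun u => \1_A u * c)).
Proof.
move=> mD mA Dy; apply: measurable_bounded_integrable => //.
  by apply: measurable_funTS; apply: measurable_funM => //; exact: measurable_indic.
exists `|c|; split; first exact: num_real.
move=> M cM u Du /=; rewrite indicE; apply: ltW; apply: le_lt_trans cM.
by case: (_ \in _); rewrite ?mul1r// mul0r normr0.
Qed.

Lemma inner_simple_integral (D : set R) s w : measurable D -> (leb D < +oo)%E ->
  simple_function s ->
  leb.-integrable D (EFin \o (fun u => inner (s u) w)) /\
  inner (simple_integral D s) w = \int[leb]_(u in D) inner (s u) w.
Proof.
move=> mD Dy ss; have [fs ms] := ss.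
rewrite (_ : (fun u => inner (s u) w) = (fun u => \sum_(v <- finmap.enum_fset (fset_set (range s)))
   \1_(s @^-1` [set v]) u * inner v w)); last first.
  by apply/funext => u; rewrite (simple_function_sum (fun v _ => inner v w) ss).
have H v : leb.-integrable D (EFin \o (fun u => \1_(s @^-1` [set v]) u * inner v w)).
  exact: integrable_indic_finite.
have [H1 H2] := @Rintegral_sum _ (measurableTypeR R) R leb D _
  (finmap.enum_fset (fset_set (range s))) _ mD H.
split=> //; rewrite H2 /simple_integral fsbig_finite// inner_suml.
apply: eq_bigr => v _; rewrite innerZl RintegralZr//.
  congr (_ * _); rewrite /Rintegral integral_indic//; last exact: ms.
  by rewrite setIC.
apply: (@eq_integrable _ _ _ leb D mD (EFin \o (fun u => \1_(s @^-1` [set v]) u * 1))).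
  by move=> u _ /=; rewrite mulr1.
exact: integrable_indic_finite.
Qed.

Lemma within_measurable (D : set R) (f : R -> R) : measurable D ->
  {within D, continuous f} -> measurable_fun D f.
Proof. exact: subspace_continuous_measurable_fun. Qed.

Lemma measurable_dist_simple (D : set R) f s : measurable D ->
  {within D, continuous f} -> simple_function s ->
  measurable_fun D (fun u => `|f u - s u|).
Proof.
move=> mD cf ss; have [fs ms] := ss.
rewrite (_ : (fun u => `|f u - s u|) = (fun u => \sum_(v <- finmap.enum_fset (fset_set (range s)))
   \1_(s @^-1` [set v]) u * `|f u - v|)); last first.
  by apply/funext => u; rewrite (simple_function_sum (fun v u => `|f u - v|) ss).
apply: measurable_sum => v; apply: measurable_funM.
  by apply: measurable_funTS; exact: measurable_indic.
apply: within_measurable => // u; apply: cvg_norm; apply: cvgB; [exact: cf|exact: cvg_cst].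
Qed.

Lemma within_inner (D : set R) f w : {within D, continuous f} ->
  {within D, continuous (fun u => inner (f u) w)}.
Proof. by move=> cf u; apply: inner_cvg; [exact: cf|exact: cvg_cst]. Qed.

Lemma integrable_within (a b : R) (f : R -> R) : {within `[a, b], continuous f} ->
  leb.-integrable `[a, b] (EFin \o f).
Proof. by move=> cf; apply: continuous_compact_integrable => //; exact: segment_compact. Qed.

Lemma inner_simple_dist t f s w : 0 <= t -> {within `[0, t], continuous f} ->
  simple_function s ->
  (`|inner (simple_integral `[0, t] s) w - \int[leb]_(u in `[0, t]) inner (f u) w|%:E <=
   `|w|%:E * \int[leb]_(u in `[0%R, t]) `|f u - s u|%:E)%E.
Proof.
move=> t0 cf ss; have mD : measurable (`[0, t]%classic : set R) by exact: measurable_itv.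
have Dy : (leb `[0%R, t]%classic < +oo)%E by rewrite leb_itv0t// ltry.
have [i1 ->] := inner_simple_integral w mD Dy ss.
have i2 := integrable_within (within_inner (w := w) cf).
have i3 := @integrable_EFinB _ (measurableTypeR R) R leb _ _ _ mD i1 i2.
have md := measurable_dist_simple mD cf ss.
rewrite -RintegralB// EFin_normr_Rintegral//.
apply: le_trans (le_abse_integral _ _ _) _ => //; first by case/integrableP : i3.
rewrite -ge0_integralZl//; last exact/measurable_EFinP.
apply: ge0_le_integral => //.
- by apply: measurableT_comp => //; case/integrableP : i3.
- by apply: measurable_funeM; exact/measurable_EFinP.
move=> u _ /=; rewrite lee_fin -innerBl mulrC distrC.
exact: inner_le_norm.
Qed.

(** Approximation in the mean makes the inner products of the simple integrals converge to the
    scalar integral; so an integral is known through its inner products. *)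
Lemma Bochner_inner t f v w : 0 <= t -> {within `[0, t], continuous f} ->
  is_Bochner_integral `[0, t] f v ->
  inner v w = \int[leb]_(u in `[0, t]) inner (f u) w.
Proof.
move=> t0 cf [s_ [ss _ s0 sv]].
have H1 : inner (simple_integral `[0, t] (s_ n)) w @[n --> \oo] --> inner v w.
  by apply: inner_cvg => //; exact: cvg_cst.
suff H2 : inner (simple_integral `[0, t] (s_ n)) w @[n --> \oo] -->
    \int[leb]_(u in `[0, t]) inner (f u) w.
  by have := cvg_unique _ H1 H2; apply; exact: Rhausdorff.
apply/subr_cvg0/norm_cvg0P.
have K : (`|w|%:E * \int[leb]_(u in `[0%R, t]) `|f u - s_ n u|%:E)%E @[n --> \oo] --> 0%E.
  by rewrite -[X in _ --> X](mule0 `|w|%:E); apply: cvgeZl.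
apply: (@squeeze_cvgr _ _ _ _ (cst 0)
  (fun n => fine (`|w|%:E * \int[leb]_(u in `[0%R, t]) `|f u - s_ n u|%:E)%E)).
- have /fine_cvgP[Kf _] := K.
  near=> n; rewrite normr_ge0/= -lee_fin fineK; last by near: n.
  exact: inner_simple_dist.
- exact: cvg_cst.
- exact: fine_cvg.
Unshelve. all: by end_near. Qed.

End Bochner_weak.

(** * Bochner integrals of Lipschitz functions *)

Section Bochner_intro.
Context {R : realType}.
Local Notation leb := (@lebesgue_measure R).
Local Notation X := (L2 R).
Implicit Types (f : R -> X) (v w : X) (t : R).

Lemma Bochner_eq t f f' v : (forall s, 0 <= s <= t -> f s = f' s) ->
  is_Bochner_integral `[0, t] f v -> is_Bochner_integral `[0, t] f' v.
Proof.
move=> ff' [s_ [ss sf sf' sv]]; exists s_; split => //.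
- apply: (@filterS _ _ (ae_filter_ringOfSetsType leb) _ _ _ sf) => s H st.
  by rewrite -ff'; [exact: H|move: st; rewrite /= in_itv].
- move: sf'; apply: cvg_trans; apply: near_eq_cvg; near=> n.
  apply: eq_integral => s; rewrite inE/= in_itv/= => st.
  by rewrite ff'.
Unshelve. all: by end_near. Qed.

(** The index of the last point of mesh [1 / (n + 1)] before [s]; clamping [s] to [[0, t]] keeps the
    set of indices finite. *)
Definition grid t (n : nat) (s : R) : R :=
  (Num.floor (Num.max 0 (Num.min s t) * n.+1%:R))%:~R.

Lemma grid_nat t n s : 0 <= t -> exists2 k, (k <= Num.trunc (t * n.+1%:R))%N & grid t n s = k%:R.
Proof.
move=> t0; have c0 : 0 <= Num.max 0 (Num.min s t) * n.+1%:R.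
  by rewrite mulr_ge0// le_max lexx.
exists (Num.trunc (Num.max 0 (Num.min s t) * n.+1%:R)).
  apply: le_truncn; rewrite ler_wpM2r// ge_max t0/= ge_min lexx orbT //.
by rewrite /grid truncn_floor c0 natr_absz ger0_norm// floor_ge0.
Qed.

Lemma grid_simple t n f : 0 <= t ->
  simple_function (fun s => f (grid t n s / n.+1%:R)).
Proof.
move=> t0.
have fr : finite_set (range (grid t n)).
  apply: (@sub_finite_set _ _ ((fun k : nat => k%:R) @` `I_(Num.trunc (t * n.+1%:R)).+1)).
    move=> _ [s _ <-]; have [k kt ->] := grid_nat n s t0.
    by exists k => //=; rewrite ltnS.
  by apply: finite_image; exact: finite_II.
split.
  apply: (@sub_finite_set _ _ ((fun y => f (y / n.+1%:R)) @` (range (grid t n)))).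
    by move=> _ [s _ <-] /=; exists (grid t n s) => //; exists s.
  exact: finite_image.
move=> v; rewrite (_ : _ @^-1` _ = grid t n @^-1`
   (range (grid t n) `&` (fun y => f (y / n.+1%:R)) @^-1` [set v])); last first.
  by apply/seteqP; split => s //= => [|[]//]; split => //; exists s.
rewrite -[X in measurable X]setTI.
have mg : measurable_fun setT (grid t n).
  apply: (measurableT_comp measurable_floor); apply: measurable_funM => //.
  by apply: measurable_maxr => //; apply: measurable_minr.
apply: mg => //.
apply: countable_measurable => //; last exact: finite_set_countable (finite_setIl _ fr).
Qed.

Lemma grid_dist t n s : 0 <= s <= t -> `|grid t n s / n.+1%:R - s| <= n.+1%:R^-1.
Proof.
move=> /andP[s0 st]; rewrite /grid min_l// max_r//.
have n0 : 0 < n.+1%:R :> R by rewrite ltr0n.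
have /andP[h1 h2] := floor_itv (s * n.+1%:R).
rewrite intrD in h2; move: h1 h2; move: (_%:~R) => y h1 h2.
have -> : y / n.+1%:R - s = (y - s * n.+1%:R) / n.+1%:R.
  by rewrite mulrBl mulfK// gt_eqF.
rewrite normrM (@gtr0_norm _ n.+1%:R^-1) ?invr_gt0// ler_piMl ?invr_ge0 ?(ltW n0)//.
by rewrite ler_norml; lra.
Qed.

(** Sampling a Lipschitz function on a grid gives simple functions with a uniform error. Their
    integrals converge to the candidate [v] because it is already the integral in the weak sense. *)
Lemma is_Bochner_intro t f v (C : R) : 0 <= t ->
  (forall a b, `|f a - f b| <= C * `|a - b|) ->
  (forall w, \int[leb]_(s in `[0, t]) inner (f s) w = inner v w) ->
  is_Bochner_integral `[0, t] f v.
Proof.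
move=> t0 fC fv; pose s_ n s := f (grid t n s / n.+1%:R).
have C0 : 0 <= C.
  by have := fC 1 0; rewrite subr0 normr1 mulr1; apply: le_trans.
have cf : {within `[0, t], continuous f}.
  apply: continuous_subspaceT => s; apply/cvgrPdist_lt => e e0.
  have C1 : 0 < C + 1 by rewrite ltr_wpDl.
  near=> u; apply: le_lt_trans (fC _ _) _.
  apply: (@le_lt_trans _ _ ((C + 1) * `|s - u|)); first by rewrite ler_wpM2r// lerDl.
  rewrite mulrC -ltr_pdivlMr//; near: u; apply: cvgr_dist_lt; [exact: cvg_id|by rewrite divr_gt0].
have ss n : simple_function (s_ n) by exact: grid_simple.
have ds n s : 0 <= s <= t -> `|f s - s_ n s| <= C * n.+1%:R^-1.
  by move=> st; apply: le_trans (fC _ _) _; rewrite ler_wpM2l// distrC grid_dist.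
have mD : measurable (`[0, t]%classic : set R) by exact: measurable_itv.
have ib n : (\int[leb]_(s in `[0%R, t]) `|f s - s_ n s|%:E <= (C * n.+1%:R^-1 * t)%:E)%E.
  apply: (@le_trans _ _ (\int[leb]_(s in `[0%R, t]) (cst (C * n.+1%:R^-1)%:E s))%E).
    apply: ge0_le_integral => //.
    - by apply/measurable_EFinP; exact: measurable_dist_simple.
    - by move=> s /=; rewrite in_itv/= lee_fin => st; exact: ds.
  have E : (\int[leb]_(s in `[0%R, t]) cst (C * n.+1%:R^-1)%:E s =
    (C * n.+1%:R^-1)%:E * leb `[0%R, t]%classic)%E by exact: integral_cst.
  by rewrite E leb_itv0t// -EFinM.
have cb : C * n.+1%:R^-1 * t @[n --> \oo] --> 0.
  rewrite -[X in _ --> X](mul0r t); apply: cvgM; last exact: cvg_cst.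
  by rewrite -[X in _ --> X](mulr0 C); apply: cvgM; [exact: cvg_cst|exact: cvg_harmonic].
exists s_; split => //.
- apply: aeW => s; rewrite /= in_itv/= => st.
  apply/subr_cvg0/norm_cvg0P.
  apply: (@squeeze_cvgr _ _ _ _ (cst 0) (fun n => C * n.+1%:R^-1)).
  + by near=> n; rewrite normr_ge0/= distrC; exact: ds.
  + exact: cvg_cst.
  + by rewrite -[X in _ --> X](mulr0 C); apply: cvgM; [exact: cvg_cst|exact: cvg_harmonic].
- apply: (@squeeze_cvge _ _ _ _ (cst 0%E) _ (fun n => (C * n.+1%:R^-1 * t)%:E)).
  + by near=> n; rewrite ib andbT; apply: integral_ge0 => s _; rewrite lee_fin.
  + exact: cvg_cst.
  + by apply: cvg_EFin; [near=> n|exact: cb].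
- apply/subr_cvg0/norm_cvg0P.
  apply: (@squeeze_cvgr _ _ _ _ (cst 0) (fun n => C * n.+1%:R^-1 * t)).
  + near=> n; rewrite normr_ge0/=; set I := simple_integral _ _.
    have [->|Iv] := eqVneq (I - v) 0.
      by rewrite normr0 !mulr_ge0// invr_ge0.
    (* The error is tested against itself, which turns the weak identity for [v] into a norm
       estimate. *)
    rewrite -(@ler_pM2r _ `|I - v|) ?normr_gt0// -expr2 normL2_sqr innerBl -fv.
    apply: le_trans (ler_norm _) _; rewrite -lee_fin.
    apply: le_trans (inner_simple_dist _ t0 cf (ss n)) _.
    by rewrite mulrC EFinM lee_wpmul2l ?lee_fin.
  + exact: cvg_cst.
  + exact: cb.
Unshelve. all: by end_near. Qed.

Lemma FTC2_oo (f F : R -> R) (t : R) : 0 <= t -> continuous f -> continuous F ->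
  (forall s : R, 0 < s < t -> is_derive s 1 F (f s)) ->
  \int[leb]_(s in `[0, t]) f s = F t - F 0.
Proof.
rewrite le_eqVlt => /predU1P[<-|t0] cf cF dF; first by rewrite set_itv1 Rintegral_set1 subrr.
rewrite /Rintegral (continuous_FTC2 t0 (continuous_subspaceT cf) (F := F))//.
- split.
  + move=> s; rewrite in_itv/= => st; have H := dF s st; exact: ex_derive.
  + by apply: cvg_at_right_filter; exact: cF.
  + by apply: cvg_at_left_filter; exact: cF.
- move=> s; rewrite in_itv/= => st; have H := dF s st.
  by rewrite derive1E derive_val.
Qed.

Lemma Lipschitz_continuous_inner f w (C : R) : (forall a b, `|f a - f b| <= C * `|a - b|) ->
  continuous (fun s => inner (f s) w).
Proof.
move=> fC s; apply: inner_cvg; last exact: cvg_cst.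
have C0 : 0 <= C.
  by have := fC 1 0; rewrite subr0 normr1 mulr1; apply: le_trans.
apply/cvgrPdist_lt => e e0; have C1 : 0 < C + 1 by rewrite ltr_wpDl.
near=> u; apply: le_lt_trans (fC _ _) _.
apply: (@le_lt_trans _ _ ((C + 1) * `|s - u|)); first by rewrite ler_wpM2r// lerDl.
rewrite mulrC -ltr_pdivlMr//; near: u; apply: cvgr_dist_lt; [exact: cvg_id|by rewrite divr_gt0].
Unshelve. all: by end_near. Qed.

(* A quadratic Taylor estimate replaces the differentiability of F. *)
Lemma Bochner_FTC t (f F : R -> X) (C : R) : 0 <= t ->
  (forall a b, `|f a - f b| <= C * `|a - b|) ->
  (forall a b, `|F a - F b| <= C * `|a - b|) ->
  (forall a b, 0 <= a -> 0 <= b -> `|F b - F a - (b - a) *: f a| <= C * (b - a) ^+ 2) ->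
  is_Bochner_integral `[0, t] f (F t - F 0).
Proof.
move=> t0 fC FC Ff; apply: (is_Bochner_intro t0 fC) => w.
have D s : 0 < s < t -> is_derive s 1 (fun s => inner (F s) w) (inner (f s) w).
  move=> /andP[s0 st]; apply: (@is_derive_quad _ _ _ _ (C * `|w|) s) => // h hs.
  have sh : 0 <= s + h by move: hs; rewrite ltr_norml; lra.
  have := Ff s (s + h) (ltW s0) sh; rewrite (addrC s h) addrK => H.
  rewrite -innerZl -!innerBl; apply: le_trans (ler_norm _) _; rewrite normr_id.
  apply: le_trans (inner_le_norm _ _) _.
  by rewrite mulrAC ler_wpM2r.
rewrite (FTC2_oo t0 (Lipschitz_continuous_inner fC) (Lipschitz_continuous_inner FC) D).
by rewrite innerBl.
Qed.

End Bochner_intro.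

(** * Mild solutions *)

Section mild_solutions.
Context {R : realType}.
Local Notation leb := (@lebesgue_measure R).
Local Notation X := (L2 R).
Implicit Types (x y : R -> X) (sigma : X -> X) (Phi : R -> X -> X).

Lemma adjoint_idfun (Bs : X -> X) : is_adjoint idfun Bs -> forall u, Bs u = u.
Proof.
move=> adj u; apply/eqP; rewrite -subr_eq0 -normr_eq0 -sqrf_eq0 normL2_sqr.
by rewrite innerBr -adj /= subrr.
Qed.

Lemma shift_op_cvg {I : Type} (F : set_system I) {FF : Filter F} (a : I -> R) (z : I -> X) a0 z0 :
  a i @[i --> F] --> a0 -> z i @[i --> F] --> z0 ->
  shift_op (a i) (z i) @[i --> F] --> shift_op a0 z0.
Proof.
move=> aa zz; apply/cvgrPdist_lt => e e0.
have [d d0 dP] := shift_op_cvg0 z0 (divr_gt0 e0 (ltr0n R 2)).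
near=> i.
have -> : shift_op a0 z0 - shift_op (a i) (z i) =
  (shift_op a0 z0 - shift_op (a i) z0) + (shift_op (a i) z0 - shift_op (a i) (z i)).
  by rewrite subrKA.
apply: le_lt_trans (ler_normD _ _) _.
rewrite [ltRHS]splitr ltrD//.
  rewrite distrC dist_shift; apply: dP; near: i.
  exact: cvgr_distC_lt.
rewrite -shift_opB norm_shift; near: i; apply: cvgr_dist_lt => //.
by rewrite divr_gt0.
Unshelve. all: by end_near. Qed.

Lemma lipschitz_cvg {I : Type} (F : set_system I) {FF : Filter F} sigma (z : I -> X) z0 :
  (forall u v, `|sigma u - sigma v| <= `|u - v|) ->
  z i @[i --> F] --> z0 -> sigma (z i) @[i --> F] --> sigma z0.
Proof.
move=> sL zz; apply/cvgrPdist_lt => e e0; near=> i.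
by apply: le_lt_trans (sL _ _) _; near: i; exact: cvgr_dist_lt.
Unshelve. all: by end_near. Qed.

Section uniqueness.
Variables (T : R -> {linear X -> X}) (Bs sigma : X -> X).
Hypothesis genT : generates_contraction_semigroup (@H1_periodic R) (@ddxi R) T.
Hypothesis adjB : is_adjoint idfun Bs.
Hypothesis sigma_lip : forall u v, `|sigma u - sigma v| <= `|u - v|.

Lemma mild_integrand (d x : R -> X) t s : (forall r, d r = 0) -> 0 <= s <= t ->
  T (t - s) (idfun (sigma (Bs (x s) + d s))) = shift_op (t - s) (sigma (x s)).
Proof.
by move=> d0 /andP[s0 st]; rewrite (generator_is_shift _ genT) ?subr_ge0//= d0 addr0 (adjoint_idfun adjB).
Qed.

(** The difference of the two integrals is tested against itself; rotations are isometric and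
    [sigma] is 1-Lipschitz, so [k] also bounds the distance of the integrands. *)
Lemma mild_solution_dist (d x y : R -> X) (x0 : X) t1 t (k : R -> R) : (forall r, d r = 0) ->
  mild_solution T idfun Bs sigma x0 d t1 x -> mild_solution T idfun Bs sigma x0 d t1 y ->
  0 <= t <= t1 -> {within `[0, t], continuous k} ->
  (forall s, 0 <= s <= t -> `|x s - y s| <= k s) ->
  `|x t - y t| <= \int[leb]_(s in `[0, t]) k s.
Proof.
move=> d0 [cx Hx] [cy Hy] tt1 ck kP; have /andP[t0 t1t] := tt1.
have [v v_int ->] := Hx t tt1; have [w w_int ->] := Hy t tt1.
have cf z : {within `[0, t1], continuous z} ->
    {within `[0, t], continuous (fun s => shift_op (t - s) (sigma (z s)))}.
  move=> cz; have cz' : {within `[0, t], continuous z}.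
    by apply: continuous_subspaceW cz; apply: subset_itvl; rewrite bnd_simp.
  move=> s; apply: shift_op_cvg; last by apply: lipschitz_cvg => //; exact: cz'.
  have ct : {within `[0, t], continuous (fun s : R => t - s)}.
    by apply: continuous_subspaceT => r; apply: cvgB; [exact: cvg_cst|exact: cvg_id].
  exact: ct.
have int z u (zint : is_Bochner_integral `[0, t]
     (fun s => T (t - s) (idfun (sigma (Bs (z s) + d s)))) u) :
   is_Bochner_integral `[0, t] (fun s => shift_op (t - s) (sigma (z s))) u.
  by apply: Bochner_eq zint => s st; exact: mild_integrand.
have -> : T t x0 - v - (T t x0 - w) = - (v - w) by rewrite subACA subrr sub0r.
rewrite normrN; have [->|vw] := eqVneq (v - w) 0.
  rewrite normr0; apply: Rintegral_ge0 => s; rewrite /= in_itv/= => st.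
  by apply: le_trans (kP s st).
rewrite -(@ler_pM2r _ `|v - w|) ?normr_gt0// -expr2 normL2_sqr {1}innerBl.
rewrite (Bochner_inner _ t0 (cf _ cx) (int _ _ v_int)).
rewrite (Bochner_inner _ t0 (cf _ cy) (int _ _ w_int)).
have ix (z : R -> X) (cz : {within `[0, t1], continuous z}) :=
  integrable_within (within_inner (w := v - w) (cf z cz)).
rewrite -RintegralB//; last 2 first.
- exact: ix.
- exact: ix.
rewrite -RintegralZr//; last exact: integrable_within.
apply: le_Rintegral => //.
- by apply: integrable_EFinB => //; exact: ix.
- by apply: integrable_within => s; apply: cvgM; [exact: ck|exact: cvg_cst].
move=> s; rewrite /= in_itv/= => st.
rewrite -innerBl; apply: le_trans (ler_norm _) _; apply: le_trans (inner_le_norm _ _) _.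
rewrite ler_wpM2r// -shift_opB norm_shift; apply: le_trans (sigma_lip _ _) _.
exact: kP.
Qed.

(* The weight [expR (- 2 * s)] makes the integral operator a contraction. *)
Lemma mild_solution_unique (d x y : R -> X) (x0 : X) t1 : (forall r, d r = 0) -> 0 <= t1 ->
  mild_solution T idfun Bs sigma x0 d t1 x -> mild_solution T idfun Bs sigma x0 d t1 y ->
  forall t, 0 <= t <= t1 -> x t = y t.
Proof.
move=> d0 t10 mx my; pose h s := expR (- 2 * s) * `|x s - y s|.
have ch : {within `[0, t1], continuous h}.
  move=> s; apply: cvgM.
    have ce : {within `[0, t1], continuous (fun s : R => expR (- 2 * s))}.
      apply: continuous_subspaceT => r; apply: continuous_comp; last exact: continuous_expR.
      by apply: cvgM; [exact: cvg_cst|exact: cvg_id].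
    exact: ce.
  by apply: cvg_norm; apply: cvgB; [exact: mx.1|exact: my.1].
have [c c01 cmax] := EVT_max t10 ch.
have c01' : 0 <= c <= t1 by move: c01; rewrite in_itv.
have /andP[c0 ct1] := c01'.
have xyh s : `|x s - y s| = expR (2 * s) * h s.
  by rewrite /h mulrA -expRD mulNr subrr expR0 mul1r.
pose k s := h c * expR (2 * s).
have dk s : is_derive s (1 : R) (fun r : R => h c / 2 * expR (2 * r)) (k s).
  have d2 : is_derive s (1 : R) (fun r : R => 2 * r) 2.
    by apply: (is_derive_eq (is_deriveZ 2 (is_derive_id s (1 : R)))); rewrite /GRing.scale/= mulr1.
  have de := is_derive1_comp (is_derive_expR (2 * s)) d2.
  apply: (is_derive_eq (is_deriveZ (h c / 2) de)).
  by rewrite /k /GRing.scale/=; field.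
have ck : continuous k.
  move=> r; apply: cvgM; first exact: cvg_cst.
  apply: continuous_comp; last exact: continuous_expR.
  by apply: cvgM; [exact: cvg_cst|exact: cvg_id].
have cK : continuous (fun r : R => h c / 2 * expR (2 * r)).
  move=> r; apply: cvgM; first exact: cvg_cst.
  apply: continuous_comp; last exact: continuous_expR.
  by apply: cvgM; [exact: cvg_cst|exact: cvg_id].
have := mild_solution_dist d0 mx my c01' (continuous_subspaceT ck).
rewrite (FTC2_oo c0 ck cK (fun s _ => dk s)) mulr0 expR0 mulr1 xyh => H.
(* At the maximum point [c] of the weighted distance, the integral inequality reads [expR (2 * c) *
   h c <= h c * (expR (2 * c) - 1) / 2], which no positive [h c] satisfies. *)
have hc : h c <= 0.
  have {H} : expR (2 * c) * h c <= h c / 2 * expR (2 * c) - h c / 2.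
    apply: H => s /andP[s0 sc]; rewrite xyh /k mulrC ler_wpM2r ?expR_ge0//.
    by apply: cmax; rewrite in_itv/= s0 (le_trans sc).
  have hc0 : 0 <= h c by rewrite mulr_ge0// expR_ge0.
  move=> H; have E0 := expR_gt0 (2 * c); rewrite leNgt; apply/negP => hc'.
  have := mulr_gt0 E0 hc'; move: H; clear -hc'; lra.
move=> t tt1; apply/eqP; rewrite -subr_eq0 -normr_eq0 xyh mulf_eq0 gt_eqF ?expR_gt0//=.
rewrite eq_le mulr_ge0 ?expR_ge0// andbT; apply: le_trans hc.
by apply: cmax; rewrite in_itv.
Qed.

Section flow.
Variables (Phi : R -> X -> X) (x0 : X) (C : R).
Hypothesis sigma_shift : forall t u, sigma (shift_op t u) = shift_op t (sigma u).
Hypothesis Phi0 : Phi 0 x0 = x0.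
Hypothesis Phi_lip : forall a b, `|Phi a x0 - Phi b x0| <= C * `|a - b|.
Hypothesis Phi_taylor : forall a b, 0 <= a -> 0 <= b ->
  `|Phi b x0 - Phi a x0 + (b - a) *: sigma (Phi a x0)| <= C * (b - a) ^+ 2.

Let C0 : 0 <= C.
Proof. by have := Phi_lip 1 0; rewrite subr0 normr1 mulr1; apply: le_trans. Qed.

Lemma flow_mild (d : R -> X) t1 : (forall r, d r = 0) ->
  mild_solution T idfun Bs sigma x0 d t1 (fun t => shift_op t (Phi t x0)).
Proof.
move=> d0; split.
  apply: continuous_subspaceT => s; apply: shift_op_cvg; first exact: cvg_id.
  apply/cvgrPdist_lt => e e0; have C1 : 0 < C + 1 by rewrite ltr_wpDl.
  near=> u; apply: le_lt_trans (Phi_lip _ _) _.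
  apply: (@le_lt_trans _ _ ((C + 1) * `|s - u|)); first by rewrite ler_wpM2r// lerDl.
  rewrite mulrC -ltr_pdivlMr//; near: u; apply: cvgr_dist_lt; [exact: cvg_id|by rewrite divr_gt0].
move=> t /andP[t0 tt1]; rewrite (generator_is_shift _ genT)//.
(* After commuting [sigma] with the rotation, the integrand at [s] is
   [shift_op t (sigma (Phi s x0))], and [s |-> shift_op t (- Phi s x0)] is its primitive. *)
exists (shift_op t (- Phi t x0) - shift_op t (- Phi 0 x0)); last first.
  have -> : shift_op t (- Phi t x0) - shift_op t (- Phi 0 x0) = shift_op t x0 - shift_op t (Phi t x0).
    by rewrite -!shift_opB opprK Phi0 addrC.
  by rewrite subKr.
pose f s := shift_op t (sigma (Phi s x0)).
apply: (@Bochner_eq _ _ f).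
  by move=> s st; rewrite (mild_integrand (fun s => shift_op s (Phi s x0)))// sigma_shift -shift_opD subrK.
apply: (@Bochner_FTC _ _ _ (fun s => shift_op t (- Phi s x0)) C) => //.
- by move=> a b; rewrite -shift_opB norm_shift; apply: le_trans (sigma_lip _ _) _.
- by move=> a b; rewrite -shift_opB norm_shift opprK addrC distrC.
- move=> a b a0 b0; rewrite -shift_opZ -!shift_opB norm_shift opprK -normrN.
  by rewrite opprB addrC opprD opprK Phi_taylor.
Unshelve. all: by end_near. Qed.

Lemma flow_mild_solutions (d : R -> X) : (forall r, d r = 0) ->
  mild_solutions_global T idfun Bs sigma x0 d /\
  forall x, global_mild_solution T idfun Bs sigma x0 d x ->
    forall t, 0 <= t -> `|x t| = `|Phi t x0|.
Proof.
move=> d0; split; first split.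
- by exists (fun t => shift_op t (Phi t x0)) => t1 _; exact: flow_mild.
- move=> t1 x t10 mx; exists (fun t => shift_op t (Phi t x0)).
    by move=> t2 _; exact: flow_mild.
  by move=> t; exact: (mild_solution_unique d0 (ltW t10) (flow_mild _ d0) mx).
- move=> x gx t t0; rewrite -[RHS](norm_shift t); congr (`| _ |).
  have t1 : 0 < t + 1 by rewrite ltr_wpDl.
  apply: (mild_solution_unique d0 (ltW t1) (gx _ t1) (flow_mild _ d0)).
  by rewrite t0 lerDl ler01.
Qed.

End flow.
End uniqueness.
End mild_solutions.

(** * The two flows *)

Section flows.
Context {R : realType}.
Local Notation mu := (mu01 R).
Local Notation X := (L2 R).
Implicit Types (x y : X) (t : R).

Lemma ae_sat x : {ae mu, forall s, Lrepr (sat x) s = sat_real (Lrepr x s)}.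
Proof. exact: ae_Lclass. Qed.

Lemma sat_shift t x : sat (shift_op t x) = shift_op t (sat x).
Proof.
apply/L2_eqP; have h := ae_frac t (ae_sat x).
have h' : {ae mu, forall s, Lrepr (shift_op t (sat x)) s = sat_real (Lrepr x (frpart (s + t)))}.
  by apply: (ae_imp2 (ae_shift t (sat x)) h) => s -> ->.
by apply: (ae_imp3 (ae_sat (shift_op t x)) (ae_shift t x) h') => s -> -> ->.
Qed.

Lemma sat_lip x y : `|sat x - sat y| <= `|x - y|.
Proof.
rewrite -[leRHS]mul1r; apply: norm_le_ae => //.
have h : {ae mu, forall s, Lrepr (sat x - sat y) s = sat_real (Lrepr x s) - sat_real (Lrepr y s)}.
  by apply: (ae_imp3 (aeB (sat x) (sat y)) (ae_sat x) (ae_sat y)) => s -> -> ->.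
by apply: (ae_imp2 h (aeB x y)) => s -> ->; rewrite mul1r sat_real_lip.
Qed.

Lemma phi_Lfun t x : phi t \o Lrepr x \in Lfun mu (2%:R)%:E.
Proof.
have mp : measurable_fun setT (phi t \o Lrepr x).
  by apply: measurableT_comp; [exact: measurable_phi|exact: Lrepr_m].
apply/(Lfun2P mp); have := (Lfun2P (Lrepr_m x)).1 (Lrepr_Lfun x); apply: le_lt_trans.
apply: ge0_le_integral => //.
- by move=> s _; rewrite lee_fin sqr_ge0.
- by apply/measurable_EFinP; exact: measurable_funX.
- by apply/measurable_EFinP; apply: measurable_funX; exact: Lrepr_m.
move=> s _ /=; rewrite lee_fin -[leLHS]real_normK ?num_real// -[leRHS]real_normK ?num_real//.
by rewrite ler_pXn2r ?nnegrE// phi_norm.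
Qed.

Definition sat_flow t x : X := Lclass (lee1n 2) (phi_Lfun t x).

Lemma ae_sat_flow t x : {ae mu, forall s, Lrepr (sat_flow t x) s = phi t (Lrepr x s)}.
Proof. exact: ae_Lclass. Qed.

Lemma sat_flow0 x : sat_flow 0 x = x.
Proof. by apply/L2_eqP; apply: (ae_imp (ae_sat_flow 0 x)) => s ->; rewrite phi0. Qed.

Lemma sat_flow_lip x (a b : R) : `|sat_flow a x - sat_flow b x| <= 1 * `|a - b|.
Proof.
rewrite mul1r -[leRHS]normr_id; apply: norm_le_cst.
apply: (ae_imp3 (aeB (sat_flow a x) (sat_flow b x)) (ae_sat_flow a x) (ae_sat_flow b x)) => s.
by move=> -> -> ->; exact: phi_lip.
Qed.

Lemma sat_flow_taylor x (a b : R) : 0 <= a -> 0 <= b ->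
  `|sat_flow b x - sat_flow a x + (b - a) *: sat (sat_flow a x)| <= 1 * (b - a) ^+ 2.
Proof.
move=> a0 b0; rewrite mul1r -[leRHS]ger0_norm ?sqr_ge0//; apply: norm_le_cst.
have h1 : {ae mu, forall s, Lrepr (sat_flow b x - sat_flow a x) s =
    phi b (Lrepr x s) - phi a (Lrepr x s)}.
  apply: (ae_imp3 (aeB (sat_flow b x) (sat_flow a x)) (ae_sat_flow b x) (ae_sat_flow a x)) => s.
  by move=> -> -> ->.
have h2 : {ae mu, forall s, Lrepr ((b - a) *: sat (sat_flow a x)) s =
    (b - a) * sat_real (phi a (Lrepr x s))}.
  apply: (ae_imp3 (aeZ (b - a) (sat (sat_flow a x))) (ae_sat (sat_flow a x)) (ae_sat_flow a x)).
  by move=> s -> -> ->.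
apply: (ae_imp3 (aeD (sat_flow b x - sat_flow a x) ((b - a) *: sat (sat_flow a x))) h1 h2) => s.
by move=> -> -> ->; exact: phi_taylor.
Qed.

Lemma sat_flow_decay M t x : 1 <= M -> 0 <= t -> {ae mu, forall s, `|Lrepr x s| <= M} ->
  `|sat_flow t x| <= expR (- M^-1 * t) * `|x|.
Proof.
move=> M1 t0 xM; apply: norm_le_ae; first exact: expR_ge0.
by apply: (ae_imp2 (ae_sat_flow t x) xM) => s -> xs; exact: phi_decay.
Qed.

(* Tall narrow pulses of norm 1 lose only the fraction [t / n] of their height by time [t]. *)
Lemma sat_flow_pulse (n : nat) t : 0 <= t -> 1 + t <= n%:R ->
  exists2 x, `|x| = 1 & `|sat_flow t x| = 1 - t / n%:R.
Proof.
move=> t0 tn; have n0 : 0 < n%:R :> R by apply: lt_le_trans tn; rewrite ltr_wpDr.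
have n1 : 1 <= n%:R :> R by apply: le_trans tn; rewrite lerDl.
(* Width [n ^ -2] is what gives a pulse of height [n] the norm 1. *)
pose p : X := indic_oo 0 (n%:R^-1 ^+ 2).
have np : `|p| = n%:R^-1.
  apply: (@pexpIrn _ 2) => //; rewrite ?nnegrE ?invr_ge0 ?(ltW n0)//.
  by rewrite norm_indic_oo_sqr ?subr0 ?sqr_ge0// expr_le1 ?invr_ge0 ?(ltW n0)// invf_le1.
exists (n%:R *: p).
  by rewrite normrZ np (gtr0_norm n0) divff// gt_eqF.
have -> : sat_flow t (n%:R *: p) = (n%:R - t) *: p.
  apply/L2_eqP.
  apply: (ae_imp3 (ae_sat_flow t (n%:R *: p)) (aeZ n%:R p) _ (S' := fun s => _)).
    exact: (@filterS2 _ _ (ae_filter_ringOfSetsType mu) _ _ _ (fun s h1 h2 => conj h1 h2)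
      (aeZ (n%:R - t) p) (ae_Lclass (indic_oo_Lfun 0 (n%:R^-1 ^+ 2)))).
  move=> s -> -> [-> ->]; rewrite indicE; case: (_ \in _); rewrite /= ?mulr1 ?mulr0 ?phi_0//.
  exact: phi_large.
rewrite normrZ np ger0_norm ?subr_ge0; last by apply: le_trans tn; rewrite lerDr.
by rewrite mulrBl divff// gt_eqF.
Qed.

Lemma sat_flow_no_uniform_decay (b : R -> R) : b t @[t --> +oo] --> 0 ->
  exists x t, [/\ `|x| = 1, 0 <= t & b t < `|sat_flow t x|].
Proof.
move=> b0; have h : 0 < 2^-1 :> R by rewrite invr_gt0.
near (+oo : set_system R) => t.
have t0 : 0 <= t by near: t; exact: nbhs_pinfty_ge.
have bt : b t < 2^-1.
  rewrite -[ltLHS]subr0; apply: le_lt_trans (ler_norm _) _.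
  by near: t; exact: cvgr_distC_lt.
(* With this height the lost fraction [t / n] is at most one half, while [b t] is below one half. *)
have [n tt] : exists n : nat, 1 + t * 2 <= n%:R.
  by exists (Num.trunc (1 + t * 2)).+1; rewrite ltW// truncnS_gt.
have [||x x1 xt] := @sat_flow_pulse n t => //.
  by apply: le_trans tt; rewrite lerD2l ler_peMr// ler1n.
exists x, t; split => //; apply: lt_le_trans bt _.
rewrite xt; move: tt; move: (n%:R) => m tt.
have m0 : 0 < m by apply: lt_le_trans tt; rewrite ltr_wpDr// mulr_ge0.
have : t / m <= 2^-1.
  by rewrite ler_pdivrMr// mulrC ler_pdivlMr//; move: tt; clear; lra.
by clear; lra.
Unshelve. all: by end_near. Qed.

(** Frozen at negative times, because the Lipschitz bound asked of a flow ranges over all real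
    times. *)
Definition lin_flow t x : X := expR (- Num.max t 0) *: x.

Lemma lin_flow0 x : lin_flow 0 x = x.
Proof. by rewrite /lin_flow maxxx oppr0 expR0 scale1r. Qed.

Lemma lin_flow_lip x (a b : R) : `|lin_flow a x - lin_flow b x| <= `|x| * `|a - b|.
Proof.
rewrite -scalerBl normrZ mulrC ler_wpM2l//.
have le0 (c : R) : - Num.max c 0 <= 0 by rewrite oppr_le0 le_max lexx orbT.
(* On nonpositive arguments [expR] is [kappa], so the estimates of the saturated flow serve the
   linear one too. *)
rewrite -!kappa_le0E//; apply: le_trans (kappa_lip _ _) _.
rewrite opprK addrC distrC.
have [a0|/ltW a0] := leP 0 a; have [b0|/ltW b0] := leP 0 b => //.
- by rewrite subr0 ger0_norm// ger0_norm ?subr_ge0 ?(le_trans b0)// lerDl oppr_ge0.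
- rewrite sub0r normrN ger0_norm// distrC ger0_norm ?subr_ge0 ?(le_trans a0)//.
  by rewrite lerDl oppr_ge0.
- by rewrite subrr normr0.
Qed.

Lemma lin_flow_taylor x (a b : R) : 0 <= a -> 0 <= b ->
  `|lin_flow b x - lin_flow a x + (b - a) *: lin_flow a x| <= `|x| * (b - a) ^+ 2.
Proof.
move=> a0 b0; rewrite /lin_flow (max_l a0) (max_l b0) scalerA -scalerBl -scalerDl normrZ.
rewrite mulrC ler_wpM2l//; have := kappa_taylor (- a) (b - a).
have -> : - a - (b - a) = - b by ring.
by rewrite !kappa_le0E ?oppr_le0// /dkappa min_l ?oppr_le0.
Qed.

Lemma class_KL_exp : class_KL (fun r t : R => r * expR (- t)).
Proof.
split.
- apply: continuous_subspaceT => z; apply: cvgM; first exact: cvg_fst.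
  by apply: continuous_comp; [apply: cvgN; exact: cvg_snd|exact: continuous_expR].
- by move=> r t r0 _; rewrite mulr_ge0// expR_ge0.
- move=> t t0; split; last by rewrite mul0r.
  + by apply: continuous_subspaceT => r; apply: cvgM; [exact: cvg_id|exact: cvg_cst].
  + by move=> r s r0 rs; rewrite ltr_pM2r// expR_gt0.
- move=> r r0; split.
  + apply: continuous_subspaceT => t; apply: cvgM; first exact: cvg_cst.
    by apply: continuous_comp; [apply: cvgN; exact: cvg_id|exact: continuous_expR].
  + by move=> t s t0 ts; rewrite ltr_pM2l// ltr_expR ltrN2.
  + by rewrite -[X in _ --> X](mulr0 r); apply: cvgM; [exact: cvg_cst|exact: cvgr_expR].
Qed.

(** The Sobolev embedding in one dimension: [x] is [k + prim g] with primitive bounded by [|g|], and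
    comparing the constant with [x] in norm gives [|k| <= |x| + |g|]. The sum [|x| + 2 * |g|]
    accounts for the factor 2. *)
Lemma H1_periodic_bounded x : H1_periodic x ->
  {ae mu, forall s, `|Lrepr x s| <= 2 * graph_norm (@ddxi R) x}.
Proof.
move=> /H1_periodic_ac[_ [k xk]]; set g := ddxi x in xk *.
have pg s : 0 < s < 1 -> `|prim g s| <= `|g|.
  by move=> /andP[s0 s1]; rewrite -[prim g s]subr0 -(prim0 g) norm_prim_le// ltW.
have kx : `|k| <= `|x| + `|g|.
  rewrite -norm_L2cst -(subrK x (L2cst k)) addrC; apply: le_trans (ler_normD _ _) _.
  rewrite lerD2l -[leRHS]normr_id; apply: norm_le_cst.
  have h : {ae mu, forall s, Lrepr (L2cst k - x) s = - prim g s}.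
    apply: (ae_imp3 (aeB (L2cst k) x) (ae_Lclass (cst_Lfun k)) xk) => s -> -> -> /=.
    by rewrite opprD addNKr.
  by apply: (ae_imp2 h ae_mu01_itv) => s -> /pg; rewrite normrN.
apply: (ae_imp2 xk ae_mu01_itv) => s -> /pg ps; rewrite /graph_norm -/g.
apply: le_trans (ler_normD _ _) _; apply: le_trans (lerD kx ps) _.
have := normr_ge0 x; move: `|x| `|g| => u v; clear; lra.
Qed.

Lemma Lnormy_le x (c : R) : {ae mu, forall s, `|Lrepr x s| <= c} ->
  ('N[mu]_+oo[EFin \o Lrepr x] <= c%:E)%E.
Proof.
move=> xc; rewrite unlock /Lnorm ifT; last by rewrite -/mu mu01_setT.
by apply/ess_supP; apply: (ae_imp xc) => s /=; rewrite lee_fin.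
Qed.

Lemma Linf_norm0 t : Linf_norm t (cst (0 : X)) = 0%E.
Proof.
rewrite /Linf_norm (_ : EFin \o _ = cst 0%E); first exact: Lnorm0.
by apply/funext => s /=; rewrite normr0.
Qed.

Lemma Linf_loc0 : Linf_loc (cst (0 : X)).
Proof.
split; last by move=> t t0; rewrite Linf_norm0.
exists (fun=> cst 0); split; last by apply: aeW => t _; exact: cvg_cst.
move=> n; split.
  by apply: (@sub_finite_set _ _ [set 0]) => // _ [s _ <-].
by move=> v; rewrite preimage_cst; case: ifP.
Qed.

End flows.

(** * The assertions on the linear and the saturated system *)

Section saturated_shift.
Context {R : realType}.
Local Notation X := (L2 R).
Variables (T : R -> {linear X -> X}) (Bs : X -> X).
Hypothesis genT : generates_contraction_semigroup (@H1_periodic R) (@ddxi R) T.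
Hypothesis adjB : is_adjoint idfun Bs.

Lemma linear_UGAS : UGAS T idfun Bs idfun.
Proof.
exists (fun r t => r * expR (- t)); first exact: class_KL_exp.
move=> x0; have [H1 H2] := flow_mild_solutions genT adjB (sigma := idfun)
  (fun u v => lexx _) (fun _ _ => erefl) (lin_flow0 x0) (lin_flow_lip x0)
  (@lin_flow_taylor R x0) (d := cst 0) (fun=> erefl).
split => // x gx t t0; rewrite (H2 x gx t t0) /lin_flow (max_l t0) normrZ.
by rewrite ger0_norm ?expR_ge0// mulrC.
Qed.

Lemma sat_solutions x0 : mild_solutions_global T idfun Bs (@sat R) x0 (cst 0) /\
  forall x, global_mild_solution T idfun Bs (@sat R) x0 (cst 0) x ->
    forall t, 0 <= t -> `|x t| = `|sat_flow t x0|.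
Proof.
exact: (flow_mild_solutions genT adjB (@sat_lip R) (@sat_shift R) (sat_flow0 x0)
  (sat_flow_lip x0) (@sat_flow_taylor R x0) (d := cst 0) (fun=> erefl)).
Qed.

Lemma generator_Z (a : R) x : H1_periodic x ->
  H1_periodic (a *: x) /\ ddxi (a *: x) = a *: ddxi x.
Proof.
move=> Dx; apply/genT.2.
rewrite (_ : (fun h => _) = (fun h => a *: (h^-1 *: (T h x - x)))).
  by apply: cvgZl_tmp; apply/genT.2.
by apply/funext => h; rewrite linearZ/= -scalerBr !scalerA mulrC.
Qed.

(** With half the identity the left-hand side equals [inner (ddxi x) x - inner x x], and the
    generator is dissipative. *)
Lemma Lyapunov_operator : exists P : {linear X -> X},
  [/\ exists M : R, forall x, `|P x| <= M * `|x|,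
      forall x y, inner (P x) y = inner x (P y),
      forall x, H1_periodic x -> H1_periodic (P x) &
      forall x, H1_periodic x ->
        inner (ddxi x - Bs x) (P x) + inner (P x) (ddxi x - Bs x) <= - inner x x ].
Proof.
exists (2^-1 \*: (@idfun X)); split.
- by exists 2^-1 => x /=; rewrite normrZ ger0_norm.
- by move=> x y /=; rewrite innerZl innerZr.
- by move=> x Dx /=; have [] := generator_Z 2^-1 Dx.
- move=> x Dx /=; rewrite (adjoint_idfun adjB) (innerC (2^-1 *: x)) innerZr innerBl.
  by have := generator_dissipative genT Dx; lra.
Qed.

Lemma sat_semiglobal :
  semiglobally_exponentially_stable T idfun Bs (@sat R) (@H1_periodic R) (@ddxi R).
Proof.
(* The values of the initial state are bounded by [2 * r] through [H1_periodic_bounded]; the decay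
   estimate asks for a bound of at least 1. *)
move=> r r0; pose M := Num.max 1 (2 * r); have M1 : 1 <= M by rewrite le_max lexx.
exists M^-1, 1; split => //; first by rewrite invr_gt0 (lt_le_trans ltr01).
move=> x0 Dx xr; have [H1 H2] := sat_solutions x0; split => // x gx t t0.
rewrite (H2 x gx t t0) mul1r; apply: sat_flow_decay => //.
apply: (ae_imp (H1_periodic_bounded Dx)) => s /le_trans; apply.
by rewrite le_max ler_pM2l// xr orbT.
Qed.

(** Common core of both negations: on the unit sphere a KL bound is the single function [beta 1],
    which tends to 0, whereas pulses of norm 1 decay arbitrarily late. *)
Lemma sat_no_KL_estimate (beta : R -> R -> R) (x_ : X -> R -> X) : class_KL beta ->
  (forall x0, global_mild_solution T idfun Bs (@sat R) x0 (cst 0) (x_ x0)) ->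
  ~ (forall x0 t, 0 <= t -> `|x_ x0 t| <= beta `|x0| t).
Proof.
move=> [_ _ _ /(_ 1 ltr01)[_ _ b0]] gx H.
have [x0 [t [x1 t0]]] := sat_flow_no_uniform_decay b0.
by rewrite -((sat_solutions x0).2 _ (gx x0) t t0) ltNge -x1 H.
Qed.

End saturated_shift.

Theorem theorem1 (R : realType) :
  let X := L2 R in
  let A : X -> X := @ddxi R in
  let DA : set X := @H1_periodic R in
  let B : X -> X := idfun in
  (exists T : R -> {linear X -> X}, generates_contraction_semigroup DA A T) /\
  forall (T : R -> {linear X -> X}) (Bs : X -> X),
    generates_contraction_semigroup DA A T -> is_adjoint B Bs ->
    (* (i) *)
    [/\ UGAS T B Bs idfun,
        (let At : X -> X := fun x => A x - B (Bs x) in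
         exists P : {linear X -> X},
           [/\ exists M : R, forall x, `|P x| <= M * `|x|,
               forall x y, inner (P x) y = inner x (P y),
               forall x, DA x -> DA (P x) &
               forall x, DA x ->
                 inner (At x) (P x) + inner (P x) (At x) <= - inner x x ]) &
        exists2 c : R, 0 < c &
          forall x, DA x ->
            ('N[mu01 R]_+oo[EFin \o Lrepr (Bs x)] <= (c * graph_norm A x)%:E)%E]
    (* (ii) *)
    /\ semiglobally_exponentially_stable T B Bs (@sat R) DA A
    (* (iii) *)
    /\ (~ UGAS T B Bs (@sat R) /\ ~ ISS T B Bs (@sat R)).
Proof.
move=> X A DA B; split; first by exists shiftL; exact: shiftL_generates.
move=> T Bs genT adjB; split; [split|split; [|split]].
- exact: linear_UGAS.
- exact: Lyapunov_operator genT adjB.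
- exists 2 => // x Dx; rewrite (adjoint_idfun adjB).
  exact/Lnormy_le/H1_periodic_bounded.
- exact: sat_semiglobal.
- move=> [beta KLb H]; have [x_ gx] := choice (fun x0 => (H x0).1.1).
  apply: (sat_no_KL_estimate genT adjB KLb gx) => x0 t; exact: (H x0).2.
(* For the zero disturbance the gain term is [rho 0 = 0], so ISS would yield the excluded KL
   estimate. *)
- move=> [beta [rho [KLb [[_ _ rho0] _] H]]].
  have [x_ gx] := choice (fun x0 => (H x0 _ (@Linf_loc0 R)).1.1).
  apply: (sat_no_KL_estimate genT adjB KLb gx) => x0 t t0.
  by have := (H x0 _ (@Linf_loc0 R)).2 _ (gx x0) t t0; rewrite Linf_norm0 rho0 addr0.
Qed.
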